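(* There is a unique morphism of $\mathbb Q$-schemes $\sigma:\underline M\to\underline{Ell}$, $(\mu,\Phi)\mapsto(\mu,\Phi,A_+,A_-)$, where $$A_+=\Phi\Big(\tfrac{\mathrm{ad}x_1}{e^{\mathrm{ad}x_1}-1}(y_2),t_{12}\Big)\, e^{\mu\frac{\mathrm{ad}x_1}{e^{\mathrm{ad}x_1}-1}(y_2)}\,\Phi\Big(\tfrac{\mathrm{ad}x_1}{e^{\mathrm{ad}x_1}-1}(y_2),t_{12}\Big)^{-1},$$ $$A_-=e^{\mu t_{12}/2}\,\Phi\Big(\tfrac{\mathrm{ad}x_2}{e^{\mathrm{ad}x_2}-1}(y_1),t_{21}\Big)\,e^{x_1}\,\Phi\Big(\tfrac{\mathrm{ad}x_1}{e^{\mathrm{ad}x_1}-1}(y_2),t_{12}\Big)^{-1},$$ with $x_i:=x_i^+$, $y_i:=x_i^-$. It is compatible with the semigroup scheme morphism $s:\underline{GT}(-)\to\underline{GT}_{ell}(-)$, i.e. $\sigma(g*m)=s(g)*\sigma(m)$ for $g\in\underline{GT}(\mathbf k)$, $m\in\underline M(\mathbf k)$ and every commutative $\mathbb Q$-algebra $\mathbf k$.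
   Context: $\mathbf k$ denotes a commutative $\mathbb Q$-algebra; $\hat{\mathfrak f}_2^{\mathbf k}$ is the degree-completed free Lie algebra on $A,B$; $(g,h)=ghg^{-1}h^{-1}$. Lie algebras. $\mathfrak t_n^{\mathbf k}$: generators $t_{ij}=t_{ji}$ ($1\le i\ne j\le n$), relations $[t_{ij},t_{ik}+t_{jk}]=0$, $[t_{ij},t_{kl}]=0$ for distinct indices. $\mathfrak t_{1,n}^{\mathbf k}$: generators $x_i^\pm$ ($1\le i\le n$), relations $\sum_ix_i^\pm=0$, $[x_i^\pm,x_j^\pm]=0$ and $[x_i^+,x_j^-]=[x_j^+,x_i^-]$ ($i\ne j$), $[x_k^\pm,[x_i^+,x_j^-]]=0$ ($i,j,k$ distinct). Hats are degree completions ($\deg t_{ij}=1$ in $\mathfrak t_n$, $\deg x_i^\pm=1$). $x\mapsto\{x\}$ is the morphism $\mathfrak t_n\to\mathfrak t_{1,n}$, $t_{ij}\mapsto[x_i^+,x_j^-]=:t_{ij}$. For disjoint $I_1,\dots,I_n\subset\{1,\dots,p\}$, $x\mapsto x^{I_1,\dots,I_n}$ is the morphism $\mathfrak t_n\to\mathfrak t_p$, $t_{ij}\mapsto\sum_{a\in I_i,b\in I_j}t_{ab}$, and, when the $I_i$ partition $\{1,\dots,p\}$, the morphism $\mathfrak t_{1,n}\to\mathfrak t_{1,p}$, $x_i^\pm\mapsto\sum_{a\in I_i}x_a^\pm$. E.g. $A^{1,23}$: $x_1^\pm\mapsto x_1^\pm,\ x_2^\pm\mapsto x_2^\pm+x_3^\pm$.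 $\underline M(\mathbf k)$: pairs $(\mu,\Phi)\in\mathbf k\times\exp(\hat{\mathfrak f}_2^{\mathbf k})$ with $\Phi$ viewed in $\exp(\hat{\mathfrak t}_3^{\mathbf k})$ by $A\mapsto t_{12},B\mapsto t_{23}$, such that $\Phi^{3,2,1}=\Phi^{-1}$, $e^{\mu t_{23}/2}\Phi^{1,2,3}e^{\mu t_{12}/2}\Phi^{3,1,2}e^{\mu t_{31}/2}\Phi^{2,3,1}=e^{\mu(t_{12}+t_{13}+t_{23})/2}$, $\Phi^{2,3,4}\Phi^{1,23,4}\Phi^{1,2,3}=\Phi^{1,2,34}\Phi^{12,3,4}$. $\underline{Ell}(\mathbf k)$: quadruples $(\mu,\Phi,A_+,A_-)$ with $(\mu,\Phi)\in\underline M(\mathbf k)$, $A_\pm\in\exp(\hat{\mathfrak t}_{1,2}^{\mathbf k})$, such that $\alpha_\pm^{3,1,2}\alpha_\pm^{2,3,1}\alpha_\pm^{1,2,3}=1$ with $\alpha_\pm=\{e^{\pm\mu(t_{12}+t_{13})/2}\}A_\pm^{1,23}\{\Phi^{1,2,3}\}$, and $$\{e^{\mu t_{12}}\}=\big(\{\Phi\}^{-1}A_-^{1,23}\{\Phi\},\{e^{-\mu t_{12}/2}(\Phi^{2,1,3})^{-1}\}(A_+^{2,13})^{-1}\{\Phi^{2,1,3}e^{-\mu t_{12}/2}\}\big).$$ $\underline{GT}$ side. $F_2$ is free on $X,Y$; $G(\mathbf k)$ denotes $\mathbf k$-prounipotent completion. $B_n$ is the braid group, $P_n$ the pure braid group.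 $B_{1,n}$ has generators $\sigma_1,\dots,\sigma_{n-1},X_1^\pm$ and relations: Artin relations; $(\sigma_1^{\pm1}X_1^\pm)^2=(X_1^\pm\sigma_1^{\pm1})^2$; $(X_1^\pm,\sigma_i)=1$ for $i\ge2$; $(X_1^-,(X_2^+)^{-1})=\sigma_1^2$; $X_1^\pm\cdots X_n^\pm=1$ with $X_{i+1}^\pm=\sigma_i^{\pm1}X_i^\pm\sigma_i^{\pm1}$; $P_{1,n}=\ker(B_{1,n}\to S_n)$; $B_{1,n}(\mathbf k)=P_{1,n}(\mathbf k)*_{P_{1,n}}B_{1,n}$. $\underline{GT}(\mathbf k)$: pairs $(\lambda,f)\in\mathbf k\times F_2(\mathbf k)$ with ($m=\frac{\lambda-1}2$) $f(Y,X)=f(X,Y)^{-1}$; $f(X_3,X_1)X_3^mf(X_2,X_3)X_2^mf(X_1,X_2)X_1^m=1$ for $X_1=X,X_2=Y,X_1X_2X_3=1$; $f(\sigma_1^2,\sigma_2\sigma_3^2\sigma_2)f(\sigma_2\sigma_1^2\sigma_2,\sigma_3^2)=f(\sigma_2^2,\sigma_3^2)f(\sigma_1\sigma_2^2\sigma_1,\sigma_3\sigma_2^2\sigma_3)f(\sigma_1^2,\sigma_2^2)$ in $P_4(\mathbf k)$; product $(\lambda,f)(\lambda',f')=(\lambda\lambda',f(f'X^{\lambda'}f'^{-1},Y^{\lambda'})f')$. $\underline{GT}_{ell}(\mathbf k)$: $(\lambda,f,g_\pm)$ with $(\lambda,f)\in\underline{GT}(\mathbf k)$, $g_\pm\in F_2(\mathbf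 k)$ such that in $B_{1,3}(\mathbf k)$ (with $g_\pm=g_\pm(X_1^+,X_1^-)$, $\sigma_1^\lambda=\sigma_1(\sigma_1^2)^m$) $(\sigma_2^{\pm1}\sigma_1^{\pm1}(\sigma_1\sigma_2^2\sigma_1)^{\pm m}g_\pm f(\sigma_1^2,\sigma_2^2))^3=1$, $u^2=(g_-,u^{-1}g_+^{-1}u^{-1})$ with $u=f(\sigma_1^2,\sigma_2^2)\sigma_1^\lambda f(\sigma_1^2,\sigma_2^2)^{-1}$; product $g''_\pm=g_\pm(g'_+,g'_-)$. Actions: $(\lambda,f)*(\mu,\Phi)=\big(\lambda\mu,\Phi(A,B)f(e^{\mu A},\Phi(A,B)^{-1}e^{\mu B}\Phi(A,B))\big)$; $(\lambda,f,g_\pm)*(\mu,\Phi,A_\pm)=((\lambda,f)*(\mu,\Phi),g_\pm(A_+,A_-))$. The morphism $s$ sends $(\lambda,f)$ to $(\lambda,f,g_\pm)$ with $g_+=f(X,(Y,X))X^\lambda f(X,(Y,X))^{-1}$, $g_-=(Y,X)^{(\lambda-1)/2}f(YX^{-1}Y^{-1},(Y,X))Yf(X,(Y,X))^{-1}$. *)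

(* Defs.v *)
From HB Require Import structures.
From mathcomp Require Import all_boot all_order all_fingroup all_algebra.
From mathcomp Require Import boolp.
From mathcomp.multinomials Require Import monalg.

Set Implicit Arguments.
Unset Strict Implicit.
Unset Printing Implicit Defensive.

Import GRing.Theory.
Local Open Scope ring_scope.

(* [ncseries k X] is k<<X>>: a series is the family of its coefficients,
   indexed by the words in the letters [X].  A record is used, rather than the
   bare function type, so that the product below is the convolution product and
   not the pointwise one. *)
Record ncseries (k : Type) (X : Type) := NCSeries { ncoef :> seq X -> k }.

HB.instance Definition _ (k X : Type) := gen_eqMixin (ncseries k X).
HB.instance Definition _ (k X : Type) := gen_choiceMixin (ncseries k X).

Lemma ncseriesP (k X : Type) (a b : ncseries k X) :
  (forall w, a w = b w) -> a = b.
Proof. by case: a b => [a] [b] /= ab; congr NCSeries; apply: funext. Qed.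

Section SeriesRing.
Variables (k : comNzRingType) (X : Type).
Implicit Types (a b c : ncseries k X) (w : seq X).

Definition nczero := NCSeries (fun _ : seq X => 0 : k).
Definition ncopp a := NCSeries (fun w => - a w).
Definition ncadd a b := NCSeries (fun w => a w + b w).
Definition ncone := NCSeries (fun w : seq X => (nilp w)%:R : k).
Definition ncmul a b := NCSeries (fun w =>
  \sum_(i < (size w).+1) a (take i w) * b (drop i w)).
Definition ncscale (l : k) a := NCSeries (fun w => l * a w).

Fact ncaddA : associative ncadd.
Proof. by move=> a b c; apply: ncseriesP => w /=; rewrite addrA. Qed.
Fact ncaddC : commutative ncadd.
Proof. by move=> a b; apply: ncseriesP => w /=; rewrite addrC. Qed.
Fact ncadd0 : left_id nczero ncadd.
Proof. by move=> a; apply: ncseriesP => w /=; rewrite add0r. Qed.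
Fact ncaddN : left_inverse nczero ncopp ncadd.
Proof. by move=> a; apply: ncseriesP => w /=; rewrite addNr. Qed.

HB.instance Definition _ :=
  GRing.isZmodule.Build (ncseries k X) ncaddA ncaddC ncadd0 ncaddN.

(* The left derivative by a letter, used to reason by induction on words. *)
Definition ncder (x : X) a := NCSeries (fun w => a (x :: w)).

Lemma ncmul_nil a b : ncmul a b [::] = a [::] * b [::].
Proof. by rewrite /= big_ord1. Qed.

Lemma ncmul_cons a b x w :
  ncmul a b (x :: w) = a [::] * b (x :: w) + ncmul (ncder x a) b w.
Proof. by rewrite /= big_ord_recl. Qed.

Fact ncmulDl : left_distributive ncmul ncadd.
Proof.
move=> a b c; apply: ncseriesP => w /=; rewrite -big_split /=.
by apply: eq_bigr => i _; rewrite mulrDl.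
Qed.
Fact ncmulDr : right_distributive ncmul ncadd.
Proof.
move=> a b c; apply: ncseriesP => w /=; rewrite -big_split /=.
by apply: eq_bigr => i _; rewrite mulrDr.
Qed.
Fact ncscaleAl l a b : ncscale l (ncmul a b) = ncmul (ncscale l a) b.
Proof.
apply: ncseriesP => w /=; rewrite big_distrr /=.
by apply: eq_bigr => i _; rewrite mulrA.
Qed.
Fact ncscaleAr l a b : ncscale l (ncmul a b) = ncmul a (ncscale l b).
Proof.
apply: ncseriesP => w /=; rewrite big_distrr /=.
by apply: eq_bigr => i _; rewrite mulrCA.
Qed.

Lemma ncder_mul x a b :
  ncder x (ncmul a b) = ncadd (ncscale (a [::]) (ncder x b)) (ncmul (ncder x a) b).
Proof. by apply: ncseriesP => w; apply: ncmul_cons. Qed.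

Fact ncmulA : associative ncmul.
Proof.
move=> a b c; apply: ncseriesP => w.
elim: w a b c => [|x w IH] a b c; first by rewrite !ncmul_nil mulrA.
rewrite !ncmul_cons IH ncder_mul ncmulDl -ncscaleAl ncmul_nil.
by rewrite mulrDr mulrA /= addrA.
Qed.
Fact ncmul1l : left_id ncone ncmul.
Proof.
move=> a; apply: ncseriesP => w /=.
rewrite big_ord_recl /= take0 drop0 mul1r big1 ?addr0 // => i _.
by case: w i => [[]|x w i] //=; rewrite mul0r.
Qed.
Fact ncmul1r : right_id ncone ncmul.
Proof.
move=> a; apply: ncseriesP => w /=.
rewrite big_ord_recr /= take_size drop_size mulr1 big1 ?add0r // => i _.
rewrite /nilp size_drop subn_eq0 leqNgt ltn_ord mulr0 //.
Qed.
Fact ncone_neq0 : ncone != nczero.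
Proof.
apply/eqP => /(congr1 (fun a : ncseries k X => a [::])) /= /eqP.
by rewrite oner_eq0.
Qed.

HB.instance Definition _ := GRing.Zmodule_isNzRing.Build (ncseries k X)
  ncmulA ncmul1l ncmul1r ncmulDl ncmulDr ncone_neq0.

Fact ncscaleA l m a : ncscale l (ncscale m a) = ncscale (l * m) a.
Proof. by apply: ncseriesP => w /=; rewrite mulrA. Qed.
Fact ncscale1 : left_id 1 ncscale.
Proof. by move=> a; apply: ncseriesP => w /=; rewrite mul1r. Qed.
Fact ncscaleDr : right_distributive ncscale +%R.
Proof. by move=> l a b; apply: ncseriesP => w /=; rewrite mulrDr. Qed.
Fact ncscaleDl a : {morph ncscale^~ a : l m / l + m}.
Proof. by move=> l m; apply: ncseriesP => w /=; rewrite mulrDl. Qed.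

HB.instance Definition _ := GRing.Zmodule_isLmodule.Build k (ncseries k X)
  ncscaleA ncscale1 ncscaleDr ncscaleDl.
HB.instance Definition _ :=
  GRing.Lmodule_isLalgebra.Build k (ncseries k X) ncscaleAl.
HB.instance Definition _ :=
  GRing.Lalgebra_isAlgebra.Build k (ncseries k X) ncscaleAr.

End SeriesRing.

Definition letter (k : comNzRingType) (X : eqType) (x : X) : ncseries k X :=
  NCSeries (fun w => (w == [:: x])%:R).

Definition ncmap (k k' X : Type) (phi : k -> k') (a : ncseries k X) :=
  NCSeries (fun w => phi (a w)).

Definition agree_below (k X : Type) (n : nat) (a b : ncseries k X) : Prop :=
  forall w, (size w < n)%N -> a w = b w.

Definition lie (A : pzRingType) (a b : A) : A := a * b - b * a.

Section Series.
Variables (k : comAlgType rat) (X : finType).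
Implicit Types (a b u v : ncseries k X).

(* The sum of the [u n], when [u n] has no term of degree less than [n]. *)
Definition ncsum (u : nat -> ncseries k X) : ncseries k X :=
  NCSeries (fun w => \sum_(n < (size w).+1) u n w).

(* [ncexp a] is meaningful when [a] has zero constant term; [nclog u] and
   [ncinv u] are meaningful when [u] has constant term 1. *)
Definition ncexp a := ncsum (fun n => ((n`!%:R)^-1 : rat)%:A *: a ^+ n).
Definition ncinv u := ncsum (fun n => (1 - u) ^+ n).
Definition nclog u := ncsum (fun n =>
  (if n is m.+1 then (-1) ^+ m / n%:R else 0 : rat)%:A *: (u - 1) ^+ n).

Definition ncpow u (l : k) := ncexp (l *: nclog u).
Definition gcomm u v := u * v * ncinv u * ncinv v.

(* The Lie k-subalgebra generated by the letters, and its degree completion. *)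
Inductive lie_poly : ncseries k X -> Prop :=
| lie_poly0 : lie_poly 0
| lie_poly_letter x : lie_poly (letter k x)
| lie_poly_lin (l : k) a b : lie_poly a -> lie_poly b -> lie_poly (l *: a + b)
| lie_poly_lie a b : lie_poly a -> lie_poly b -> lie_poly (lie a b).

Definition lie_series a : Prop :=
  forall n, exists2 b, lie_poly b & agree_below n a b.

Definition is_lie_exp u : Prop := exists2 a, lie_series a & u = ncexp a.

End Series.

(* Substitution of series [s x] with zero constant term for the letters [x]. *)
Definition subst (k : comAlgType rat) (X Y : finType)
    (s : X -> ncseries k Y) (a : ncseries k X) : ncseries k Y :=
  ncsum (fun n => \sum_(w : n.-tuple X) a w *: \prod_(x <- w) s x).

(* [todd n] is the coefficient of t^n in t / (e^t - 1); see [toddP]. *)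
Fixpoint todd_seq (n : nat) : seq rat :=
  if n is m.+1 then
    rcons (todd_seq m)
      ((m == 0)%:R - \sum_(j < m) (todd_seq m)`_j / ((m.+1 - j)`!)%:R)
  else [::].
Definition todd (n : nat) : rat := (todd_seq n.+1)`_n.

Lemma size_todd_seq n : size (todd_seq n) = n.
Proof. by elim: n => //= n IH; rewrite size_rcons IH. Qed.

Lemma nth_todd_seq n j : (j < n)%N -> (todd_seq n)`_j = todd j.
Proof.
elim: n => // n IH; rewrite ltnS leq_eqVlt => /orP[/eqP->//|jn].
by rewrite /= nth_rcons size_todd_seq jn IH.
Qed.

Lemma toddP n : \sum_(j < n.+1) todd j / ((n.+1 - j)`!)%:R = (n == 0)%:R.
Proof.
rewrite big_ord_recr /= subSnn divr1 {2}/todd /= nth_rcons size_todd_seq.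
rewrite ltnn eqxx addrCA -[RHS]addr0; congr (_ + _).
rewrite -sumrB big1 // => j _.
by rewrite nth_todd_seq ?subrr.
Qed.

(* (ad x / (e^{ad x} - 1))(y) *)
Definition todd_ad (k : comAlgType rat) (X : finType) (x y : ncseries k X) :=
  ncsum (fun n => (todd n)%:A *: iter n (lie x) y).

Inductive ideal_span (A : pzRingType) (S : A -> Prop) : A -> Prop :=
| ideal_span0 : ideal_span S 0
| ideal_spanD (a s b c : A) :
    S s -> ideal_span S c -> ideal_span S (a * s * b + c).

(* Let g be the Lie k-algebra with generators [X] and homogeneous relators
   [R].  Its enveloping algebra is k<X>/(R), whose degree completion is the
   quotient of k<<X>> by the closure of the ideal spanned by [R]; [cong R] is
   equality in that quotient.  As k contains Q, g embeds into U(g), so the group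
   exp(g^) is identified with the image in this quotient of the group of the
   series satisfying [is_lie_exp].  Thus elements of exp(g^) are represented by
   series [u] with [is_lie_exp u], and are compared by [cong R]. *)
Definition cong (k : comAlgType rat) (X : finType)
    (R : ncseries k X -> Prop) (a b : ncseries k X) : Prop :=
  forall n, exists2 c, ideal_span R c & agree_below n (a - b) c.

(* Indices of strands are numbered from 1: [ix i] is the i-th element of
   {1, ..., n.+1}. *)
Definition ix (n i : nat) : 'I_n.+1 := inord i.-1.

(* Blocks (I_1, ..., I_n) of subsets of {1, ..., p}, given as lists. *)
Definition block (p : nat) (I : seq (seq nat)) (i : nat) : pred 'I_p :=
  fun a => a.+1 \in nth [::] I i.

Section InfinitesimalBraids.
Variables (k : comAlgType rat) (n : nat).

Definition tgen := {p : 'I_n * 'I_n | p.1 != p.2}.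

(* By convention [tij i i = 0]. *)
Definition tij (i j : 'I_n) : ncseries k tgen :=
  if insub (i, j) is Some g then letter k (g : tgen) else 0.

Inductive trel : ncseries k tgen -> Prop :=
| trel_sym i j : i != j -> trel (tij i j - tij j i)
| trel_tri i j l : uniq [:: i; j; l] -> trel (lie (tij i j) (tij i l + tij j l))
| trel_far i j l m : uniq [:: i; j; l; m] -> trel (lie (tij i j) (tij l m)).

(* [xx true i] is x_i^+ and [xx false i] is x_i^-. *)
Definition egen := (bool * 'I_n)%type.
Definition xx (e : bool) (i : 'I_n) : ncseries k egen := letter k (e, i).

Inductive erel : ncseries k egen -> Prop :=
| erel_sum e : erel (\sum_i xx e i)
| erel_comm e i j : i != j -> erel (lie (xx e i) (xx e j))
| erel_sym i j : i != j ->
    erel (lie (xx true i) (xx false j) - lie (xx true j) (xx false i))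
| erel_far e i j l : uniq [:: i; j; l] ->
    erel (lie (xx e l) (lie (xx true i) (xx false j))).

Definition te (i j : 'I_n) : ncseries k egen := lie (xx true i) (xx false j).

(* x |-> {x} *)
Definition brace : ncseries k tgen -> ncseries k egen :=
  subst (fun g : tgen => te (val g).1 (val g).2).

End InfinitesimalBraids.

Arguments tij {k n}.
Arguments xx {k n}.
Arguments te {k n}.
Arguments trel {k n}.
Arguments erel {k n}.

(* x |-> x^{I_1, ..., I_n} *)
Definition tins (k : comAlgType rat) (n p : nat) (I : seq (seq nat)) :
    ncseries k (tgen n) -> ncseries k (tgen p) :=
  subst (fun g : tgen n =>
    \sum_(a | block I (val g).1 a) \sum_(b | block I (val g).2 b) tij a b).

Definition eins (k : comAlgType rat) (n p : nat) (I : seq (seq nat)) :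
    ncseries k (egen n) -> ncseries k (egen p) :=
  subst (fun g : egen n => \sum_(a : 'I_p | block I g.2 a) xx g.1 a).

Section Free.
Variable k : comAlgType rat.

Definition f2 := ncseries k bool.
Definition serA : f2 := letter k false.
Definition serB : f2 := letter k true.

(* Phi(a, b), for a and b in a complete Lie algebra *)
Definition ev2 (X : finType) (Phi : f2) (a b : ncseries k X) : ncseries k X :=
  subst (fun x : bool => if x then b else a) Phi.

(* The prounipotent completion F_2(k) is exp(f_2^), with X = e^A and Y = e^B.
   Thus f(u, v), for u and v in a prounipotent group, is obtained by
   substituting log u and log v for A and B. *)
Definition grX : f2 := ncexp serA.
Definition grY : f2 := ncexp serB.
Definition gev2 (X : finType) (f : f2) (u v : ncseries k X) : ncseries k X :=
  ev2 f (nclog u) (nclog v).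

End Free.

Arguments serA {k}.
Arguments serB {k}.
Arguments grX {k}.
Arguments grY {k}.

Definition half (k : comAlgType rat) (l : k) : k := (2^-1 : rat) *: l.

Section PresentedGroup.
Variables (k : comAlgType rat) (L : choiceType).

(* Words in the generators of a group: (l, true) stands for the generator l and
   (l, false) for its inverse. *)
Definition word := seq (L * bool).
Definition winv (w : word) : word := rev [seq (x.1, ~~ x.2) | x <- w].
Definition wcomm (u v : word) : word := u ++ v ++ winv u ++ winv v.

Definition free_alg := {malg k[{fmonom (L * bool)%type}]}.
Definition mon (w : word) : free_alg := << FMonom w >>.

Variables (rel : word -> word -> Prop) (T : finGroupType) (pi : L -> T).

Definition wmap (w : word) : T :=
  (\prod_(x <- w) (if x.2 then pi x.1 else (pi x.1)^-1))%g.

(* Let G be the group presented by [rel], mapping to T by [pi], let P be the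
   kernel and I the augmentation ideal of k[P].  [acong N] is equality in
   k[G] / k[G] I^N. *)
Inductive arel (N : nat) : free_alg -> Prop :=
| arel_rel u v : rel u v -> arel N (mon u - mon v)
| arel_inv x e : arel N (mon [:: (x, e); (x, ~~ e)] - 1)
| arel_aug (p : N.-tuple word) : all (fun w => wmap w == 1%g) p ->
    arel N (\prod_(w <- p) (mon w - 1)).

Definition acong (N : nat) (a b : free_alg) : Prop :=
  ideal_span (arel N) (a - b).

(* P(k) is the group of group-like elements of lim_N k[P] / I^N, and
   P(k) *_P G is the subgroup generated by P(k) and G of the units of
   lim_N k[G] / k[G] I^N (which is free over lim_N k[P] / I^N on coset
   representatives).  The next definitions compute, modulo k[G] I^N, the
   logarithm and the powers u^l of u in P, and f(u, v) for f in F_2(k) and u, v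
   in P. *)
Definition alog (N : nat) (u : free_alg) : free_alg :=
  \sum_(1 <= n < N) (((-1) ^+ n.-1 / n%:R : rat)%:A : k) *: (u - 1) ^+ n.
Definition apow (N : nat) (u : free_alg) (l : k) : free_alg :=
  \sum_(0 <= n < N) ((((n`!)%:R)^-1 : rat)%:A * l ^+ n) *: alog N u ^+ n.
Definition aev2 (N : nat) (f : f2 k) (u v : free_alg) : free_alg :=
  \sum_(n < N) \sum_(w : n.-tuple bool)
    f w *: \prod_(x <- w) (if x then alog N v else alog N u).

End PresentedGroup.

Arguments mon {k L}.

(* Generators and relations of B_n and B_{1,n}, for n = m.+2. *)
Section Braids.
Variable m : nat.

(* [sg e i] is sigma_i if [e = true], its inverse if [e = false], for
   1 <= i <= m.+1. *)
Definition sg (e : bool) (i : nat) : word 'I_m.+1 := [:: (ix m i, e)].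

Definition sperm (i : 'I_m.+1) : 'S_m.+2 := tperm (inord i) (inord i.+1).

Inductive artin (L : choiceType) (s : nat -> word L) : word L -> word L -> Prop :=
| artin_braid i : (0 < i)%N -> (i < m.+1)%N ->
    artin s (s i ++ s i.+1 ++ s i) (s i.+1 ++ s i ++ s i.+1)
| artin_far i j : (0 < i)%N -> (i.+1 < j)%N -> (j <= m.+1)%N ->
    artin s (s i ++ s j) (s j ++ s i).

Definition brel := artin (sg true).

(* The generators of B_{1,n}: the sigma_i, and X_1^+ and X_1^-. *)
Definition ebgen := ('I_m.+1 + bool)%type.
Definition esg (e : bool) (i : nat) : word ebgen := [:: (inl (ix m i), e)].
Definition eX1 (e : bool) : word ebgen := [:: (inr e, true)].

(* [eX e i] is X_{i+1}^+ or X_{i+1}^-, according to [e]. *)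
Fixpoint eX (e : bool) (i : nat) : word ebgen :=
  if i is j.+1 then esg e j.+1 ++ eX e j ++ esg e j.+1 else eX1 e.

Inductive ebrel : word ebgen -> word ebgen -> Prop :=
| ebrel_artin u v : artin (esg true) u v -> ebrel u v
| ebrel_sq e :
    ebrel (esg e 1 ++ eX1 e ++ esg e 1 ++ eX1 e)
          (eX1 e ++ esg e 1 ++ eX1 e ++ esg e 1)
| ebrel_far e i : (1 < i)%N -> (i <= m.+1)%N ->
    ebrel (wcomm (eX1 e) (esg true i)) [::]
| ebrel_comm : ebrel (wcomm (eX1 false) (winv (eX true 1)))
                     (esg true 1 ++ esg true 1)
| ebrel_prod e : ebrel (flatten [seq eX e i | i <- iota 0 m.+2]) [::].

Definition esperm (x : ebgen) : 'S_m.+2 :=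
  match x with inl i => sperm i | inr _ => 1%g end.

End Braids.

(* A scheme over Q is handled through its functor of points k |-> F(k): F(k) is
   the set of the [x : pt k] with [is_point x], modulo the equivalence [eqv].
   Morphisms of schemes are natural transformations, by Yoneda's lemma.  A
   [comAlgType] is nonzero; over the zero algebra, every functor considered here
   has a single point. *)
Record Qfunctor := {
  pt : comAlgType rat -> Type;
  is_point : forall k : comAlgType rat, pt k -> Prop;
  eqv : forall k : comAlgType rat, pt k -> pt k -> Prop;
  base_change : forall k k' : comAlgType rat,
    {rmorphism k -> k'} -> pt k -> pt k' }.

Arguments is_point F {k} x : rename.
Arguments eqv F {k} x y : rename.
Arguments base_change F {k k'} phi x : rename.

Definition is_morphism (F G : Qfunctor)
    (tau : forall k : comAlgType rat, pt F k -> pt G k) : Prop :=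
  (forall (k : comAlgType rat) (x : pt F k), is_point F x -> is_point G (tau k x)) /\
  (forall (k : comAlgType rat) (x y : pt F k), is_point F x -> is_point F y ->
     eqv F x y -> eqv G (tau k x) (tau k y)) /\
  (forall (k k' : comAlgType rat) (phi : {rmorphism k -> k'}) (x : pt F k),
     is_point F x ->
     eqv G (tau k' (base_change F phi x)) (base_change G phi (tau k x))).

Record Qsemigroup := {
  sg_functor :> Qfunctor;
  sg_mul : forall k : comAlgType rat,
    pt sg_functor k -> pt sg_functor k -> pt sg_functor k }.

Section M.
Variable k : comAlgType rat.

Record Mpt := MPt { M_mu : k; M_Phi : f2 k }.

Definition Phi_t3 (Phi : f2 k) : ncseries k (tgen 3) :=
  ev2 Phi (tij (ix 2 1) (ix 2 2)) (tij (ix 2 2) (ix 2 3)).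

Definition is_M (m : Mpt) : Prop :=
  let: MPt mu Phi := m in
  let t i j : ncseries k (tgen 3) := tij (ix 2 i) (ix 2 j) in
  let e i j := ncexp (half mu *: t i j) in
  let P3 a b c : ncseries k (tgen 3) :=
    tins 3 [:: [:: a]; [:: b]; [:: c]] (Phi_t3 Phi) in
  let P4 a b c : ncseries k (tgen 4) := tins 4 [:: a; b; c] (Phi_t3 Phi) in
  [/\ is_lie_exp Phi,
      cong trel (P3 3 2 1) (ncinv (Phi_t3 Phi)),
      cong trel (e 2 3 * P3 1 2 3 * e 1 2 * P3 3 1 2 * e 3 1 * P3 2 3 1)
                (ncexp (half mu *: (t 1 2 + t 1 3 + t 2 3)))
    & cong trel
        (P4 [:: 2] [:: 3] [:: 4] * P4 [:: 1] [:: 2; 3] [:: 4]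
          * P4 [:: 1] [:: 2] [:: 3])
        (P4 [:: 1] [:: 2] [:: 3; 4] * P4 [:: 1; 2] [:: 3] [:: 4])].

End M.

Definition M : Qfunctor := {|
  pt := Mpt;
  is_point := is_M;
  eqv := fun k x y => x = y;
  base_change := fun k k' phi m => MPt (phi (M_mu m)) (ncmap phi (M_Phi m)) |}.

Section Ell.
Variable k : comAlgType rat.

Record Ellpt := EllPt {
  Ell_mu : k; Ell_Phi : f2 k;
  Ell_Ap : ncseries k (egen 2); Ell_Am : ncseries k (egen 2) }.

Definition is_Ell (x : Ellpt) : Prop :=
  let: EllPt mu Phi Ap Am := x in
  let t i j : ncseries k (tgen 3) := tij (ix 2 i) (ix 2 j) in
  let A e := if e then Ap else Am in
  let smu (e : bool) := if e then mu else - mu in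
  let A' e a b : ncseries k (egen 3) := eins 3 [:: a; b] (A e) in
  let P a b c : ncseries k (tgen 3) :=
    tins 3 [:: [:: a]; [:: b]; [:: c]] (Phi_t3 Phi) in
  let alpha e : ncseries k (egen 3) :=
    brace (ncexp (half (smu e) *: (t 1 2 + t 1 3)))
      * A' e [:: 1] [:: 2; 3] * brace (P 1 2 3) in
  let alpha' e a b c : ncseries k (egen 3) :=
    eins 3 [:: [:: a]; [:: b]; [:: c]] (alpha e) in
  let E := ncexp (- half mu *: t 1 2) in
  [/\ is_M (MPt mu Phi),
      is_lie_exp Ap /\ is_lie_exp Am,
      forall e, cong erel (alpha' e 3 1 2 * alpha' e 2 3 1 * alpha' e 1 2 3) 1
    & cong erel (brace (ncexp (mu *: t 1 2)))
        (gcomm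
          (ncinv (brace (P 1 2 3)) * A' false [:: 1] [:: 2; 3] * brace (P 1 2 3))
          (brace (E * ncinv (P 2 1 3)) * ncinv (A' true [:: 2] [:: 1; 3])
            * brace (P 2 1 3 * E)))].

Definition Ell_eqv (x y : Ellpt) : Prop :=
  [/\ Ell_mu x = Ell_mu y, Ell_Phi x = Ell_Phi y,
      cong erel (Ell_Ap x) (Ell_Ap y) & cong erel (Ell_Am x) (Ell_Am y)].

End Ell.

Definition Ell : Qfunctor := {|
  pt := Ellpt;
  is_point := is_Ell;
  eqv := Ell_eqv;
  base_change := fun k k' phi x =>
    EllPt (phi (Ell_mu x)) (ncmap phi (Ell_Phi x))
          (ncmap phi (Ell_Ap x)) (ncmap phi (Ell_Am x)) |}.

Section GT.
Variable k : comAlgType rat.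

Record GTpt := GTPt { GT_lambda : k; GT_f : f2 k }.

Definition is_GT (g : GTpt) : Prop :=
  let: GTPt lambda f := g in
  let m := half (lambda - 1) in
  let X1 := grX in let X2 := grY in let X3 := ncinv (X1 * X2) in
  let s i : word 'I_3 := sg 2 true i in
  let F N u v : free_alg k 'I_3 := aev2 N f (mon u) (mon v) in
  [/\ is_lie_exp f,
      gev2 f grY grX = ncinv f,
      gev2 f X3 X1 * ncpow X3 m * gev2 f X2 X3 * ncpow X2 m * gev2 f X1 X2
        * ncpow X1 m = 1
    & forall N, acong (@brel 2) (@sperm 2) N
        (F N (s 1 ++ s 1) (s 2 ++ s 3 ++ s 3 ++ s 2)
          * F N (s 2 ++ s 1 ++ s 1 ++ s 2) (s 3 ++ s 3))
        (F N (s 2 ++ s 2) (s 3 ++ s 3)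
          * F N (s 1 ++ s 2 ++ s 2 ++ s 1) (s 3 ++ s 2 ++ s 2 ++ s 3)
          * F N (s 1 ++ s 1) (s 2 ++ s 2))].

Definition GT_mul (g g' : GTpt) : GTpt :=
  let: GTPt lambda f := g in let: GTPt lambda' f' := g' in
  GTPt (lambda * lambda')
    (gev2 f (f' * ncpow grX lambda' * ncinv f') (ncpow grY lambda') * f').

Definition GT_act (g : GTpt) (m : Mpt k) : Mpt k :=
  let: GTPt lambda f := g in let: MPt mu Phi := m in
  MPt (lambda * mu)
    (Phi * gev2 f (ncexp (mu *: serA))
                  (ncinv Phi * ncexp (mu *: serB) * Phi)).

End GT.

Definition GT_functor : Qfunctor := {|
  pt := GTpt;
  is_point := is_GT;
  eqv := fun k x y => x = y;
  base_change := fun k k' phi g =>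
    GTPt (phi (GT_lambda g)) (ncmap phi (GT_f g)) |}.

Definition GT : Qsemigroup := {| sg_functor := GT_functor; sg_mul := GT_mul |}.

Section GTell.
Variable k : comAlgType rat.

Record GTellpt := GTellPt {
  GTell_lambda : k; GTell_f : f2 k; GTell_gp : f2 k; GTell_gm : f2 k }.

Definition is_GTell (g : GTellpt) : Prop :=
  let: GTellPt lambda f gp gm := g in
  let m := half (lambda - 1) in
  let s e i : word (ebgen 1) := esg 1 e i in
  let s1 := s true 1 in let s2 := s true 2 in
  let ev N (h : f2 k) u v : free_alg k (ebgen 1) := aev2 N h (mon u) (mon v) in
  let pow N u (l : k) : free_alg k (ebgen 1) := apow N (mon u) l in
  let F N := ev N f (s1 ++ s1) (s2 ++ s2) in
  let F' N := ev N (ncinv f) (s1 ++ s1) (s2 ++ s2) in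
  let Gp N := ev N gp (eX1 1 true) (eX1 1 false) in
  let Gp' N := ev N (ncinv gp) (eX1 1 true) (eX1 1 false) in
  let Gm N := ev N gm (eX1 1 true) (eX1 1 false) in
  let Gm' N := ev N (ncinv gm) (eX1 1 true) (eX1 1 false) in
  let G e N := if e then Gp N else Gm N in
  let sm (e : bool) := if e then m else - m in
  (* u = F sigma_1^lambda F^-1 and its inverse *)
  let u N := F N * (mon s1 * pow N (s1 ++ s1) m) * F' N in
  let u' N := F N * (pow N (s1 ++ s1) (- m) * mon (s false 1)) * F' N in
  [/\ is_GT (GTPt lambda f),
      is_lie_exp gp /\ is_lie_exp gm,
      forall e N, acong (@ebrel 1) (@esperm 1) N
        ((mon (s e 2 ++ s e 1) * pow N (s1 ++ s2 ++ s2 ++ s1) (sm e)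
           * G e N * F N) ^+ 3) 1
    & forall N, acong (@ebrel 1) (@esperm 1) N
        (u N * u N)
        (Gm N * (u' N * Gp' N * u' N) * Gm' N * (u N * Gp N * u N))].

Definition GTell_mul (g g' : GTellpt) : GTellpt :=
  let: GTellPt lambda f gp gm := g in
  let: GTellPt lambda' f' gp' gm' := g' in
  let: GTPt lambda'' f'' := GT_mul (GTPt lambda f) (GTPt lambda' f') in
  GTellPt lambda'' f'' (gev2 gp gp' gm') (gev2 gm gp' gm').

Definition GTell_act (g : GTellpt) (x : Ellpt k) : Ellpt k :=
  let: GTellPt lambda f gp gm := g in
  let: EllPt mu Phi Ap Am := x in
  let: MPt mu' Phi' := GT_act (GTPt lambda f) (MPt mu Phi) in
  EllPt mu' Phi' (gev2 gp Ap Am) (gev2 gm Ap Am).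

End GTell.

Definition GTell_functor : Qfunctor := {|
  pt := GTellpt;
  is_point := is_GTell;
  eqv := fun k x y => x = y;
  base_change := fun k k' phi g =>
    GTellPt (phi (GTell_lambda g)) (ncmap phi (GTell_f g))
            (ncmap phi (GTell_gp g)) (ncmap phi (GTell_gm g)) |}.

Definition GTell : Qsemigroup :=
  {| sg_functor := GTell_functor; sg_mul := GTell_mul |}.

Definition GT_to_GTell (k : comAlgType rat) (g : pt GT k) : pt GTell k :=
  let: GTPt lambda f := g in
  let X : f2 k := grX in let Y : f2 k := grY in let YX := gcomm Y X in
  GTellPt lambda f
    (gev2 f X YX * ncpow X lambda * ncinv (gev2 f X YX))
    (ncpow YX (half (lambda - 1)) * gev2 f (Y * ncinv X * ncinv Y) YX
      * Y * ncinv (gev2 f X YX)).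

Section Sigma.
Variables (k : comAlgType rat) (m : pt M k).

Let mu := M_mu m.
Let Phi := M_Phi m.
Let x i : ncseries k (egen 2) := xx true (ix 1 i).
Let y i : ncseries k (egen 2) := xx false (ix 1 i).
Let t i j : ncseries k (egen 2) := te (ix 1 i) (ix 1 j).
Let z12 := todd_ad (x 1) (y 2).
Let z21 := todd_ad (x 2) (y 1).

Definition sigma_Ap : ncseries k (egen 2) :=
  ev2 Phi z12 (t 1 2) * ncexp (mu *: z12) * ncinv (ev2 Phi z12 (t 1 2)).

Definition sigma_Am : ncseries k (egen 2) :=
  ncexp (half mu *: t 1 2) * ev2 Phi z21 (t 2 1) * ncexp (x 1)
    * ncinv (ev2 Phi z12 (t 1 2)).

Definition sigma_formula : pt Ell k := EllPt mu Phi sigma_Ap sigma_Am.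

End Sigma.

(* Main.v *)
Require Import Defs.
From HB Require Import structures.
From mathcomp Require Import all_boot all_order all_fingroup all_algebra.
From mathcomp Require Import boolp generic_quotient ring.

Set Implicit Arguments.
Unset Strict Implicit.
Unset Printing Implicit Defensive.

Import GRing.Theory.
Local Open Scope ring_scope.
Local Open Scope quotient_scope.

(** Uniqueness is immediate, since the formula prescribes sigma on points. The content is that the
    formula satisfies the relations of [Ell] and intertwines the two actions.

    In the completion of t_{1,3}, put z_i = (ad x_i/(e^{ad x_i} - 1))(sum of the y_j, j != i). The
    proof rests on a morphism from t_4, with strands 0, 1, 2, 3, to t_{1,3}: t_{0i} goes to z_i and
    t_{ij} to t_{ij} ([tt4_tri], [tt4_far]). The images of the six generators add up to zero
    ([zz_sum]), and conjugation by e^{x_i} sends z_j + t_{ij} to z_j and fixes t_{jl} ([conj_zz_te],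
    [conj_te]). The hard relation is [z_i, z_j + t_{ij}] = 0 ([zz_comm]): in each degree at least 2
    its left side is a polynomial in the commuting operators ad x_1, ad x_2 applied to [t_12, t_13],
    and that polynomial vanishes by the addition formula of 1/(e^u - 1) ([gh_addition],
    [todd_poly_eq0], [comm_partSS]).

    Inserting A_+ and A_- along (a, bc) gives words in e^{mu z/2}, e^{mu t/2}, Phi and e^{x_a}
    ([cable_Ap], [cable_Am]). One simplification uses that Phi has no linear term, so that commuting
    shifts of its arguments are invisible ([Phi_coef1], [Phi_shift]). The elliptic relations then
    become group computations from the pentagons and hexagons of the four strands
    ([alpha_plus_words], [alpha_minus_words], [commutator_words]). That A_+ and A_- are exponentials
    of Lie series is Baker-Campbell-Hausdorff ([is_lie_expM]).

    For the compatibility, (A_-, A_+) = e^{mu t_12} holds in t_{1,2} ([sigma_gcomm]). Conjugation by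
    Phi(z_12, t_12) takes e^{mu z_12} to A_+, so the acted associator takes the value f(A_+, (A_-,
    A_+)) Phi(z_12, t_12); a similar conjugation treats Phi(z_21, t_21). Substituting gives exactly
    the formulas of s ([GT_compat_plus], [GT_compat_minus]).

    Throughout, congruences are turned into equalities in the ring [quo R], and [subst_intertwine]
    extends conjugation relations from letters to series. *)

Section Valuation.
Variables (k : comNzRingType) (X : Type).
Implicit Types (a b c : ncseries k X) (w : seq X).

(** * The degree filtration on series *)

Definition vanish n a := forall w, (size w < n)%N -> a w = 0.

Lemma ncaddE a b w : (a + b) w = a w + b w. Proof. by []. Qed.
Lemma ncoppE a w : (- a) w = - a w. Proof. by []. Qed.
Lemma nczeroE w : (0 : ncseries k X) w = 0. Proof. by []. Qed.
Lemma nconeE w : (1 : ncseries k X) w = (nilp w)%:R. Proof. by []. Qed.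
Lemma ncscaleE (l : k) a w : (l *: a) w = l * a w. Proof. by []. Qed.
Lemma ncmulE a b w :
  (a * b) w = \sum_(i < (size w).+1) a (take i w) * b (drop i w).
Proof. by []. Qed.
Lemma ncsumE I (r : seq I) (P : pred I) (F : I -> ncseries k X) w :
  (\sum_(i <- r | P i) F i) w = \sum_(i <- r | P i) F i w.
Proof. by elim/big_rec2: _ => // i x y _ <-. Qed.

Lemma agreeP n a b : agree_below n a b <-> vanish n (a - b).
Proof.
split=> h w /h; first by rewrite ncaddE ncoppE => ->; rewrite subrr.
by move/eqP; rewrite subr_eq0 => /eqP.
Qed.

Lemma vanish0 a : vanish 0 a. Proof. by []. Qed.
Lemma vanish_zero n : vanish n 0. Proof. by []. Qed.
Lemma vanishW m n a : (m <= n)%N -> vanish n a -> vanish m a.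
Proof. by move=> mn h w wm; apply/h/(leq_trans wm mn). Qed.
Lemma vanishD n a b : vanish n a -> vanish n b -> vanish n (a + b).
Proof. by move=> ha hb w wn; rewrite ncaddE ha // hb // addr0. Qed.
Lemma vanishN n a : vanish n a -> vanish n (- a).
Proof. by move=> ha w wn; rewrite ncoppE ha // oppr0. Qed.
Lemma vanishB n a b : vanish n a -> vanish n b -> vanish n (a - b).
Proof. by move=> ha hb; apply/vanishD/vanishN. Qed.
Lemma vanishZ n (l : k) a : vanish n a -> vanish n (l *: a).
Proof. by move=> ha w wn; rewrite ncscaleE ha // mulr0. Qed.
Lemma vanish_sum n I (r : seq I) (P : pred I) (F : I -> ncseries k X) :
  (forall i, P i -> vanish n (F i)) -> vanish n (\sum_(i <- r | P i) F i).
Proof. by move=> h w wn; rewrite ncsumE big1 // => i /h; apply. Qed.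
Lemma vanishM m n a b : vanish m a -> vanish n b -> vanish (m + n) (a * b).
Proof.
move=> ha hb w wn; rewrite ncmulE big1 // => i _.
have [im|mi] := ltnP i m.
  by rewrite ha ?mul0r // size_take_min (leq_ltn_trans (geq_minl _ _)).
rewrite (hb (drop i w)) ?mulr0 // size_drop.
rewrite ltn_subLR; last by rewrite -ltnS ltn_ord.
by rewrite (leq_trans wn) // leq_add2r.
Qed.
Lemma vanishMl n a b : vanish n b -> vanish n (a * b).
Proof. exact: (@vanishM 0). Qed.
Lemma vanishMr n a b : vanish n a -> vanish n (a * b).
Proof. by move=> ha; rewrite -[n]addn0; apply: vanishM. Qed.
Lemma vanishX n a : vanish 1 a -> vanish n (a ^+ n).
Proof.
move=> ha; elim: n => [|n IH]; first exact: vanish0.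
by rewrite exprS -add1n; apply: vanishM.
Qed.
Lemma vanish_lie m n a b : vanish m a -> vanish n b -> vanish (m + n) (lie a b).
Proof. by move=> ha hb; apply: vanishB; [|rewrite addnC]; apply: vanishM. Qed.
Lemma vanish_iter_lie m n a b :
  vanish 1 a -> vanish m b -> vanish (n + m) (iter n (lie a) b).
Proof.
move=> ha hb; elim: n => // n IH /=.
by rewrite -add1n -addnA; apply: vanish_lie.
Qed.

(** The filtration is separated, so identities of series may be checked up to every order. *)
Lemma series_eq a b : (forall n, vanish n (a - b)) -> a = b.
Proof.
move=> h; apply: ncseriesP => w.
by have /agreeP := h (size w).+1; apply.
Qed.

Lemma vanish_trans n b a c : vanish n (a - b) -> vanish n (b - c) ->
  vanish n (a - c).
Proof. by move=> h1 h2; rewrite -(subrK b a) -addrA; apply: vanishD. Qed.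
Lemma vanish_sym n a b : vanish n (a - b) -> vanish n (b - a).
Proof. by move=> h; rewrite -opprB; apply: vanishN. Qed.
Lemma vanish_subM n a b c d :
  vanish n (a - c) -> vanish n (b - d) -> vanish n (a * b - c * d).
Proof.
move=> h1 h2; apply: (@vanish_trans _ (c * b)).
  by rewrite -mulrBl; apply: vanishMr.
by rewrite -mulrBr; apply: vanishMl.
Qed.
Lemma vanish1P a : vanish 1 a <-> a [::] = 0.
Proof. by split=> [h|h [|//] _]; first exact: h. Qed.

End Valuation.

(** * Bracket identities and reindexing of double sums *)

Lemma lieC (A : pzRingType) (a b : A) : lie a b = - lie b a.
Proof. by rewrite /lie opprB. Qed.
Lemma lieDl (A : pzRingType) (a b c : A) : lie (a + b) c = lie a c + lie b c.
Proof. by rewrite /lie mulrDl mulrDr opprD addrACA. Qed.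
Lemma lieDr (A : pzRingType) (a b c : A) : lie c (a + b) = lie c a + lie c b.
Proof. by rewrite /lie mulrDl mulrDr opprD addrACA. Qed.
Lemma lieNl (A : pzRingType) (a b : A) : lie (- a) b = - lie a b.
Proof. by rewrite /lie mulNr mulrN -opprB opprK addrC. Qed.
Lemma lieNr (A : pzRingType) (a b : A) : lie a (- b) = - lie a b.
Proof. by rewrite lieC lieNl -lieC. Qed.
Lemma lie0r (A : pzRingType) (a : A) : lie a 0 = 0.
Proof. by rewrite /lie mulr0 mul0r subrr. Qed.
Lemma lie0l (A : pzRingType) (a : A) : lie 0 a = 0.
Proof. by rewrite /lie mulr0 mul0r subrr. Qed.
Lemma lie_jacobi (A : pzRingType) (a b c : A) :
  lie a (lie b c) = lie (lie a b) c + lie b (lie a c).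
Proof.
rewrite /lie !(mulrDl, mulrDr, mulrN, mulNr, opprD, opprK) !mulrA.
by rewrite [RHS](AC ((2*2)*(2*2)) ((1*7*(6*4))*(5*2)*(8*3))) /= !subrr !addr0.
Qed.

Lemma sum_triangle (V : nmodType) (S : nat) (F : nat -> nat -> V) :
  \sum_(n < S) \sum_(i < n.+1) F i (n - i)%N = \sum_(i < S) \sum_(m < S - i) F i m.
Proof.
elim: S => [|S IH]; first by rewrite !big_ord0.
rewrite big_ord_recr [in RHS]big_ord_recr /= IH subSnn big_ord1.
rewrite big_ord_recr /= subnn addrA -big_split /=; congr (_ + _).
by apply: eq_bigr => i _; rewrite subSn ?big_ord_recr //= ltnW.
Qed.

Lemma sum_square (V : nmodType) (S : nat) (F : nat -> nat -> V) :
  (forall i j, (S <= i + j)%N -> F i j = 0) ->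
  \sum_(i < S) \sum_(j < S) F i j = \sum_(n < S) \sum_(i < n.+1) F i (n - i)%N.
Proof.
move=> h; rewrite sum_triangle; apply: eq_bigr => i _.
rewrite [RHS](big_ord_widen S (fun m => F i m)) ?leq_subr // [RHS]big_mkcond /=.
apply: eq_bigr => j _; case: ltnP => // ij; apply: h.
by rewrite -leq_subLR.
Qed.

(** * Convergent sums and density of polynomials *)

Section Sums.
Variables (k : comAlgType rat) (X : finType).
Implicit Types (a b c : ncseries k X) (u v : nat -> ncseries k X).

Lemma ncsum_coefE u w : ncsum u w = \sum_(n < (size w).+1) u n w.
Proof. by []. Qed.

Lemma ncsum_coef_widen u w N : (forall n, vanish n (u n)) -> (size w < N)%N ->
  ncsum u w = \sum_(n < N) u n w.
Proof.
move=> hu wN; rewrite ncsum_coefE (big_ord_widen N (fun n => u n w) wN).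
rewrite big_mkcond; apply: eq_bigr => i _; case: ltnP => // wi.
by rewrite hu.
Qed.

Lemma ncsum_approx u N : (forall n, vanish n (u n)) ->
  vanish N (ncsum u - \sum_(n < N) u n).
Proof.
by move=> hu w wN; rewrite ncaddE ncoppE ncsumE (ncsum_coef_widen hu wN) subrr.
Qed.

Lemma ncsum_vanish m u : (forall n, vanish m (u n)) -> vanish m (ncsum u).
Proof. by move=> h w wm; rewrite ncsum_coefE big1 // => i _; apply: h. Qed.

Lemma eq_ncsum u v : u =1 v -> ncsum u = ncsum v.
Proof. by move=> /funext ->. Qed.

Lemma ncsum_single m u : (forall n, n != m -> u n = 0) -> vanish m (u m) ->
  ncsum u = u m.
Proof.
move=> h hm; apply: ncseriesP => w; rewrite ncsum_coefE.
have [mw|wm] := leqP m (size w).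
  rewrite (bigD1 (Ordinal (mw : (m < (size w).+1)%N))) //= big1 ?addr0 // => i.
  by rewrite -val_eqE /= => /h ->.
rewrite big1 ?hm // => i _; rewrite h // neq_ltn.
by rewrite (leq_trans (ltn_ord i)).
Qed.

Lemma ncsum_recl u : (forall n, vanish n (u n)) ->
  ncsum u = u 0%N + ncsum (fun n => u n.+1).
Proof.
move=> hu; apply: ncseriesP => w; rewrite ncaddE !ncsum_coefE big_ord_recl.
rewrite [in RHS]big_ord_recr /= [X in _ + (_ + X)]hu // addr0.
by congr (_ + _); apply: eq_bigr.
Qed.

Lemma ncsumD u v : ncsum u + ncsum v = ncsum (fun n => u n + v n).
Proof.
by apply: ncseriesP => w; rewrite ncaddE !ncsum_coefE -big_split.
Qed.
Lemma ncsumN u : - ncsum u = ncsum (fun n => - u n).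
Proof.
by apply: ncseriesP => w; rewrite ncoppE !ncsum_coefE -sumrN.
Qed.
Lemma ncsumB u v : ncsum u - ncsum v = ncsum (fun n => u n - v n).
Proof. by rewrite ncsumN ncsumD. Qed.
Lemma ncsumZ (l : k) u : l *: ncsum u = ncsum (fun n => l *: u n).
Proof.
by apply: ncseriesP => w; rewrite ncscaleE !ncsum_coefE big_distrr.
Qed.

Lemma ncsumMl a u : (forall n, vanish n (u n)) ->
  a * ncsum u = ncsum (fun n => a * u n).
Proof.
move=> hu; apply: series_eq => N.
apply: (@vanish_trans _ _ _ (\sum_(n < N) a * u n)).
  by rewrite -mulr_sumr -mulrBr; apply/vanishMl/ncsum_approx.
by apply/vanish_sym/ncsum_approx => n; apply: vanishMl.
Qed.
Lemma ncsumMr a u : (forall n, vanish n (u n)) ->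
  ncsum u * a = ncsum (fun n => u n * a).
Proof.
move=> hu; apply: series_eq => N.
apply: (@vanish_trans _ _ _ (\sum_(n < N) u n * a)).
  by rewrite -mulr_suml -mulrBl; apply/vanishMr/ncsum_approx.
by apply/vanish_sym/ncsum_approx => n; apply: vanishMr.
Qed.

Lemma ncsum_double (u : nat -> nat -> ncseries k X) :
  (forall n m, vanish (n + m) (u n m)) ->
  ncsum (fun n => ncsum (u n)) = ncsum (fun n => \sum_(i < n.+1) u i (n - i)%N).
Proof.
move=> hu; apply: ncseriesP => w; rewrite !ncsum_coefE.
under [RHS]eq_bigr do rewrite ncsumE.
rewrite -(@sum_square _ _ (fun i j => u i j w)) // => i j wij.
by rewrite hu.
Qed.

Lemma ncsumM u v : (forall n, vanish n (u n)) -> (forall n, vanish n (v n)) ->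
  ncsum u * ncsum v = ncsum (fun n => \sum_(i < n.+1) u i * v (n - i)%N).
Proof.
move=> hu hv; rewrite ncsumMr //.
under eq_ncsum do rewrite ncsumMl //.
by rewrite ncsum_double // => n m; apply: vanishM.
Qed.

Definition nword (w : seq X) : ncseries k X := NCSeries (fun t : seq X => (t == w)%:R).

Lemma vanish_nword w : vanish (size w) (nword w).
Proof.
by move=> v vw /=; case: eqP vw => // ->; rewrite ltnn.
Qed.

Lemma nwordM (v w : seq X) : nword v * nword w = nword (v ++ w).
Proof.
apply: ncseriesP => t; rewrite ncmulE /=.
case: (eqVneq t (v ++ w)) => [->|tvw].
  have vs : (size v < (size (v ++ w)).+1)%N by rewrite ltnS size_cat leq_addr.
  rewrite (bigD1 (Ordinal vs)) //= take_size_cat // drop_size_cat // !eqxx mulr1.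
  rewrite big1 ?addr0 // => i; rewrite -val_eqE /= => iv.
  case: eqP => [/(congr1 size) e|]; rewrite ?mul0r //; move: iv.
  by rewrite -e size_takel ?eqxx // -ltnS.
rewrite big1 // => i _; case: eqP => [e1|]; last by rewrite mul0r.
case: eqP => [e2|]; last by rewrite mulr0.
by move: tvw; rewrite -e1 -e2 cat_take_drop eqxx.
Qed.

Lemma nword_nil : nword [::] = 1.
Proof. by apply: ncseriesP => -[]. Qed.

Lemma nword1 x : nword [:: x] = letter k x.
Proof. by []. Qed.

Lemma nword_prod w : nword w = \prod_(x <- w) letter k x.
Proof.
elim: w => [|x w IH]; first by rewrite big_nil nword_nil.
by rewrite big_cons -IH -nword1 nwordM.
Qed.

Definition trunc N a : ncseries k X :=
  \sum_(n < N) \sum_(t : n.-tuple X) a t *: nword t.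

Lemma trunc_approx N a : vanish N (a - trunc N a).
Proof.
move=> w wN; rewrite ncaddE ncoppE ncsumE (bigD1 (Ordinal wN)) //= ncsumE.
rewrite (bigD1 (in_tuple w)) //= eqxx mulr1 big1 ?addr0 => [|t tw].
  rewrite big1 ?addr0 ?subrr // => i; rewrite -val_eqE /= => iw.
  rewrite ncsumE big1 // => t _; rewrite ncscaleE /=.
  case: eqP => [/(congr1 size) e|]; rewrite ?mulr0 //.
  by rewrite e size_tuple eqxx in iw.
case: eqP => [e|]; rewrite ?mulr0 //.
by move/eqP: tw; case; apply: val_inj.
Qed.

(** Noncommutative polynomials are dense: a property stable under adding a multiple of a word and
    under limits holds for all series. The continuity arguments below go through this principle. *)
Lemma series_ind (P : ncseries k X -> Prop) :
  P 0 -> (forall l w a, P a -> P (l *: nword w + a)) ->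
  (forall a, (forall N, exists2 b, P b & vanish N (a - b)) -> P a) ->
  forall a, P a.
Proof.
move=> P0 PD Plim a; apply: Plim => N; exists (trunc N a); last exact: trunc_approx.
rewrite /trunc; elim: N => [|N IH]; first by rewrite big_ord0.
rewrite big_ord_recr /= addrC.
elim: (index_enum _) => [|t r IHr]; first by rewrite big_nil add0r.
by rewrite big_cons -addrA; apply: PD.
Qed.

End Sums.
Arguments nword {k X}.

(** * Substitution as a continuous algebra morphism *)

Section Subst.
Variables (k : comAlgType rat) (X Y : finType) (s : X -> ncseries k Y).

Fact subst_linear : linear (subst s).
Proof.
move=> l a b; rewrite /subst ncsumZ ncsumD; apply: eq_ncsum => n.
rewrite scaler_sumr -big_split; apply: eq_bigr => t _ /=.
by rewrite scalerDl -scalerA.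
Qed.
HB.instance Definition _ :=
  GRing.isLinear.Build k (ncseries k X) (ncseries k Y) *:%R (subst s)
    subst_linear.

Lemma subst_vanish n a : vanish n a -> vanish n (subst s a).
Proof.
move=> ha w wn; rewrite ncsum_coefE big1 // => i _.
rewrite ncsumE big1 // => t _; rewrite ncscaleE ha ?mul0r //.
by rewrite size_tuple (leq_ltn_trans _ wn) // -ltnS.
Qed.

Hypothesis hs : forall x, vanish 1 (s x).

Lemma vanish_prod (w : seq X) : vanish (size w) (\prod_(x <- w) s x).
Proof.
elim: w => [|x w IH]; first exact: vanish0.
by rewrite big_cons -[size _]add1n; apply: vanishM.
Qed.

Lemma subst_nword w : subst s (nword w) = \prod_(x <- w) s x.
Proof.
rewrite /subst (@ncsum_single _ _ (size w)) => [|n nw|].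
- rewrite (bigD1 (in_tuple w)) //= eqxx scale1r [X in _ + X]big1 ?addr0 // => t.
  by rewrite -val_eqE /= => /negPf ->; rewrite scale0r.
- rewrite big1 // => t _ /=; case: (tval t =P w) nw => [<-|]; last by rewrite scale0r.
  by rewrite size_tuple eqxx.
by apply: vanish_sum => t _; apply: vanishZ; rewrite -{1}(size_tuple t);
  apply: vanish_prod.
Qed.

Lemma subst1 : subst s 1 = 1.
Proof. by rewrite -nword_nil subst_nword big_nil. Qed.

Lemma subst_letter x : subst s (letter k x) = s x.
Proof. by rewrite -nword1 subst_nword big_seq1. Qed.

(** Both sides are bilinear and continuous, so [series_ind] in each argument reduces to two words,
    where the product is concatenation. *)
Lemma substM a b : subst s (a * b) = subst s a * subst s b.
Proof.
move: a; apply: series_ind => [|l v a IH|a h].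
- by rewrite !(mul0r, linear0).
- rewrite mulrDl -scalerAl !linearP /= IH mulrDl -scalerAl; congr (_ *: _ + _).
  move: b {a IH}; apply: series_ind => [|m w b IH|b h].
  + by rewrite !(mulr0, linear0).
  + rewrite mulrDr -scalerAr !linearP /= IH mulrDr -scalerAr nwordM.
    by rewrite !subst_nword big_cat.
  apply: series_eq => N; have [c IH bc] := h N.
  rewrite -(subrK c b); move: (b - c) bc => d bc.
  rewrite mulrDr !linearD /= IH mulrDr opprD addrACA subrr addr0.
  by apply: vanishB; [apply/subst_vanish|]; apply/vanishMl => //; apply/subst_vanish.
apply: series_eq => N; have [c IH bc] := h N.
rewrite -(subrK c a); move: (a - c) bc => d bc.
rewrite mulrDl !linearD /= IH mulrDl opprD addrACA subrr addr0.
by apply: vanishB; [apply/subst_vanish|]; apply/vanishMr => //; apply/subst_vanish.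
Qed.

Lemma substX a n : subst s (a ^+ n) = subst s a ^+ n.
Proof. by elim: n => [|n IH]; rewrite ?subst1 // !exprS substM IH. Qed.

Lemma subst_prod I (r : seq I) (F : I -> ncseries k X) :
  subst s (\prod_(i <- r) F i) = \prod_(i <- r) subst s (F i).
Proof. by elim/big_rec2: _ => [|i a b _ <-]; rewrite ?subst1 ?substM. Qed.

Lemma subst_lie a b : subst s (lie a b) = lie (subst s a) (subst s b).
Proof. by rewrite /lie linearB /= !substM. Qed.

Lemma subst_iter_lie n a b :
  subst s (iter n (lie a) b) = iter n (lie (subst s a)) (subst s b).
Proof. by elim: n => //= n <-; rewrite subst_lie. Qed.

Lemma subst_ncsum u : (forall n, vanish n (u n)) ->
  subst s (ncsum u) = ncsum (fun n => subst s (u n)).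
Proof.
move=> hu; apply: series_eq => N.
apply: (@vanish_trans _ _ _ (\sum_(n < N) subst s (u n))).
  by rewrite -linear_sum -linearB /=; apply/subst_vanish/ncsum_approx.
by apply/vanish_sym/ncsum_approx => n; apply: subst_vanish.
Qed.

End Subst.

Lemma eq_subst (k : comAlgType rat) (X Y : finType) (s s' : X -> ncseries k Y) :
  s =1 s' -> subst s =1 subst s'.
Proof. by move=> /funext ->. Qed.

Lemma subst_comp (k : comAlgType rat) (X Y Z : finType)
    (s : Y -> ncseries k Z) (s' : X -> ncseries k Y) a :
  (forall y, vanish 1 (s y)) -> (forall x, vanish 1 (s' x)) ->
  subst s (subst s' a) = subst (fun x => subst s (s' x)) a.
Proof.
move=> hs hs'; have hss' x : vanish 1 (subst s (s' x)) by apply/subst_vanish/hs'.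
move: a; apply: series_ind => [|l w a IH|a h].
- by rewrite !linear0.
- by rewrite !linearP /= IH !subst_nword // subst_prod.
apply: series_eq => N; have [c IH ac] := h N.
rewrite -(subrK c a); move: (a - c) ac => d ac.
rewrite [subst s' _]linearD /= !linearD /= IH addrACA subrr addr0.
by apply: vanishB; do ?apply/subst_vanish.
Qed.

(** * Rational scalars, exponentials, inverses and the Euler derivation *)

Section RatScalars.
Variable k : comAlgType rat.

Lemma ratkM (p q : rat) : (p * q)%:A = p%:A * q%:A :> k.
Proof. by rewrite mulr_algl scalerA. Qed.
Lemma ratkD (p q : rat) : (p + q)%:A = p%:A + q%:A :> k.
Proof. by rewrite scalerDl. Qed.
Lemma ratkN (p : rat) : (- p)%:A = - p%:A :> k.
Proof. by rewrite scaleNr. Qed.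
Lemma ratk_nat n : (n%:R : rat)%:A = n%:R :> k.
Proof. by rewrite scaler_nat. Qed.

Lemma ratk_inv n : n.+1%:R * (n.+1%:R^-1 : rat)%:A = 1 :> k.
Proof. by rewrite -ratk_nat -ratkM divff ?scale1r // Num.Theory.pnatr_eq0. Qed.

Lemma natk_inj n (c : k) : n.+1%:R * c = 0 -> c = 0.
Proof.
by move/(congr1 ( *%R (n.+1%:R^-1 : rat)%:A)); rewrite mulrA mulr0 [_ * _%:R]mulrC
  ratk_inv mul1r.
Qed.

End RatScalars.

Section ExpLog.
Variables (k : comAlgType rat) (X : finType).
Implicit Types (a b c u v : ncseries k X).

Lemma vanish_exp_term a : vanish 1 a ->
  forall n, vanish n (((n`!%:R)^-1 : rat)%:A *: a ^+ n).
Proof. by move=> ha n; apply/vanishZ/vanishX. Qed.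

Lemma ncexp_nil a : vanish 1 a -> ncexp a [::] = 1.
Proof.
move=> ha; rewrite ncsum_coefE big_ord1 fact0 expr0 ncscaleE nconeE.
by rewrite invr1 scale1r mulr1.
Qed.

Lemma vanish1BP u : vanish 1 (1 - u) <-> u [::] = 1.
Proof.
split; first by move/vanish1P => /eqP; rewrite ncaddE ncoppE subr_eq0 => /eqP <-.
by move=> hu; apply/vanish1P; rewrite ncaddE ncoppE hu subrr.
Qed.

Lemma vanish_sub1P u : vanish 1 (u - 1) <-> u [::] = 1.
Proof. by rewrite -vanish1BP; split=> h; rewrite -opprB; apply: vanishN. Qed.

Lemma mul_nil u v : u [::] = 1 -> v [::] = 1 -> (u * v) [::] = 1.
Proof. by move=> hu hv; rewrite ncmulE big_ord1 /= hu hv mulr1. Qed.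

Lemma ncinv_nil u : u [::] = 1 -> ncinv u [::] = 1.
Proof. by move=> hu; rewrite ncsum_coefE big_ord1 expr0. Qed.

Lemma ncmulVr u : u [::] = 1 -> ncinv u * u = 1.
Proof.
move=> /vanish1BP hu; set w := 1 - u.
have hw n : vanish n (w ^+ n) by apply: vanishX.
have E : ncinv u = 1 + ncinv u * w.
  rewrite {1}/ncinv ncsum_recl // expr0 [in RHS]/ncinv ncsumMr //.
  by congr (_ + _); apply: eq_ncsum => n; rewrite exprSr.
have {2}-> : u = 1 - w by rewrite subKr.
by rewrite mulrBr mulr1 {1}E addrK.
Qed.

Lemma ncmulrV u : u [::] = 1 -> u * ncinv u = 1.
Proof.
move=> hu; have hv := ncinv_nil hu.
have e : u = ncinv (ncinv u).
  by rewrite -[LHS]mul1r -(ncmulVr hv) -mulrA ncmulVr // mulr1.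
by rewrite {1}e ncmulVr.
Qed.

Lemma ncinv_unique u v : u [::] = 1 -> u * v = 1 -> ncinv u = v.
Proof. by move=> hu uv; rewrite -[RHS]mul1r -(ncmulVr hu) -mulrA uv mulr1. Qed.

Lemma ncinv1 : ncinv (1 : ncseries k X) = 1.
Proof. by apply: ncinv_unique; rewrite ?mulr1. Qed.

Lemma ncinvM u v : u [::] = 1 -> v [::] = 1 ->
  ncinv (u * v) = ncinv v * ncinv u.
Proof.
move=> hu hv; apply: ncinv_unique; first exact: mul_nil.
by rewrite mulrA -(mulrA u) ncmulrV // mulr1 ncmulrV.
Qed.

Lemma ncinvK u : u [::] = 1 -> ncinv (ncinv u) = u.
Proof. by move=> hu; apply: ncinv_unique; rewrite ?ncmulVr //; exact: ncinv_nil. Qed.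

Lemma ncexpD a b : vanish 1 a -> vanish 1 b -> a * b = b * a ->
  ncexp (a + b) = ncexp a * ncexp b.
Proof.
move=> ha hb ab; rewrite /ncexp ncsumM; do ?exact: vanish_exp_term.
apply: eq_ncsum => n; rewrite addrC exprDn_comm; last by rewrite /GRing.comm ab.
rewrite scaler_sumr; apply: eq_bigr => i _.
rewrite -scalerAl -scalerAr scalerA -scaler_nat scalerA.
have -> : b ^+ (n - i) * a ^+ i = a ^+ i * b ^+ (n - i).
  exact/commrX/commr_sym/commrX/esym.
congr (_ *: _); rewrite -ratk_nat -!ratkM; congr (_%:A).
have /(congr1 (fun m => m%:R : rat)) := bin_fact (ltn_ord i : i <= n)%N.
rewrite !natrM => <-.
have f0 m : (m`!%:R : rat) != 0 by rewrite Num.Theory.pnatr_eq0 -lt0n fact_gt0.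
have c0 : ('C(n, i)%:R : rat) != 0.
  by rewrite Num.Theory.pnatr_eq0 -lt0n bin_gt0 -ltnS.
by rewrite [LHS]mulrC invfM mulrA divff // mul1r invfM.
Qed.

Lemma ncexp0 : ncexp (0 : ncseries k X) = 1.
Proof.
rewrite /ncexp (@ncsum_single _ _ 0) => [|n n0|]; last exact: vanish0.
  by rewrite fact0 expr0 invr1 !scale1r.
by rewrite expr0n (negPf n0) scaler0.
Qed.

Lemma ncexpN a : vanish 1 a -> ncinv (ncexp a) = ncexp (- a).
Proof.
move=> ha; apply: ncinv_unique; first exact: ncexp_nil.
by rewrite -ncexpD ?subrr ?ncexp0 //; [exact: vanishN|rewrite mulrN mulNr].
Qed.

Lemma ncexp_mulN a : vanish 1 a -> ncexp a * ncexp (- a) = 1.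
Proof. by move=> ha; rewrite -ncexpN // ncmulrV // ncexp_nil. Qed.

Lemma ncexp_Nmul a : vanish 1 a -> ncexp (- a) * ncexp a = 1.
Proof. by move=> ha; rewrite -ncexpN // ncmulVr // ncexp_nil. Qed.

Lemma vanish_log u : u [::] = 1 -> vanish 1 (nclog u).
Proof.
move=> /vanish_sub1P hu; apply: ncsum_vanish => -[|n].
  by rewrite scale0r scale0r.
by apply/vanishZ/(@vanishW _ _ 1 n.+1) => //; apply: vanishX.
Qed.

(** The Euler derivation. Its kernel consists of constants because k contains Q, so it replaces
    d/dt: identities and Lie properties are tested on logarithmic derivatives. *)
Definition dg a := NCSeries (fun w => (size w)%:R * a w).

Lemma dg_coefE a w : dg a w = (size w)%:R * a w. Proof. by []. Qed.

Fact dg_linear : linear dg.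
Proof.
move=> l a b; apply: ncseriesP => w.
by rewrite dg_coefE !(ncaddE, ncscaleE) mulrDr mulrCA.
Qed.
HB.instance Definition _ :=
  GRing.isLinear.Build k (ncseries k X) (ncseries k X) *:%R dg dg_linear.

Lemma dg_vanish n a : vanish n a -> vanish n (dg a).
Proof. by move=> ha w /ha; rewrite dg_coefE => ->; rewrite mulr0. Qed.

Lemma dg_vanish1 a : vanish 1 (dg a).
Proof. by apply/vanish1P; rewrite dg_coefE mul0r. Qed.

Lemma dgM a b : dg (a * b) = dg a * b + a * dg b.
Proof.
apply: ncseriesP => w; rewrite dg_coefE ncaddE !ncmulE -big_split mulr_sumr /=.
apply: eq_bigr => i _; rewrite [X in _ + X]mulrCA -mulrA -mulrDl.
by rewrite -natrD size_takel -1?ltnS // size_drop subnKC // -ltnS.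
Qed.

Lemma dg1 : dg 1 = 0.
Proof. by apply: ncseriesP => -[|x w]; rewrite dg_coefE ?mul0r // mulr0. Qed.

Lemma dg_eq0 a : dg a = 0 -> vanish 1 a -> a = 0.
Proof.
move=> h /vanish1P a0; apply: ncseriesP => -[|x w]; first exact: a0.
exact/natk_inj/(congr1 (fun b : ncseries k X => b (x :: w)) h).
Qed.

Lemma dg_ncsum (u : nat -> ncseries k X) : dg (ncsum u) = ncsum (fun n => dg (u n)).
Proof. by apply: ncseriesP => w; rewrite dg_coefE ncsum_coefE mulr_sumr. Qed.

Lemma dgX a n : a * dg a = dg a * a -> dg (a ^+ n.+1) = n.+1%:R *: (a ^+ n * dg a).
Proof.
move=> h; elim: n => [|n IH]; first by rewrite expr0 mul1r scale1r.
rewrite exprS dgM IH -scalerAr mulrA -exprS.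
have -> : dg a * a ^+ n.+1 = a ^+ n.+1 * dg a by apply/commrX/esym.
by rewrite -[X in X + _]scale1r -scalerDl nat1r.
Qed.

Lemma dg_exp a : vanish 1 a -> a * dg a = dg a * a ->
  dg (ncexp a) = ncexp a * dg a.
Proof.
move=> ha h; have ht := vanish_exp_term ha.
rewrite dg_ncsum ncsum_recl => [|n]; last exact/dg_vanish.
rewrite expr0 linearZ /= dg1 scaler0 add0r /ncexp ncsumMr //.
apply: eq_ncsum => n; rewrite linearZ /= dgX // scalerA scalerAl; congr (_ *: _ * _).
rewrite -ratk_nat -ratkM; congr (_%:A); rewrite factS natrM invfM mulrC mulrA divff.
  by rewrite mul1r.
by rewrite Num.Theory.pnatr_eq0.
Qed.

Lemma dg_log u : u [::] = 1 -> u * dg u = dg u * u -> dg (nclog u) = ncinv u * dg u.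
Proof.
move=> hu h; have hv : vanish 1 (u - 1) by apply/vanish_sub1P.
rewrite dg_ncsum ncsum_recl => [|[|n]]; last 2 first.
- exact: vanish0.
- by apply/dg_vanish/vanishZ/vanishX.
rewrite !scale0r linear0 add0r /ncinv ncsumMr => [|n]; last first.
  by rewrite -opprB; apply/vanishX/vanishN.
apply: eq_ncsum => n; rewrite linearZ /= dgX; last first.
  by rewrite linearB /= dg1 subr0 mulrBl mulrBr h mulr1 mul1r.
rewrite scalerA linearB /= dg1 subr0 scalerAl; congr (_ * _).
rewrite -ratk_nat -ratkM divfK; last by rewrite Num.Theory.pnatr_eq0.
have -> : 1 - u = - (u - 1) by rewrite opprB.
rewrite [RHS]exprNn -[in RHS]signr_odd -[in LHS]signr_odd.
by case: (odd n); rewrite ?expr0 ?expr1 ?ratkN !scale1r ?mul1r // scaleN1r mulN1r.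
Qed.

End ExpLog.

(** * Substitution into exponentials and logarithms, which are mutually inverse *)

Section SubstExp.
Variables (k : comAlgType rat) (X Y : finType) (s : X -> ncseries k Y).
Implicit Types a u v : ncseries k X.
Hypothesis hs : forall x, vanish 1 (s x).

Lemma subst_exp a : vanish 1 a -> subst s (ncexp a) = ncexp (subst s a).
Proof.
move=> ha; rewrite subst_ncsum; last exact: vanish_exp_term.
by apply: eq_ncsum => n; rewrite linearZ /= substX.
Qed.

Lemma subst_nil a : subst s a [::] = a [::].
Proof.
rewrite ncsum_coefE big_ord1 ncsumE (bigD1 [tuple]) //= big_nil big1 => [|t].
  by rewrite addr0 mulr1.
by rewrite tuple0.
Qed.

Lemma subst_inv u : u [::] = 1 -> subst s (ncinv u) = ncinv (subst s u).
Proof.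
move=> hu; symmetry; apply: ncinv_unique; first by rewrite subst_nil.
by rewrite -substM // ncmulrV // subst1.
Qed.

Lemma subst_log u : u [::] = 1 -> subst s (nclog u) = nclog (subst s u).
Proof.
move=> /vanish_sub1P hu; rewrite subst_ncsum => [|[|n]]; last 2 first.
- exact: vanish0.
- by apply/vanishZ/vanishX.
by apply: eq_ncsum => n; rewrite linearZ /= substX // linearB /= subst1.
Qed.

Lemma subst_pow u l : u [::] = 1 -> subst s (ncpow u l) = ncpow (subst s u) l.
Proof.
move=> hu; rewrite /ncpow subst_exp ?linearZ /= ?subst_log //.
exact/vanishZ/vanish_log.
Qed.

Lemma subst_gcomm u v : u [::] = 1 -> v [::] = 1 ->
  subst s (gcomm u v) = gcomm (subst s u) (subst s v).
Proof. by move=> hu hv; rewrite /gcomm !substM // !subst_inv. Qed.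

Lemma todd_vanish x y : vanish 1 x ->
  forall n, vanish n ((todd n)%:A *: iter n (lie x) y : ncseries k X).
Proof.
by move=> hx n; have := @vanish_iter_lie _ _ 0 n _ _ hx (@vanish0 _ _ y); rewrite addn0 => /vanishZ.
Qed.

Lemma subst_todd x y : vanish 1 x ->
  subst s (todd_ad x y) = todd_ad (subst s x) (subst s y).
Proof.
move=> hx; rewrite subst_ncsum; last exact: todd_vanish.
by apply: eq_ncsum => n; rewrite linearZ /= subst_iter_lie.
Qed.

End SubstExp.

Lemma ser1_mulC (k : comNzRingType) (a b : ncseries k unit) : a * b = b * a.
Proof.
apply: ncseriesP => w; rewrite !ncmulE.
have nE (v : seq unit) : v = nseq (size v) tt.
  by elim: v => [|[] v IH] //=; rewrite -IH.
rewrite (reindex_inj rev_ord_inj); apply: eq_bigr => i _ /=; rewrite mulrC subSS.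
have iw : (i <= size w)%N by rewrite -ltnS.
congr (_ * _); [congr (b _)|congr (a _)]; rewrite [LHS]nE [RHS]nE; congr nseq.
  by rewrite size_drop size_takel // subKn.
by rewrite size_drop size_takel // leq_subr.
Qed.

(* In one letter everything commutes, so that the logarithmic derivative turns
   the identities relating exp and log into trivial ones; they are then
   transported to any algebra by substitution. *)
Section OneLetter.
Variable k : comAlgType rat.
Implicit Types a b u : ncseries k unit.
Let t : ncseries k unit := letter k tt.


Let t1 : vanish 1 t. Proof. exact: vanish_nword [:: tt]. Qed.

Lemma ser1_logexp : nclog (ncexp t) = t.
Proof.
have E := ncexp_nil t1.
apply/eqP; rewrite -subr_eq0; apply/eqP/dg_eq0; last exact/vanishB/t1/vanish_log.
rewrite linearB /= dg_log //; last exact: ser1_mulC.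
rewrite dg_exp //; last exact: ser1_mulC.
by rewrite mulrA ncmulVr // mul1r subrr.
Qed.

Lemma ser1_explog : ncexp (nclog (1 + t)) = 1 + t.
Proof.
have u1 : (1 + t) [::] = 1 by apply/vanish_sub1P; rewrite [1 + _]addrC addrK.
have l1 := vanish_log u1.
set u := 1 + t in u1 l1 *; pose v := ncinv u.
have hv : v [::] = 1 by apply: ncinv_nil.
have dv : dg v = - (v * v * dg u).
  have : dg (u * v) = 0 by rewrite ncmulrV // dg1.
  rewrite dgM => /eqP; rewrite addr_eq0 => /eqP h.
  by rewrite -[LHS]mul1r -(ncmulVr u1) -mulrA -[u * dg v]opprK -h mulrN -/v
    [dg u * v]ser1_mulC mulrA.
(* The quotient of exp(log u) by u has zero derivative and constant term 1. *)
suff h : ncexp (nclog u) * v = 1.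
  by rewrite -[LHS]mulr1 -(ncmulVr u1) mulrA h mul1r.
apply/eqP; rewrite -subr_eq0; apply/eqP/dg_eq0; last first.
  by apply/vanish_sub1P/mul_nil => //; apply: ncexp_nil.
rewrite linearB /= dg1 subr0 dgM dv dg_exp //; last exact: ser1_mulC.
rewrite dg_log //; last exact: ser1_mulC.
by rewrite -/v mulrN -!mulrA [dg u * v]ser1_mulC subrr.
Qed.

End OneLetter.

Section LogExp.
Variables (k : comAlgType rat) (X : finType).
Implicit Types a u : ncseries k X.

Lemma nclog_exp a : vanish 1 a -> nclog (ncexp a) = a.
Proof.
move=> ha; have t1 : vanish 1 (letter k tt) by exact: (@vanish_nword _ _ [:: tt]).
have := congr1 (subst (fun=> a)) (ser1_logexp k).
by rewrite subst_log ?subst_exp ?subst_letter //; apply: ncexp_nil.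
Qed.

Lemma ncexp_log u : u [::] = 1 -> ncexp (nclog u) = u.
Proof.
move=> hu; have t1 : vanish 1 (letter k tt) by exact: (@vanish_nword _ _ [:: tt]).
have h1 : vanish 1 (u - 1) by apply/vanish_sub1P.
have e1 : (1 + letter k tt : ncseries k unit) [::] = 1.
  by apply/vanish_sub1P; rewrite [1 + _]addrC addrK.
have := congr1 (subst (fun=> u - 1)) (ser1_explog k).
rewrite subst_exp ?subst_log //; last exact: vanish_log.
by rewrite linearD /= subst1 // subst_letter // addrC subrK.
Qed.

Lemma ncpow_exp a l : vanish 1 a -> ncpow (ncexp a) l = ncexp (l *: a).
Proof. by move=> ha; rewrite /ncpow nclog_exp. Qed.

End LogExp.

(** * The adjoint action of exponentials *)

Lemma exprMn_lie (A : pzRingType) (x y : A) n :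
  x ^+ n * y = \sum_(j < n.+1) (iter j (lie x) y * x ^+ (n - j)) *+ 'C(n, j).
Proof.
(* Left multiplication by x is ad x plus right multiplication by x, and these two operators commute:
   the identity is the binomial theorem for their sum. *)
elim: n => [|n IH]; first by rewrite big_ord1 mul1r mulr1.
rewrite exprS -mulrA IH [RHS]big_ord_recl subn0 bin0 mulr1n /=.
under [X in _ = _ + X]eq_bigr do rewrite /bump /= add1n subSS binS mulrnDr.
rewrite big_split /= addrA [X in _ + X + _]big_ord_recr /= bin_small // mulr0n addr0.
have -> : y * x ^+ n.+1 + \sum_(i < n) (lie x (iter i (lie x) y) * x ^+ (n - i)) *+
    'C(n, i.+1) = \sum_(i < n.+1) (iter i (lie x) y * x ^+ (n.+1 - i)) *+ 'C(n, i).
  rewrite big_ord_recl subn0 bin0 mulr1n; congr (_ + _).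
rewrite -big_split mulr_sumr; apply: eq_bigr => j _ /=.
rewrite -mulrnDl mulrnAr; congr (_ *+ _).
by rewrite subSn -1?ltnS // exprS !mulrA -mulrDl /lie addrC subrK.
Qed.

Lemma inv_fact_bin (n j : nat) : (j <= n)%N ->
  (n`!%:R^-1 * 'C(n, j)%:R : rat) = j`!%:R^-1 * (n - j)`!%:R^-1.
Proof.
move=> jn; have /(congr1 (fun m => m%:R : rat)) := bin_fact jn.
rewrite !natrM => <-.
have c0 : ('C(n, j)%:R : rat) != 0.
  by rewrite Num.Theory.pnatr_eq0 -lt0n bin_gt0.
by rewrite [LHS]mulrC invfM mulrA divff // mul1r invfM.
Qed.

Section ExpAd.
Variables (k : comAlgType rat) (X : finType).
Implicit Types (a b x y z u v : ncseries k X).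

Definition exp_ad x y := ncsum (fun n => ((n`!%:R)^-1 : rat)%:A *: iter n (lie x) y).
(* ((e^{ad x} - 1) / ad x) (y) *)
Definition dexp_ad x y :=
  ncsum (fun n => ((n.+1`!%:R)^-1 : rat)%:A *: iter n (lie x) y).

Lemma vanish_iter_lie0 n x y : vanish 1 x -> vanish n (iter n (lie x) y).
Proof.
by move=> hx; have := @vanish_iter_lie _ _ 0 n _ _ hx (@vanish0 _ _ y); rewrite addn0.
Qed.

Lemma ncexp_mul_ad x y : vanish 1 x -> ncexp x * y = exp_ad x y * ncexp x.
Proof.
move=> hx; have hv n : vanish n (iter n (lie x) y) by apply: vanish_iter_lie0.
have ht := vanish_exp_term hx.
rewrite /ncexp ncsumMr // /exp_ad ncsumM // => [|n]; last exact/vanishZ.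
apply: eq_ncsum => n; rewrite -scalerAl exprMn_lie scaler_sumr.
apply: eq_bigr => j _; rewrite -scaler_nat scalerA -ratk_nat -ratkM inv_fact_bin -1?ltnS //.
by rewrite -scalerAl -scalerAr scalerA ratkM.
Qed.

Lemma exp_ad_conj x y : vanish 1 x -> ncexp x * y * ncexp (- x) = exp_ad x y.
Proof. by move=> hx; rewrite ncexp_mul_ad // -mulrA ncexp_mulN // mulr1. Qed.

(** The Leibniz rule leaves a factor [dg z] in each position; [exprMn_lie] moves it to the left, and
    Pascal's rule collects the coefficients. *)
Lemma dgX_lie z n : dg (z ^+ n.+1) =
  \sum_(j < n.+1) (iter j (lie z) (dg z) * z ^+ (n - j)) *+ 'C(n.+1, j.+1).
Proof.
elim: n => [|n IH]; first by rewrite big_ord1 /= mulr1.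
rewrite exprSr dgM IH exprMn_lie [X in _ = X]big_ord_recr /= [X in _ + X]big_ord_recr /=.
rewrite subnn !binn addrA mulr_suml -big_split /=; congr (_ + _).
apply: eq_bigr => j _; have jn : (j <= n)%N by rewrite -ltnS.
by rewrite [in RHS]binS [in RHS]mulrnDr mulrnAl subSn // exprSr mulrA.
Qed.

(** The differential of the exponential: D(e^z) e^{-z} = ((e^{ad z} - 1)/ad z)(D z), for the
    derivation D = [dg]. *)
Lemma dg_ncexp z : vanish 1 z -> dg (ncexp z) = dexp_ad z (dg z) * ncexp z.
Proof.
move=> hz; have ht := vanish_exp_term hz.
have hv n : vanish n (iter n (lie z) (dg z)) by apply: vanish_iter_lie0.
rewrite dg_ncsum ncsum_recl => [|n]; last exact/dg_vanish.
rewrite expr0 linearZ /= dg1 scaler0 add0r /dexp_ad /ncexp ncsumM // => [|n]; last exact/vanishZ.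
apply: eq_ncsum => n; rewrite linearZ /= dgX_lie scaler_sumr.
apply: eq_bigr => j _; rewrite -scaler_nat scalerA -ratk_nat -ratkM inv_fact_bin //.
by rewrite -scalerAl -scalerAr scalerA subSS ratkM.
Qed.

Definition hpart d a := NCSeries (fun w => if size w == d then a w else 0).

Lemma hpart_coefE d a w : hpart d a w = if size w == d then a w else 0.
Proof. by []. Qed.

Lemma hpart_linear d : linear (hpart d).
Proof.
move=> l a b; apply: ncseriesP => w.
rewrite !(ncaddE, ncscaleE, hpart_coefE).
by case: eqP => // _; rewrite mulr0 addr0.
Qed.
HB.instance Definition _ d :=
  GRing.isLinear.Build k (ncseries k X) (ncseries k X) *:%R (hpart d) (hpart_linear d).

Lemma hpartM d a b : hpart d (a * b) = \sum_(i < d.+1) hpart i a * hpart (d - i)%N b.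
Proof.
apply: ncseriesP => w; rewrite hpart_coefE ncsumE.
under eq_bigr do rewrite ncmulE.
rewrite exchange_big ncmulE /=; case: eqP => [sd|/eqP sd].
  move: d sd => d <-; apply: eq_bigr => i _; have iw : (i <= size w)%N by rewrite -ltnS.
  rewrite (bigD1 i) //= big1 => [|j].
    by rewrite size_takel // eqxx size_drop eqxx addr0.
  rewrite -val_eqE /= size_takel // eq_sym => /negPf ->.
  by rewrite mul0r.
rewrite big1 // => i _; rewrite big1 // => j _.
have iw : (i <= size w)%N by rewrite -ltnS.
have jd : (j <= d)%N by rewrite -ltnS.
rewrite size_takel // size_drop; case: eqP => [ij|]; rewrite ?mul0r //.
case: eqP => [e|]; rewrite ?mulr0 //.
by case/eqP: sd; rewrite -(subnKC iw) e ij subnKC.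
Qed.

Lemma hpart_lie d a b :
  hpart d (lie a b) = \sum_(i < d.+1) lie (hpart i a) (hpart (d - i)%N b).
Proof.
rewrite /lie linearB /= !hpartM sumrB; congr (_ - _).
rewrite (reindex_inj rev_ord_inj); apply: eq_bigr => i _ /=.
by rewrite subSS subKn // -ltnS.
Qed.

Lemma vanish_hpart n d a : vanish n a -> vanish n (hpart d a).
Proof. by move=> ha w wn; rewrite hpart_coefE ha // if_same. Qed.

Lemma sum_hpart (c : nat -> k) N a w : (size w < N)%N ->
  (\sum_(d < N) c d *: hpart d a) w = c (size w) * a w.
Proof.
move=> wN; rewrite ncsumE (bigD1 (Ordinal wN)) //= eqxx big1 ?addr0 // => d.
by rewrite -val_eqE /= eq_sym => /negPf ->; rewrite mulr0.
Qed.

End ExpAd.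

(** * Lie series and the Baker-Campbell-Hausdorff theorem *)

Section LieSeries.
Variables (k : comAlgType rat) (X : finType).
Implicit Types (a b x y z u v : ncseries k X).

Lemma lie_polyD a b : lie_poly a -> lie_poly b -> lie_poly (a + b).
Proof. by move=> ha hb; rewrite -[a]scale1r; apply: lie_poly_lin. Qed.
Lemma lie_polyZ (l : k) a : lie_poly a -> lie_poly (l *: a).
Proof. by move=> ha; rewrite -[_ *: _]addr0; apply: lie_poly_lin => //; apply: lie_poly0. Qed.
Lemma lie_poly_sum I (r : seq I) (P : pred I) (F : I -> ncseries k X) :
  (forall i, P i -> lie_poly (F i)) -> lie_poly (\sum_(i <- r | P i) F i).
Proof. by move=> h; apply: big_ind => //; [exact: lie_poly0|exact: lie_polyD]. Qed.

Lemma lie_poly_vanish a : lie_poly a -> vanish 1 a.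
Proof.
elim=> {a} [|x|l a b _ ha _ hb|a b _ ha _ hb].
- exact: vanish_zero.
- exact: vanish_nword [:: x].
- exact/vanishD/hb/vanishZ.
- exact: (vanishW _ (vanish_lie ha hb)).
Qed.

Lemma hpart_letter d (x : X) : hpart d (letter k x) = if d == 1%N then letter k x else 0.
Proof.
apply: ncseriesP => w; rewrite hpart_coefE.
case: (eqVneq d 1%N) => [->|d1]; case: eqP => // e; rewrite /letter /=.
  by case: eqP e => // ->.
by case: eqP e => // -> /esym/eqP; rewrite (negPf d1).
Qed.

Lemma lie_poly_hpart d a : lie_poly a -> lie_poly (hpart d a).
Proof.
move=> ha; elim: ha d => {a} [|x|l a b _ ha _ hb|a b _ ha _ hb] d.
- by rewrite linear0; apply: lie_poly0.
- by rewrite hpart_letter; case: eqP => _; [apply: lie_poly_letter|apply: lie_poly0].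
- by rewrite linearP /=; apply: lie_poly_lin.
- by rewrite hpart_lie; apply: lie_poly_sum => i _; apply: lie_poly_lie.
Qed.

Lemma lie_poly_series a : lie_poly a -> lie_series a.
Proof. by move=> ha n; exists a. Qed.

Lemma lie_seriesP a : (forall n, exists2 b, lie_series b & vanish n (a - b)) ->
  lie_series a.
Proof.
move=> h n; have [b hb ab] := h n; have [c hc /agreeP bc] := hb n.
by exists c => //; apply/agreeP/vanish_trans/bc.
Qed.

Lemma lie_series_vanish a : lie_series a -> vanish 1 a.
Proof.
move=> h; have [b /lie_poly_vanish hb /agreeP ab] := h 1%N.
by rewrite -(subrK b a); apply: vanishD.
Qed.

Lemma lie_series0 : lie_series (0 : ncseries k X).
Proof. exact/lie_poly_series/lie_poly0. Qed.
Lemma lie_series_letter (x : X) : lie_series (letter k x).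
Proof. exact/lie_poly_series/lie_poly_letter. Qed.
Lemma lie_seriesD a b : lie_series a -> lie_series b -> lie_series (a + b).
Proof.
move=> ha hb n; have [c hc /agreeP ac] := ha n; have [d hd /agreeP bd] := hb n.
exists (c + d); first exact: lie_polyD.
by apply/agreeP; rewrite opprD addrACA; apply: vanishD.
Qed.
Lemma lie_seriesZ (l : k) a : lie_series a -> lie_series (l *: a).
Proof.
move=> ha n; have [c hc /agreeP ac] := ha n; exists (l *: c); first exact: lie_polyZ.
by apply/agreeP; rewrite -scalerBr; apply: vanishZ.
Qed.
Lemma lie_seriesN a : lie_series a -> lie_series (- a).
Proof. by rewrite -scaleN1r; apply: lie_seriesZ. Qed.
Lemma lie_seriesB a b : lie_series a -> lie_series b -> lie_series (a - b).
Proof. by move=> ha hb; apply/lie_seriesD/lie_seriesN. Qed.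
Lemma lie_series_sum I (r : seq I) (P : pred I) (F : I -> ncseries k X) :
  (forall i, P i -> lie_series (F i)) -> lie_series (\sum_(i <- r | P i) F i).
Proof. by move=> h; apply: big_ind => //; [exact: lie_series0|exact: lie_seriesD]. Qed.
Lemma lie_series_lie a b : lie_series a -> lie_series b -> lie_series (lie a b).
Proof.
move=> ha hb n; have [c hc /agreeP ac] := ha n; have [d hd /agreeP bd] := hb n.
exists (lie c d); first exact: lie_poly_lie.
apply/agreeP; rewrite /lie opprD addrACA; apply: vanishD; first exact: vanish_subM.
by rewrite -opprD; apply/vanishN/vanish_subM.
Qed.
Lemma lie_series_iter n a b : lie_series a -> lie_series b ->
  lie_series (iter n (lie a) b).
Proof. by move=> ha hb; elim: n => //= n; apply: lie_series_lie. Qed.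
Lemma lie_series_ncsum (u : nat -> ncseries k X) : (forall n, vanish n (u n)) ->
  (forall n, lie_series (u n)) -> lie_series (ncsum u).
Proof.
move=> hu hl; apply: lie_seriesP => n; exists (\sum_(i < n) u i).
  exact: lie_series_sum.
exact: ncsum_approx.
Qed.

Lemma lie_series_exp_ad x y : lie_series x -> lie_series y -> lie_series (exp_ad x y).
Proof.
move=> hx hy; apply: lie_series_ncsum => n.
  exact/vanishZ/vanish_iter_lie0/lie_series_vanish.
exact/lie_seriesZ/lie_series_iter.
Qed.
Lemma lie_series_dexp_ad x y : lie_series x -> lie_series y -> lie_series (dexp_ad x y).
Proof.
move=> hx hy; apply: lie_series_ncsum => n.
  exact/vanishZ/vanish_iter_lie0/lie_series_vanish.
exact/lie_seriesZ/lie_series_iter.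
Qed.
Lemma lie_series_todd x y : lie_series x -> lie_series y -> lie_series (todd_ad x y).
Proof.
move=> hx hy; apply: lie_series_ncsum => n.
  exact/vanishZ/vanish_iter_lie0/lie_series_vanish.
exact/lie_seriesZ/lie_series_iter.
Qed.

(** Homogeneous components of Lie polynomials are Lie polynomials, so they can be rescaled degree by
    degree. *)
Lemma lie_series_dg a : lie_series a -> lie_series (dg a).
Proof.
move=> ha n; have [b hb /agreeP ab] := ha n.
exists (\sum_(d < n) d%:R *: hpart d b).
  by apply: lie_poly_sum => d _; apply/lie_polyZ/lie_poly_hpart.
move=> w wn; rewrite (sum_hpart (fun d => d%:R)) // dg_coefE.
by have /agreeP -> := ab.
Qed.

Lemma dg_lie_approx n a p : vanish 1 a -> lie_poly p -> vanish n (dg a - p) ->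
  exists2 b, lie_poly b & vanish n (a - b).
Proof.
move=> ha hp ap.
(* [dg] is inverted by dividing degree d by d. In degree 0 the inverse of 0 is 0, which is right
   because a has no constant term. *)
exists (\sum_(d < n) ((d%:R)^-1 : rat)%:A *: hpart d p).
  by apply: lie_poly_sum => d _; apply/lie_polyZ/lie_poly_hpart.
move=> w wn; rewrite ncaddE ncoppE (sum_hpart (fun d => ((d%:R)^-1 : rat)%:A)) //.
have /agreeP/(_ w wn) <- := ap; rewrite dg_coefE mulrA.
case: w wn => [|x w] _; first by rewrite ha // !mulr0 subr0.
by rewrite [X in X * _]mulrC ratk_inv mul1r subrr.
Qed.

Lemma vanish_sub_lie n z b x y : vanish 1 z -> vanish 1 b -> vanish 1 x ->
  vanish 1 y -> vanish n (z - b) -> vanish n (x - y) ->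
  vanish n.+1 (lie z x - lie b y).
Proof.
move=> hz hb hx hy zb xy.
have -> : lie z x - lie b y = lie (z - b) x + lie b (x - y).
  by rewrite lieDl lieNl lieDr lieNr addrA subrK.
by apply: vanishD; [rewrite -addn1|rewrite -add1n]; apply: vanish_lie.
Qed.

Lemma vanish_iter_lie_sub n m z b x y : vanish 1 z -> vanish 1 b -> vanish 1 x ->
  vanish 1 y -> vanish n (z - b) -> vanish n (x - y) ->
  vanish n (iter m (lie z) x - iter m (lie b) y).
Proof.
move=> hz hb hx hy zb xy; elim: m => //= m IH.
apply/(@vanishW _ _ n n.+1)/vanish_sub_lie => //.
  by apply/(@vanishW _ _ 1 (m + 1)); [rewrite addn1|apply: vanish_iter_lie].
by apply/(@vanishW _ _ 1 (m + 1)); [rewrite addn1|apply: vanish_iter_lie].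
Qed.

(** The hypothesis concerns [dg z] plus brackets of z with [dg z], and brackets gain one degree. So
    a Lie approximation of z to order n + 1 determines these brackets to order n + 2, hence yields
    Lie approximations of [dg z], and then of z, to order n + 2. *)
Lemma lie_series_of_dexp z : vanish 1 z -> lie_series (dexp_ad z (dg z)) -> lie_series z.
Proof.
move=> hz hL n; suff [b hb zb] : exists2 b, lie_poly b & vanish n (z - b).
  by exists b => //; apply/agreeP.
elim: n => [|[_|n [b hb zb]]].
- by exists 0; [exact: lie_poly0|exact: vanish0].
- by exists 0; [exact: lie_poly0|rewrite subr0].
(* The terms of [dexp_ad x y] after the first, which is y itself. *)
pose F (x y : ncseries k X) m := ((m.+2`!%:R)^-1 : rat)%:A *: iter m.+1 (lie x) y.
have vF x y : vanish 1 x -> forall m, vanish m (F x y m).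
  move=> hx m; apply/vanishZ/(@vanishW _ _ m m.+1) => //.
  exact: vanish_iter_lie0.
have hb1 := lie_poly_vanish hb; have db1 := dg_vanish1 b; have dz1 := dg_vanish1 z.
have lb := lie_poly_series hb.
have hc : lie_series (dexp_ad z (dg z) - ncsum (F b (dg b))).
  apply/lie_seriesB/lie_series_ncsum => //; first exact: vF.
  by move=> m; apply/lie_seriesZ/lie_series_iter => //; apply: lie_series_dg.
have zc : vanish n.+2 (dg z - (dexp_ad z (dg z) - ncsum (F b (dg b)))).
  rewrite /dexp_ad ncsum_recl => [|m]; last exact/vanishZ/vanish_iter_lie0.
  rewrite -/(F z (dg z)) invr1 !scale1r /= -addrA opprD addrA subrr add0r opprB ncsumB.
  apply: ncsum_vanish => m; rewrite -scalerBr; apply: vanishZ.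
  apply: vanish_sym.
  have it1 x y : vanish 1 x -> vanish 1 y -> vanish 1 (iter m (lie x) y).
    move=> hx hy; apply/(@vanishW _ _ 1 (m + 1)); first by rewrite addn1.
    exact: vanish_iter_lie.
  apply: vanish_sub_lie; do ?exact: it1; do ?by [].
  by apply: vanish_iter_lie_sub => //; rewrite -linearB; apply: dg_vanish.
have [p hp pc] := hc n.+2; move/agreeP in pc.
exact: dg_lie_approx hz hp (vanish_trans zc pc).
Qed.

(** With D = [dg], the logarithmic derivative D(uv)(uv)^{-1} is D(u)u^{-1} + u (D(v)v^{-1}) u^{-1},
    a sum of two Lie series by [dg_ncexp] and [exp_ad_conj]; [lie_series_of_dexp] then shows that
    log(uv) is a Lie series. *)
Lemma is_lie_expM u v : is_lie_exp u -> is_lie_exp v -> is_lie_exp (u * v).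
Proof.
move=> [a ha ->] [b hb ->]; have a1 := lie_series_vanish ha; have b1 := lie_series_vanish hb.
set w := _ * _; have w1 : w [::] = 1 by apply: mul_nil; apply: ncexp_nil.
exists (nclog w); last by rewrite ncexp_log.
have z1 := vanish_log w1; apply: lie_series_of_dexp => //.
have := dg_ncexp z1; rewrite ncexp_log // => /(congr1 (fun c => c * ncinv w)).
rewrite -[RHS]mulrA ncmulrV // mulr1 => <-.
rewrite dgM !dg_ncexp // ncinvM ?ncexp_nil // !ncexpN // mulrDl.
rewrite [X in X + _](_ : _ = dexp_ad a (dg a)); last first.
  by rewrite -!mulrA [ncexp b * _]mulrA ncexp_mulN // mul1r ncexp_mulN // mulr1.
rewrite [X in _ + X](_ : _ = exp_ad a (dexp_ad b (dg b))); last first.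
  by rewrite -!mulrA [ncexp b * _]mulrA ncexp_mulN // mul1r mulrA exp_ad_conj.
by apply: lie_seriesD; [|apply: lie_series_exp_ad => //];
  apply: lie_series_dexp_ad => //; apply: lie_series_dg.
Qed.

Lemma is_lie_exp_ncexp a : lie_series a -> is_lie_exp (ncexp a).
Proof. by exists a. Qed.

Lemma is_lie_exp_nil u : is_lie_exp u -> u [::] = 1.
Proof. by move=> [a /lie_series_vanish ha ->]; apply: ncexp_nil. Qed.

Lemma is_lie_expV u : is_lie_exp u -> is_lie_exp (ncinv u).
Proof.
move=> [a ha ->]; rewrite ncexpN; last exact: lie_series_vanish.
exact/is_lie_exp_ncexp/lie_seriesN.
Qed.

End LieSeries.

Section LieSubst.
Variables (k : comAlgType rat) (X Y : finType) (s : X -> ncseries k Y).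
Hypothesis hs : forall x, lie_series (s x).

Let hs1 x : vanish 1 (s x). Proof. exact: lie_series_vanish. Qed.

Lemma lie_series_subst a : lie_series a -> lie_series (subst s a).
Proof.
move=> ha; apply: lie_seriesP => n; have [b hb /agreeP ab] := ha n.
exists (subst s b); last by rewrite -linearB; apply: subst_vanish.
elim: hb => {b ab} [|x|l a' b _ IHa _ IHb|a' b _ IHa _ IHb].
- by rewrite linear0; apply: lie_series0.
- by rewrite subst_letter.
- by rewrite linearP /=; apply/lie_seriesD/IHb/lie_seriesZ.
- by rewrite subst_lie //; apply: lie_series_lie.
Qed.

Lemma is_lie_exp_subst u : is_lie_exp u -> is_lie_exp (subst s u).
Proof.
move=> [a ha ->]; rewrite subst_exp //; last exact: lie_series_vanish.
exact/is_lie_exp_ncexp/lie_series_subst.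
Qed.

End LieSubst.

(** * The quotient ring by the closed ideal of the relators *)

Section IdealSpan.
Variables (A : pzRingType) (S : A -> Prop).

Lemma ideal_span_in a : S a -> ideal_span S a.
Proof.
move=> ha; rewrite -[a]mul1r -[X in ideal_span S X]addr0 -[1 * a]mulr1.
by apply: ideal_spanD => //; apply: ideal_span0.
Qed.
Lemma ideal_span_add a b : ideal_span S a -> ideal_span S b -> ideal_span S (a + b).
Proof. by elim=> [|c s d e hs he IH] hb; rewrite ?add0r // -addrA; apply: ideal_spanD; auto. Qed.
Lemma ideal_span_mull a b : ideal_span S b -> ideal_span S (a * b).
Proof.
elim=> [|c s d e hs he IH]; first by rewrite mulr0; apply: ideal_span0.
by rewrite mulrDr !mulrA; apply: ideal_spanD.
Qed.
Lemma ideal_span_mulr a b : ideal_span S a -> ideal_span S (a * b).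
Proof.
elim=> [|c s d e hs he IH]; first by rewrite mul0r; apply: ideal_span0.
by rewrite mulrDl -[_ * d * b]mulrA; apply: ideal_spanD.
Qed.
Lemma ideal_spanN a : ideal_span S a -> ideal_span S (- a).
Proof. by move=> h; rewrite -mulN1r; apply: ideal_span_mull. Qed.

End IdealSpan.

Section Cong.
Variables (k : comAlgType rat) (X : finType) (R : ncseries k X -> Prop).
Implicit Types (a b c x y : ncseries k X).

(* The closure of the ideal spanned by [R]. *)
Definition cideal a := forall n, exists2 c, ideal_span R c & vanish n (a - c).

Lemma congP a b : cong R a b <-> cideal (a - b).
Proof. by split=> h n; have [c hc /agreeP hn] := h n; exists c => //; apply/agreeP. Qed.

Lemma cideal_span a : ideal_span R a -> cideal a.
Proof. by move=> h n; exists a => //; rewrite subrr. Qed.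
Lemma cideal0 : cideal 0.
Proof. exact/cideal_span/ideal_span0. Qed.
Lemma cidealD a b : cideal a -> cideal b -> cideal (a + b).
Proof.
move=> ha hb n; have [c hc ac] := ha n; have [d hd bd] := hb n.
exists (c + d); first exact: ideal_span_add.
by rewrite opprD addrACA; apply: vanishD.
Qed.
Lemma cidealMl a b : cideal b -> cideal (a * b).
Proof.
move=> hb n; have [d hd bd] := hb n; exists (a * d); first exact: ideal_span_mull.
by rewrite -mulrBr; apply: vanishMl.
Qed.
Lemma cidealMr a b : cideal a -> cideal (a * b).
Proof.
move=> hb n; have [d hd bd] := hb n; exists (d * b); first exact: ideal_span_mulr.
by rewrite -mulrBl; apply: vanishMr.
Qed.
Lemma cidealN a : cideal a -> cideal (- a).
Proof. by move=> h; rewrite -mulN1r; apply: cidealMl. Qed.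
Lemma cidealZ (l : k) a : cideal a -> cideal (l *: a).
Proof. by move=> h; rewrite -mulr_algl; apply: cidealMl. Qed.
Lemma cideal_lim a : (forall n, exists2 b, cideal b & vanish n (a - b)) -> cideal a.
Proof.
move=> h n; have [b hb ab] := h n; have [c hc bc] := hb n; exists c => //.
exact: vanish_trans ab bc.
Qed.
Lemma cideal_sum I (r : seq I) (P : pred I) (F : I -> ncseries k X) :
  (forall i, P i -> cideal (F i)) -> cideal (\sum_(i <- r | P i) F i).
Proof. by move=> h; apply: big_ind => //; [exact: cideal0|exact: cidealD]. Qed.
Lemma cideal_ncsum (u : nat -> ncseries k X) : (forall n, vanish n (u n)) ->
  (forall n, cideal (u n)) -> cideal (ncsum u).
Proof.
move=> hu hl; apply: cideal_lim => n; exists (\sum_(i < n) u i).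
  exact: cideal_sum.
exact: ncsum_approx.
Qed.

Definition congb a b := `[< cideal (a - b) >].
Fact congb_refl : reflexive congb.
Proof. by move=> a; apply/asboolP; rewrite subrr; apply: cideal0. Qed.
Fact congb_sym : symmetric congb.
Proof.
by move=> a b; apply/asboolP/asboolP => h; rewrite -opprB; apply: cidealN.
Qed.
Fact congb_trans : transitive congb.
Proof.
move=> b a c /asboolP ab /asboolP bc; apply/asboolP.
by rewrite -(subrK b a) -addrA; apply: cidealD.
Qed.
Definition congb_equiv := EquivRel congb congb_refl congb_sym congb_trans.

(** In this quotient [cong R] becomes an equality ([qpiP]) that can be rewritten with. For arbitrary
    relators it may be the zero ring, hence only a [pzRingType]. *)
Definition quo : Type := {eq_quot congb_equiv}.
HB.instance Definition _ := Choice.on quo.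
Definition qpi a : quo := \pi_({eq_quot congb_equiv})%qT a.
Definition qrepr (p : quo) : ncseries k X := repr p.

Lemma qreprK p : qpi (qrepr p) = p. Proof. exact: reprK. Qed.
Lemma qpi_eq a b : qpi a = qpi b <-> cideal (a - b).
Proof. by split=> [/eqmodP/asboolP|h] //; apply/eqmodP/asboolP. Qed.
Lemma qpiP a b : cong R a b <-> qpi a = qpi b.
Proof. by rewrite qpi_eq congP. Qed.
Lemma qrepr_pi a : cideal (qrepr (qpi a) - a).
Proof. by apply/qpi_eq; rewrite qreprK. Qed.

Definition qadd p q := qpi (qrepr p + qrepr q).
Definition qopp p := qpi (- qrepr p).
Definition qmul p q := qpi (qrepr p * qrepr q).
Definition qscale (l : k) p := qpi (l *: qrepr p).

Lemma qaddE a b : qadd (qpi a) (qpi b) = qpi (a + b).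
Proof. by apply/qpi_eq; rewrite opprD addrACA; apply: cidealD; apply: qrepr_pi. Qed.
Lemma qoppE a : qopp (qpi a) = qpi (- a).
Proof. by apply/qpi_eq; rewrite -opprD; apply/cidealN/qrepr_pi. Qed.
Lemma qmulE a b : qmul (qpi a) (qpi b) = qpi (a * b).
Proof.
apply/qpi_eq; set a' := qrepr (qpi a); set b' := qrepr (qpi b).
have -> : a' * b' - a * b = (a' - a) * b' + a * (b' - b).
  by rewrite mulrBl mulrBr addrA subrK.
by apply: cidealD; [apply: cidealMr|apply: cidealMl]; apply: qrepr_pi.
Qed.
Lemma qscaleE l a : qscale l (qpi a) = qpi (l *: a).
Proof. by apply/qpi_eq; rewrite -scalerBr; apply/cidealZ/qrepr_pi. Qed.

Let qE := (qaddE, qoppE, qmulE, qscaleE).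

Fact qaddA : associative qadd.
Proof. by move=> p q r; rewrite -(qreprK p) -(qreprK q) -(qreprK r) !qE addrA. Qed.
Fact qaddC : commutative qadd.
Proof. by move=> p q; rewrite -(qreprK p) -(qreprK q) !qE addrC. Qed.
Fact qadd0 : left_id (qpi 0) qadd.
Proof. by move=> p; rewrite -(qreprK p) !qE add0r. Qed.
Fact qaddN : left_inverse (qpi 0) qopp qadd.
Proof. by move=> p; rewrite -(qreprK p) !qE addNr. Qed.
HB.instance Definition _ := GRing.isZmodule.Build quo qaddA qaddC qadd0 qaddN.

Fact qmulA : associative qmul.
Proof. by move=> p q r; rewrite -(qreprK p) -(qreprK q) -(qreprK r) !qE mulrA. Qed.
Fact qmul1l : left_id (qpi 1) qmul.
Proof. by move=> p; rewrite -(qreprK p) !qE mul1r. Qed.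
Fact qmul1r : right_id (qpi 1) qmul.
Proof. by move=> p; rewrite -(qreprK p) !qE mulr1. Qed.
Fact qmulDl : left_distributive qmul qadd.
Proof. by move=> p q r; rewrite -(qreprK p) -(qreprK q) -(qreprK r) !qE mulrDl. Qed.
Fact qmulDr : right_distributive qmul qadd.
Proof. by move=> p q r; rewrite -(qreprK p) -(qreprK q) -(qreprK r) !qE mulrDr. Qed.
HB.instance Definition _ := GRing.Zmodule_isPzRing.Build quo
  qmulA qmul1l qmul1r qmulDl qmulDr.

Fact qscaleA l m p : qscale l (qscale m p) = qscale (l * m) p.
Proof. by rewrite -(qreprK p) !qE scalerA. Qed.
Fact qscale1 : left_id 1 qscale.
Proof. by move=> p; rewrite -(qreprK p) !qE scale1r. Qed.
Fact qscaleDr : right_distributive qscale +%R.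
Proof.
move=> l p q; rewrite -(qreprK p) -(qreprK q) -[LHS]/(qscale l (qadd _ _)).
by rewrite -[RHS]/(qadd _ _) !qE scalerDr.
Qed.
Fact qscaleDl p : {morph qscale^~ p : l m / l + m}.
Proof.
by move=> l m; rewrite -(qreprK p) -[RHS]/(qadd _ _) !qE scalerDl.
Qed.
HB.instance Definition _ := GRing.Zmodule_isLmodule.Build k quo
  qscaleA qscale1 qscaleDr qscaleDl.

Fact qpi_linear : linear qpi.
Proof. by move=> l a b; rewrite -qaddE -qscaleE. Qed.
HB.instance Definition _ := GRing.isLinear.Build k (ncseries k X) quo *:%R qpi qpi_linear.
Fact qpi_monoid : monoid_morphism qpi.
Proof. by split=> // a b; rewrite -qmulE. Qed.
HB.instance Definition _ := GRing.isMonoidMorphism.Build (ncseries k X) quo qpi qpi_monoid.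

Lemma qpiM a b : qpi (a * b) = qpi a * qpi b. Proof. exact: rmorphM. Qed.
Lemma qpiD a b : qpi (a + b) = qpi a + qpi b. Proof. exact: linearD. Qed.
Lemma qpiN a : qpi (- a) = - qpi a. Proof. exact: linearN. Qed.
Lemma qpiB a b : qpi (a - b) = qpi a - qpi b. Proof. exact: linearB. Qed.
Lemma qpiZ l a : qpi (l *: a) = l *: qpi a. Proof. exact: linearZ. Qed.
Lemma qpi1 : qpi 1 = 1. Proof. by []. Qed.
Lemma qpi0 : qpi 0 = 0. Proof. by []. Qed.
Lemma qpi_lie a b : qpi (lie a b) = lie (qpi a) (qpi b).
Proof. by rewrite /lie qpiB !qpiM. Qed.
Lemma qpi_iter_lie n a b : qpi (iter n (lie a) b) = iter n (lie (qpi a)) (qpi b).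
Proof. by elim: n => //= n <-; rewrite qpi_lie. Qed.
Lemma qpi_rel a : R a -> qpi a = 0.
Proof.
by move=> h; rewrite -qpi0; apply/qpi_eq; rewrite subr0; apply/cideal_span/ideal_span_in.
Qed.
Lemma qpi_eq0 a : qpi a = 0 <-> cideal a.
Proof. by rewrite -qpi0 qpi_eq subr0. Qed.

Lemma qscaleAl l (p q : quo) : l *: (p * q) = (l *: p) * q.
Proof.
by rewrite -(qreprK p) -(qreprK q) -qpiM -!qpiZ -qpiM scalerAl.
Qed.
Lemma qscaleAr l (p q : quo) : l *: (p * q) = p * (l *: q).
Proof.
by rewrite -(qreprK p) -(qreprK q) -qpiM -!qpiZ -qpiM scalerAr.
Qed.

Lemma qpi_lim a b : (forall n, exists2 c, qpi c = qpi b & vanish n (a - c)) ->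
  qpi a = qpi b.
Proof.
move=> h; apply/qpi_eq/cideal_lim => n; have [c /qpi_eq hc ac] := h n.
by exists (c - b); rewrite // opprB addrA subrK.
Qed.

Lemma qpi_ncsum (u v : nat -> ncseries k X) : (forall n, vanish n (u n)) ->
  (forall n, vanish n (v n)) ->
  (forall n, qpi (u n) = qpi (v n)) -> qpi (ncsum u) = qpi (ncsum v).
Proof.
move=> hu hv uv; apply/qpi_eq; rewrite ncsumB; apply: cideal_ncsum => n.
  exact: vanishB.
exact/qpi_eq.
Qed.

End Cong.

(** * Conjugation and central shifts under substitution *)

Section Intertwine.
Variables (k : comAlgType rat) (X : finType) (R : ncseries k X -> Prop).
Local Notation pi := (@qpi k X R).
Implicit Types (u v : ncseries k X).

(** The relation passes from letters to words, to linear combinations, and to limits because the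
    ideal is closed. It covers conjugation, commutation (s = s') and congruence of the substituted
    values (g = 1). *)
Lemma subst_intertwine (Y : finType) (s s' : Y -> ncseries k X) (g : quo R) a :
  (forall y, vanish 1 (s y)) -> (forall y, vanish 1 (s' y)) ->
  (forall y, g * pi (s y) = pi (s' y) * g) ->
  g * pi (subst s a) = pi (subst s' a) * g.
Proof.
move=> hs hs' hg; move: a; apply: series_ind => [|l w a IH|a h].
- by rewrite !linear0 mulr0 mul0r.
- rewrite !linearP /= mulrDr mulrDl IH -qscaleAr -qscaleAl; congr (_ *: _ + _).
  rewrite !subst_nword //; elim: w => [|x w IHw]; first by rewrite !big_nil mulr1 mul1r.
  by rewrite !big_cons !qpiM mulrA hg -mulrA IHw mulrA.
rewrite -(qreprK g) -!qpiM; apply/qpi_eq/cideal_lim => n; have [c IH ac] := h n.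
exists (qrepr g * subst s c - subst s' c * qrepr g).
  by apply/qpi_eq; rewrite !qpiM qreprK.
rewrite opprB [X in vanish _ X](AC (2*2) ((1*4)*(3*2))) /= -mulrBr -mulrBl -!linearB.
apply: vanishD; [apply/vanishMl|apply/vanishMr]; apply: subst_vanish => //.
exact: vanish_sym.
Qed.

(** Presents an exponential as a substitution into a one-letter series, so that [subst_intertwine]
    and [qpi_subst] apply to it. *)
Lemma exp_subst1 (a : ncseries k X) : vanish 1 a ->
  ncexp a = subst (fun=> a) (ncexp (letter k tt)).
Proof.
by move=> ha; rewrite subst_exp ?subst_letter //; exact: (@vanish_nword _ _ [:: tt]).
Qed.

Lemma exp_intertwine (g : quo R) a a' : vanish 1 a -> vanish 1 a' ->
  g * pi a = pi a' * g -> g * pi (ncexp a) = pi (ncexp a') * g.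
Proof. by move=> ha ha' h; rewrite !exp_subst1 //; apply: subst_intertwine. Qed.

Lemma qpi_subst (Y : finType) (s s' : Y -> ncseries k X) a :
  (forall y, vanish 1 (s y)) -> (forall y, vanish 1 (s' y)) ->
  (forall y, pi (s y) = pi (s' y)) -> pi (subst s a) = pi (subst s' a).
Proof.
move=> hs hs' h; rewrite -[LHS]mul1r -[RHS]mulr1; apply: subst_intertwine => // y.
by rewrite mulr1 mul1r.
Qed.

Lemma qpi_exp a a' : vanish 1 a -> vanish 1 a' -> pi a = pi a' ->
  pi (ncexp a) = pi (ncexp a').
Proof. by move=> ha ha' h; rewrite !exp_subst1 //; apply: qpi_subst. Qed.

Lemma qpi_log u u' : u [::] = 1 -> u' [::] = 1 -> pi u = pi u' ->
  pi (nclog u) = pi (nclog u').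
Proof.
have e (v : ncseries k X) : v [::] = 1 ->
    nclog v = subst (fun=> v - 1) (nclog (1 + letter k tt)).
  move=> /vanish_sub1P hv; rewrite subst_log //; last first.
    apply/vanish_sub1P; rewrite [1 + _]addrC addrK; exact: (@vanish_nword _ _ [:: tt]).
  by rewrite linearD /= subst1 // subst_letter // addrC subrK.
move=> hu hu' h; rewrite !e //; apply: qpi_subst => _; do ?exact/vanish_sub1P.
by rewrite !qpiB h.
Qed.

Lemma qpi_todd (x x' y y' : ncseries k X) : vanish 1 x -> vanish 1 x' -> pi x = pi x' -> pi y = pi y' ->
  pi (todd_ad x y) = pi (todd_ad x' y').
Proof.
move=> hx hx' xx' yy'; apply: qpi_ncsum => [n|n|n]; do ?exact: todd_vanish.
by rewrite !qpiZ !qpi_iter_lie xx' yy'.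
Qed.

Lemma qpi_mulV u : u [::] = 1 -> pi (ncinv u) * pi u = 1.
Proof. by move=> hu; rewrite -qpiM ncmulVr. Qed.
Lemma qpi_mulrV u : u [::] = 1 -> pi u * pi (ncinv u) = 1.
Proof. by move=> hu; rewrite -qpiM ncmulrV. Qed.
Lemma qpi_inv u (v : quo R) : u [::] = 1 -> pi u * v = 1 -> pi (ncinv u) = v.
Proof. by move=> hu uv; rewrite -[LHS]mulr1 -uv mulrA qpi_mulV // mul1r. Qed.

Lemma cideal_subst (Y : finType) (R' : ncseries k Y -> Prop) (s : Y -> ncseries k X) a :
  (forall y, vanish 1 (s y)) -> (forall r, R' r -> pi (subst s r) = 0) ->
  cideal R' a -> cideal R (subst s a).
Proof.
move=> hs h ha; apply: cideal_lim => n; have [c hc ac] := ha n.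
exists (subst s c); last by rewrite -linearB; apply: subst_vanish.
apply/qpi_eq0; elim: hc => {c ac} [|b r d c /h hr _ IH]; first by rewrite !linear0.
by rewrite linearD /= qpiD IH !substM // !qpiM hr mulr0 mul0r addr0.
Qed.

Lemma cong_subst (Y : finType) (R' : ncseries k Y -> Prop) (s : Y -> ncseries k X) a b :
  (forall y, vanish 1 (s y)) -> (forall r, R' r -> pi (subst s r) = 0) ->
  cong R' a b -> pi (subst s a) = pi (subst s b).
Proof.
by move=> hs h /congP ab; apply/qpi_eq; rewrite -linearB; apply: cideal_subst ab.
Qed.

Section Shift.
Variables (Y : finType) (s s' : Y -> ncseries k X) (d : Y -> quo R).
Hypotheses (hs : forall y, vanish 1 (s y)) (hs' : forall y, vanish 1 (s' y)).
Hypothesis ss' : forall y, pi (s' y) = pi (s y) + d y.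
Hypothesis ds : forall y z, d y * pi (s z) = pi (s z) * d y.
Hypothesis dd : forall y z, d y * d z = d z * d y.

(** The shifts commute with all substituted values and with each other, so they drop out of every
    bracket; only the linear part of a sees them. *)
Lemma shift_lie_poly a : lie_poly a ->
  pi (subst s' a) = pi (subst s a) + \sum_y a [:: y] *: d y.
Proof.
elim=> {a} [|x|l a b _ IHa _ IHb|a b ha IHa hb IHb].
- by rewrite !linear0 big1 ?addr0 // => y _; rewrite scale0r.
- rewrite !subst_letter // ss'; congr (_ + _).
  rewrite (bigD1 x) //= eqxx scale1r big1 ?addr0 // => y yx.
  by case: eqP => [[e]|]; rewrite ?scale0r // e eqxx in yx *.
- rewrite !linearP /= IHa IHb scalerDr addrACA; congr (_ + _).
  rewrite scaler_sumr -big_split; apply: eq_bigr => y _ /=.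
  by rewrite scalerDl scalerA.
rewrite !subst_lie // !qpi_lie IHa IHb [X in _ = _ + X]big1 => [|y _]; last first.
  rewrite (@vanish_lie _ _ 1 1 a b) ?scale0r //; exact: lie_poly_vanish.
have sC (P : quo R) (c : Y -> k) : (forall y, d y * P = P * d y) ->
    (\sum_y c y *: d y) * P = P * (\sum_y c y *: d y).
  move=> h; rewrite mulr_suml mulr_sumr; apply: eq_bigr => y _.
  by rewrite -qscaleAl -qscaleAr h.
have sP (c : Y -> k) p : (\sum_y c y *: d y) * pi (subst s p) =
    pi (subst s p) * (\sum_y c y *: d y).
  by apply: sC => y; apply: subst_intertwine.
have sS (c c' : Y -> k) : (\sum_y c y *: d y) * (\sum_y c' y *: d y) =
    (\sum_y c' y *: d y) * (\sum_y c y *: d y).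
  apply: sC => y; rewrite mulr_suml mulr_sumr; apply: eq_bigr => z _.
  by rewrite -qscaleAl -qscaleAr dd.
rewrite addr0 /lie !(mulrDl, mulrDr) !sP (sS _ (fun y => a [:: y])).
rewrite [X in _ - X](AC (2*2) ((1*3)*(2*4))) /=.
by rewrite opprD addrACA subrr addr0 opprD addrACA subrr addr0.
Qed.

Lemma shift_lie_exp (u : ncseries k Y) : is_lie_exp u -> (forall y, u [:: y] = 0) ->
  pi (subst s' u) = pi (subst s u).
Proof.
move=> [a ha ->] h; have a1 := lie_series_vanish ha.
have a0 y : a [:: y] = 0.
  have := h y; rewrite ncsum_coefE !big_ord_recr big_ord0 /=.
  by rewrite mulr0 !add0r expr1 (_ : 1`! = 1%N) // invr1 scale1r mul1r.
rewrite !subst_exp //; apply: qpi_exp; do ?exact: subst_vanish.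
(* Order at least 2 makes the one-letter coefficients of p equal to those of a, which are zero. *)
apply: qpi_lim => n; have [p hp /agreeP ap] := ha n.+2.
exists (subst s' p + subst s (a - p)).
  rewrite qpiD shift_lie_poly // big1 => [|y _]; last first.
    have /agreeP := ap; move=> /(_ [:: y]); rewrite a0 => <- //.
    by rewrite scale0r.
  by rewrite addr0 -qpiD -linearD /= addrC subrK.
rewrite opprD addrA -[X in vanish _ (X - _)]linearB /=.
by apply: vanishB; apply/subst_vanish/(vanishW _ ap)/leqW.
Qed.

End Shift.
End Intertwine.

(** * Coefficients of degree one *)

Section Coef1.
Variables (k : comAlgType rat) (X : finType).
Implicit Types (u v : ncseries k X).

Lemma ncmul_coef0 u v : (u * v) [::] = u [::] * v [::].
Proof. by rewrite ncmulE big_ord1. Qed.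

Lemma ncmul_coef1 u v x : (u * v) [:: x] = u [::] * v [:: x] + u [:: x] * v [::].
Proof. by rewrite ncmulE !big_ord_recr big_ord0 /= add0r. Qed.

Lemma mul_coef1 u v x : u [::] = 1 -> v [::] = 1 ->
  (u * v) [:: x] = u [:: x] + v [:: x].
Proof. by move=> hu hv; rewrite ncmul_coef1 hu hv mul1r mulr1 addrC. Qed.

Lemma inv_coef1 u x : u [::] = 1 -> ncinv u [:: x] = - u [:: x].
Proof.
move=> hu; have := congr1 (fun a : ncseries k X => a [:: x]) (ncmulVr hu).
rewrite mul_coef1 //; last exact: ncinv_nil.
by rewrite nconeE => /eqP; rewrite addr_eq0 => /eqP.
Qed.

Lemma subst_coef1 (Y : finType) (s : Y -> ncseries k X) (u : ncseries k Y) x :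
  (forall y, vanish 1 (s y)) ->
  subst s u [:: x] = \sum_y u [:: y] * s y [:: x].
Proof.
move=> hs; move: u; apply: series_ind => [|l w a IH|a h].
- by rewrite linear0 big1 // => y _; rewrite mul0r.
- have -> : subst s (l *: nword w + a) = l *: subst s (nword w) + subst s a.
    exact: linearP.
  rewrite ncaddE ncscaleE IH subst_nword //.
  under [RHS]eq_bigr do rewrite mulrDl -mulrA.
  rewrite big_split -mulr_sumr; congr (_ * _ + _).
  case: w => [|y [|z w]].
  + by rewrite big_nil big1 // => y _ /=; rewrite mul0r.
  + rewrite big_seq1 (bigD1 y) //= eqxx mul1r big1 ?addr0 // => z zy.
    by case: eqP => [[e]|]; rewrite ?mul0r // e eqxx in zy *.
  rewrite [RHS]big1 => [|t _]; last first.
    by rewrite /= eqseq_cons andbF mul0r.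
  by have h := @vanish_prod _ _ _ _ hs [:: y, z & w]; apply: h.
have [c IH ac] := h 2%N.
have /agreeP -> // : vanish 2 (subst s a - subst s c).
  by rewrite -linearB; apply: subst_vanish.
rewrite IH; apply: eq_bigr => y _.
by have /agreeP/(_ [:: y]) -> := ac.
Qed.

Lemma cideal_coef1 (R : ncseries k X -> Prop) (l : X -> k) a :
  (forall r, R r -> r [::] = 0) ->
  (forall r, R r -> \sum_x l x * r [:: x] = 0) ->
  cideal R a -> \sum_x l x * a [:: x] = 0.
Proof.
move=> h0 h1 ha; have [c hc ac] := ha 2%N.
have -> : \sum_x l x * a [:: x] = \sum_x l x * c [:: x].
  by apply: eq_bigr => x _; have /agreeP/(_ [:: x]) -> := ac.
elim: hc => [|b r d e hr _ IH]; first by rewrite big1 // => x _; rewrite mulr0.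
under eq_bigr do rewrite ncaddE mulrDr.
rewrite big_split /= IH addr0.
have -> : \sum_x l x * (b * r * d) [:: x] =
    (b [::] * d [::]) * \sum_x l x * r [:: x]; last by rewrite h1 // mulr0.
rewrite mulr_sumr; apply: eq_bigr => x _.
rewrite !(ncmul_coef1, ncmul_coef0) (h0 _ hr) !(mulr0, mul0r) add0r addr0.
by rewrite -!mulrA [LHS]mulrCA; congr (_ * _); rewrite mulrA mulrC.
Qed.

End Coef1.

(** * The addition formula behind the coefficients [todd] *)

HB.instance Definition _ (k : comNzRingType) :=
  GRing.PzRing_hasCommutativeMul.Build (ncseries k unit) (@ser1_mulC k).

(* The computations below are done in an abstract commutative ring, where [ring]
   is much faster than in the ring of series. *)
Lemma exp_addition_ring (A : comNzRingType) (U V t eu ev : A) :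
  (1 + U * (t * eu)) * (1 + V * (t * ev)) =
    1 + t * (V * ev + U * eu + U * V * (t * eu * ev)).
Proof. by ring. Qed.

(** Here U, V, W are the scalars u, v, u + v; [eu] stands for (e^{ut} - 1)/(ut), [a] for its inverse
    and [Hu] for h(ut), and similarly for v and w. The last hypothesis is e^{(u+v)t} = e^{ut}
    e^{vt}. The factor U V W t^2 clears all denominators; it is cancelled later. *)
Lemma todd_addition_ring (A : comNzRingType)
    (U V W t a b c eu ev ew Hu Hv Hw D1 D2 D3 : A) :
  W = U + V ->
  W * (t * D1) = Hu - (- Hv - 1) -> - (U * (t * D2)) = Hv - Hw ->
  - (V * (t * D3)) = Hu - Hw ->
  a = 1 + U * (t * Hu) -> b = 1 + V * (t * Hv) -> c = 1 + W * (t * Hw) ->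
  a * eu = 1 -> b * ev = 1 -> c * ew = 1 ->
  W * ew = V * ev + U * eu + U * V * (t * eu * ev) ->
  U * (V * (W * (t * (t * (- D1 - D2 - D3 - Hu * Hw - Hw * Hv + Hu * Hv - Hw)))))
    = 0.
Proof.
move=> WE d1 d2 d3 hu hv hw iu iv iw e.
have key : W * a * b = c * (V * a + U * b + U * V * t).
  transitivity ((W * ew) * (a * b * c)); first by rewrite -[LHS]mulr1 -iw; ring.
  rewrite e; transitivity (c * (V * a * (b * ev) + U * b * (a * eu) +
    U * V * t * (a * eu) * (b * ev))); first by ring.
  by rewrite iu iv; ring.
transitivity (- (U * V * t) * (W * (t * D1)) + V * W * t * (- (U * (t * D2)))
   + U * W * t * (- (V * (t * D3)))
   + U * V * W * t * t * (- (Hu * Hw) - Hw * Hv + Hu * Hv - Hw)); first by ring.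
rewrite d1 d2 d3.
transitivity (W * a * b - c * (V * a + U * b + U * V * t)).
  by rewrite hu hv hw WE; ring.
by rewrite key subrr.
Qed.

Section ToddIdentity.
Let K : comNzRingType := ncseries rat unit.

Definition gser (f : nat -> rat) : ncseries rat unit := NCSeries (fun w => f (size w)).

Lemma gserE f n : gser f (nseq n tt) = f n.
Proof. by rewrite /= size_nseq. Qed.

Lemma eq_gser f g : f =1 g -> gser f = gser g.
Proof. by move=> /funext ->. Qed.

Lemma gserD f g : gser f + gser g = gser (fun n => f n + g n).
Proof. by apply: ncseriesP. Qed.
Lemma gserN f : - gser f = gser (fun n => - f n).
Proof. by apply: ncseriesP. Qed.
Lemma gserM f g : gser f * gser g = gser (fun n => \sum_(i < n.+1) f i * g (n - i)%N).
Proof.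
apply: ncseriesP => w; rewrite ncmulE; apply: eq_bigr => i _ /=.
by rewrite size_takel ?size_drop // -ltnS.
Qed.
Lemma gserZ (c : rat) f : c *: gser f = gser (fun n => c * f n).
Proof. by apply: ncseriesP. Qed.
Lemma gser1 : 1 = gser (fun n => (n == 0)%:R).
Proof. by apply: ncseriesP => w; rewrite nconeE /nilp. Qed.

Let t := gser (fun n => (n == 1)%:R).

Lemma gser_tM f : t * gser f = gser (fun n => if n is m.+1 then f m else 0).
Proof.
rewrite gserM; apply: eq_gser => -[|n]; first by rewrite big_ord1 mul0r.
rewrite !big_ord_recl mul0r add0r /= mul1r subSS subn0 big1 ?addr0 // => i _.
by rewrite mul0r.
Qed.

Lemma gser_t_inj f g : t * gser f = t * gser g -> gser f = gser g.
Proof.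
rewrite !gser_tM => h; apply: eq_gser => n.
by have := congr1 (fun a : ncseries rat unit => a (nseq n.+1 tt)) h; rewrite !gserE.
Qed.

Lemma gserP (a : ncseries rat unit) : exists f, a = gser f.
Proof.
exists (fun n => a (nseq n tt)); apply: ncseriesP => w /=; congr (a _).
by elim: w => [|[] w IH] //=; rewrite -IH.
Qed.

Lemma t_inj (a b : ncseries rat unit) : t * a = t * b -> a = b.
Proof. by have [f ->] := gserP a; have [g ->] := gserP b; apply: gser_t_inj. Qed.

(** In the variable t, with h(x) = 1/(e^x - 1) - 1/x: [hcoef] gives the coefficients of h, [gexp1 r]
    is (e^{rt} - 1)/(rt), [gtodd r] is rt/(e^{rt} - 1), [gh r] is h(rt), and [gdiff r s] is the
    divided difference (h(rt) - h(st))/((r - s)t). *)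
Definition hcoef n := todd n.+1.
Definition gexp (r : rat) := gser (fun n => r ^+ n / n`!%:R).
Definition gexp1 (r : rat) := gser (fun n => r ^+ n / n.+1`!%:R).
Definition gtodd (r : rat) := gser (fun n => r ^+ n * todd n).
Definition gh (r : rat) := gser (fun n => r ^+ n * hcoef n).
Definition gdiff (r s : rat) :=
  gser (fun n => hcoef n.+1 * \sum_(i < n.+1) r ^+ i * s ^+ (n - i)%N).

Lemma gexpD r s : gexp (r + s) = gexp r * gexp s.
Proof.
rewrite gserM; apply: eq_gser => n; rewrite addrC exprDn mulr_suml.
apply: eq_bigr => i _; rewrite -mulr_natr.
transitivity (s ^+ (n - i) * r ^+ i * (n`!%:R^-1 * 'C(n, i)%:R)); first by ring.
by rewrite inv_fact_bin -1?ltnS //; ring.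
Qed.

Lemma gexp0 : gexp 0 = 1.
Proof.
by rewrite gser1; apply: eq_gser => -[|n]; rewrite ?expr0 ?divr1 // expr0n mul0r.
Qed.

Lemma gexpE r : gexp r = 1 + r *: (t * gexp1 r).
Proof.
rewrite gser1 gser_tM gserZ gserD; apply: eq_gser => -[|n]; rewrite ?mulr0 ?addr0 ?divr1 //.
by rewrite add0r exprS mulrA.
Qed.

Lemma gtoddM r : gtodd r * gexp1 r = 1.
Proof.
rewrite gser1 gserM; apply: eq_gser => n.
transitivity (r ^+ n * (\sum_(j < n.+1) todd j / ((n.+1 - j)`!)%:R)).
  rewrite mulr_sumr; apply: eq_bigr => i _; have iN : (i <= n)%N by rewrite -ltnS.
  by rewrite subSn // -[in r ^+ n](subnKC iN) exprD; ring.
by rewrite toddP; case: n => [|n]; rewrite ?mulr1 ?mulr0.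
Qed.

Lemma gtoddE r : gtodd r = 1 + r *: (t * gh r).
Proof.
rewrite gser1 gser_tM gserZ gserD; apply: eq_gser => -[|n].
  by rewrite mulr0 addr0 expr0 mul1r; have := toddP 0; rewrite big_ord1 divr1.
by rewrite add0r exprS mulrA.
Qed.

Lemma gdiffE r s : (r - s) *: (t * gdiff r s) = gh r - gh s.
Proof.
rewrite gser_tM gserN gserZ gserD; apply: eq_gser => -[|n]; first by rewrite mulr0 subrr.
rewrite -mulrBl subrXX mulrCA mulrC; congr (_ * _ * _).
rewrite (reindex_inj rev_ord_inj); apply: eq_bigr => i _ /=.
have iN : (i <= n)%N by rewrite -ltnS.
by rewrite subSS subKn.
Qed.

Let sc (r : rat) : K := r%:A.
Let scE r (x : K) : r *: x = sc r * x. Proof. by rewrite mulr_algl. Qed.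
Let scM r s : sc (r * s) = sc r * sc s. Proof. by rewrite /sc mulr_algl scalerA. Qed.
Let scD r s : sc (r + s) = sc r + sc s. Proof. exact: scalerDl. Qed.
Opaque sc.

Lemma gexp1D u v : (u + v) *: gexp1 (u + v) =
  v *: gexp1 v + u *: gexp1 u + (u * v) *: (t * gexp1 u * gexp1 v).
Proof.
have := gexpD u v; rewrite !gexpE; have := t_inj.
move: (t) (gexp1 _) (gexp1 u) (gexp1 v) => s e eu ev inj E.
apply/inj/(@addrI _ 1); rewrite -scalerAr E !scE scM.
exact: exp_addition_ring.
Qed.

(** From -x/(e^{-x} - 1) = e^x x/(e^x - 1) = x/(e^x - 1) + x. *)
Lemma gtoddN r : gtodd (- r) = gtodd r + r *: t.
Proof.
have e : gexp1 (- r) * gexp r = gexp1 r.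
  have [->|r0] := eqVneq r 0; first by rewrite oppr0 gexp0 mulr1.
  apply: t_inj; apply: (scalerI r0); apply: (@addrI _ 1).
  rewrite -[RHS]gexpE; have h := gexpE (- r); have : gexp (- r) * gexp r = 1 by rewrite -gexpD addNr gexp0.
  rewrite h mulrDl mul1r scaleNr mulNr -scalerAl -mulrA => /eqP.
  by rewrite subr_eq => /eqP <-.
have : gtodd (- r) * (gexp1 (- r) * gexp r) * gtodd r = gtodd (- r).
  by rewrite e -mulrA [gexp1 r * _]mulrC gtoddM mulr1.
rewrite mulrA gtoddM mul1r => <-; rewrite gexpE mulrDl mul1r; congr (_ + _).
by rewrite -scalerAl -mulrA [gexp1 r * _]mulrC gtoddM mulr1.
Qed.

(** The coefficientwise form of h(-x) = -h(x) - 1. *)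
Lemma hcoefN n : (-1) ^+ n * hcoef n = - hcoef n - (n == 0)%:R.
Proof.
have := gtoddN 1; rewrite !gtoddE scaleNr !scale1r -addrA => /addrI.
rewrite -[X in _ = _ + X]mulr1 -mulrDr -mulrN gser1 gserN gserD => /gser_t_inj.
move=> /(congr1 (fun a : ncseries rat unit => a (nseq n tt))); rewrite !gserE.
by rewrite expr1n mul1r => e; rewrite -opprD -e opprK.
Qed.

(* The addition formula of 1 / (e^x - 1), written for its regular part
   h(x) = 1 / (e^x - 1) - 1 / x. *)
Lemma gh_addition u v : u != 0 -> v != 0 -> u + v != 0 ->
  - gdiff u (- v) - gdiff v (u + v) - gdiff u (u + v)
    - gh u * gh (u + v) - gh (u + v) * gh v + gh u * gh v - gh (u + v) = 0.
Proof.
move=> u0 v0 w0; set w := u + v.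
have HN : gh (- v) = - gh v - 1.
  have := gtoddN v; rewrite !gtoddE -addrA => /addrI.
  rewrite scaleNr -scalerDr -[X in _ + X]mulr1 -mulrDr -scalerN -mulrN.
  by move=> /(scalerI v0)/t_inj e; rewrite -opprD -e opprK.
have d1 := gdiffE u (- v); have d2 := gdiffE v w; have d3 := gdiffE u w.
have vw : v - w = - u by rewrite /w opprD addrCA subrr addr0.
have uw : u - w = - v by rewrite /w opprD addrA subrr add0r.
rewrite opprK -/w HN in d1; rewrite vw in d2; rewrite uw in d3.
have hu := gtoddE u; have hv := gtoddE v; have hw := gtoddE w.
have iu := gtoddM u; have iv := gtoddM v; have iw := gtoddM w.
have e := gexp1D u v; rewrite -/w in e.
move: d1 d2 d3 hu hv hw iu iv iw e.
set D1 := gdiff u _; set D2 := gdiff v _; set D3 := gdiff u w.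
move: D1 D2 D3 (gtodd u) (gtodd v) (gtodd w) (gexp1 u) (gexp1 v) (gexp1 w)
  (gh u) (gh v) (gh w) => D1 D2 D3 a b c eu ev ew Hu Hv Hw.
rewrite !scaleNr => d1 d2 d3 hu hv hw iu iv iw e.
set G := (X in X = 0).
suff : u *: (v *: (w *: (t * (t * G)))) = 0.
  move=> h; apply: t_inj; apply: t_inj; apply: (scalerI w0).
  by apply: (scalerI v0); apply: (scalerI u0); rewrite h !(mulr0, scaler0).
move: d1 d2 d3 hu hv hw e.
rewrite !scE scM => d1 d2 d3 hu hv hw e.
exact: (todd_addition_ring (scD u v) d1 d2 d3 hu hv hw iu iv iw e).
Qed.

(** The coefficient of t^n in [gh_addition] at u = X, v = 1. Read with X for ad x1, 1 for ad x2 and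
    X + 1 for ad(x1 + x2), it is also what the commutator of z_1 and z_2 + t_12 produces. *)
Definition todd_poly n : {poly rat} :=
  - (hcoef n.+1 *: \sum_(i < n.+1) 'X^i * ((-1) ^+ (n - i))%:P)
  - hcoef n.+1 *: \sum_(i < n.+1) ('X + 1) ^+ (n - i)
  - hcoef n.+1 *: \sum_(i < n.+1) 'X^i * ('X + 1) ^+ (n - i)
  + \sum_(i < n.+1) (hcoef i * hcoef (n - i)) *:
      (- 'X^i * ('X + 1) ^+ (n - i) - ('X + 1) ^+ i + 'X^i)
  - hcoef n *: ('X + 1) ^+ n.

Lemma poly_nat_roots (p : {poly rat}) : (forall m, p.[m.+1%:R] = 0) -> p = 0.
Proof.
move=> h; apply/eqP/negPn/negP => p0.
pose s := [seq m.+1%:R : rat | m <- iota 0 (size p)].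
have : (size s < size p)%N.
  apply: max_poly_roots => //.
    by apply/allP => _ /mapP[m _ ->]; apply/rootP.
  rewrite map_inj_uniq ?iota_uniq // => m n /eqP.
  by rewrite Num.Theory.eqr_nat => /eqP[].
by rewrite size_map size_iota ltnn.
Qed.

Lemma todd_poly_eq0 n : todd_poly n = 0.
Proof.
(* Positive integers are infinitely many roots for which u, 1 and u + 1 are nonzero, as
   [gh_addition] requires. *)
apply: poly_nat_roots => m; have [u um] : exists u : rat, u = m.+1%:R by eexists.
have u0 : u != 0 by rewrite um Num.Theory.pnatr_eq0.
have u1 : u + 1 != 0 by rewrite um natr1 Num.Theory.pnatr_eq0.
rewrite -um.
have X1 i : (('X + 1) ^+ i).[u] = (u + 1) ^+ i.
  by rewrite horner_exp hornerD hornerX -[1]/(1%:P) hornerC.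
have X0 i : ('X^i).[u] = u ^+ i by rewrite hornerXn.
have M1 (i : 'I_n.+1) : (- 'X^i * ('X + 1) ^+ (n - i) - ('X + 1) ^+ i + 'X^i).[u] =
    - u ^+ i * (u + 1) ^+ (n - i) - (u + 1) ^+ i + u ^+ i.
  by rewrite hornerD hornerD hornerN hornerM hornerN !X1 !X0.
have := gh_addition u0 (oner_neq0 _) u1; rewrite /gh !gserM.
move=> /(congr1 (fun a : ncseries rat unit => a (nseq n tt))).
rewrite 6!ncaddE 6!ncoppE !gserE => E.
rewrite -[RHS]E /todd_poly 4!hornerD 4!hornerN 4!hornerZ 4!horner_sum X1.
have -> : \sum_(i < n.+1) ((hcoef i * hcoef (n - i)) *:
      (- 'X^i * ('X + 1) ^+ (n - i) - ('X + 1) ^+ i + 'X^i)).[u] =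
  - (\sum_(i < n.+1) u ^+ i * hcoef i * ((u + 1) ^+ (n - i) * hcoef (n - i)))
  - (\sum_(i < n.+1) (u + 1) ^+ i * hcoef i * (1 ^+ (n - i) * hcoef (n - i)))
  + \sum_(i < n.+1) u ^+ i * hcoef i * (1 ^+ (n - i) * hcoef (n - i)).
  rewrite -!sumrN -!big_split; apply: eq_bigr => i _ /=.
  by rewrite hornerZ M1 expr1n; ring.
rewrite !addrA [hcoef n * _]mulrC; congr (- (_ * _) - _ * _ - _ * _ - _ - _ + _ - _).
- by apply: eq_bigr => i _; rewrite hornerM X0 hornerC.
- by apply: eq_bigr => i _; rewrite X1 expr1n mul1r.
by apply: eq_bigr => i _; rewrite hornerM X0 X1.
Qed.

End ToddIdentity.

(** * The commutator of z_1 and z_2 + t_12 in t_{1,3} *)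

Section LieIter.
Variable A : pzRingType.
Implicit Types x y s t u v p q : A.

Lemma lie_self x : lie x x = 0. Proof. by rewrite /lie subrr. Qed.

Lemma lie_comm_swap x y p : lie x y = 0 -> lie x (lie y p) = lie y (lie x p).
Proof. by move=> h; rewrite lie_jacobi h lie0l add0r. Qed.

Lemma iterS_lie n x p : iter n (lie x) (lie x p) = lie x (iter n (lie x) p).
Proof. by rewrite -iterSr. Qed.

Lemma iter_lie0 n x : iter n (lie x) 0 = 0.
Proof. by elim: n => //= n ->; rewrite lie0r. Qed.
Lemma iter_lieD n x p q : iter n (lie x) (p + q) = iter n (lie x) p + iter n (lie x) q.
Proof. by elim: n => //= n ->; rewrite lieDr. Qed.
Lemma iter_lieN n x p : iter n (lie x) (- p) = - iter n (lie x) p.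
Proof. by elim: n => //= n ->; rewrite lieNr. Qed.

Lemma iter_lie_swap n x y p : lie y x = 0 ->
  lie y (iter n (lie x) p) = iter n (lie x) (lie y p).
Proof. by move=> h; elim: n => //= n IH; rewrite lie_comm_swap // IH. Qed.

Lemma iter_lie_kill n x y p : lie y x = 0 -> lie y p = 0 -> lie y (iter n (lie x) p) = 0.
Proof. by move=> yx yp; rewrite iter_lie_swap // yp iter_lie0. Qed.

Lemma iter_lie_shift n x u p : lie u x = 0 -> lie u p = 0 ->
  iter n (lie (x + u)) p = iter n (lie x) p.
Proof.
move=> ux up; elim: n => //= n ->.
by rewrite lieDl [lie u _]iter_lie_kill // addr0.
Qed.

Lemma lie_iterr n x p q : lie x p = 0 ->
  lie p (iter n (lie x) q) = iter n (lie x) (lie p q).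
Proof. by move=> xp; apply: iter_lie_swap; rewrite lieC xp oppr0. Qed.
Lemma lie_iterl n x p q : lie x q = 0 ->
  lie (iter n (lie x) p) q = iter n (lie x) (lie p q).
Proof. by move=> xq; rewrite lieC lie_iterr // -iter_lieN -lieC. Qed.

(** The derivation ad y replaces one ad x at a time by -ad s, and kills t at the end. *)
Lemma lie_iter_deriv n x y s t : lie y x = - s -> lie y t = 0 ->
  lie y (iter n (lie x) t) =
    - \sum_(i < n) iter i (lie x) (lie s (iter (n - i.+1) (lie x) t)).
Proof.
move=> yx yt; elim: n => [|n IH]; first by rewrite big_ord0 oppr0.
rewrite [iter n.+1 _ _]/= lie_jacobi yx IH big_ord_recl /= subSS subn0.
rewrite lieNl lieNr [RHS]opprD; congr (_ + - _).
rewrite {1}/lie mulr_sumr mulr_suml -sumrB.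
by apply: eq_bigr => i _; rewrite -[LHS]/(lie _ _) -iterS.
Qed.

Lemma lie_oppD_add y y' p q q' :
  lie (- y) (- p + q) + lie (p + q') (- y') = lie (y + y') p - lie y q + lie y' q'.
Proof.
rewrite lieNl [lie _ (- y')]lieC lieNl opprK (lieDr (- p)) (lieDr p) lieNr lieDl.
move: (lie y p) (lie y q) (lie y' p) (lie y' q') => a b c d.
by rewrite opprD opprK addrACA -!addrA; congr (_ + _); rewrite addrCA.
Qed.

End LieIter.

Section EllipticLie.
Variables (k : comAlgType rat) (X : finType) (R : ncseries k X -> Prop).
Let A := quo R.
Implicit Types p q : A.

Lemma lieZl (l : k) p q : lie (l *: p) q = l *: lie p q.
Proof. by rewrite /lie -qscaleAl -qscaleAr scalerBr. Qed.
Lemma lieZr (l : k) p q : lie p (l *: q) = l *: lie p q.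
Proof. by rewrite /lie -qscaleAl -qscaleAr scalerBr. Qed.
Lemma iter_lieZ n (l : k) (x : A) p : iter n (lie x) (l *: p) = l *: iter n (lie x) p.
Proof. by elim: n => //= n ->; rewrite lieZr. Qed.

Definition ratsc (r : rat) p : A := (r%:A : k) *: p.

Lemma ratscM r s p : ratsc (r * s) p = ratsc r (ratsc s p).
Proof. by rewrite /ratsc ratkM scalerA. Qed.
Lemma ratscDl r s p : ratsc (r + s) p = ratsc r p + ratsc s p.
Proof. by rewrite /ratsc ratkD scalerDl. Qed.
Lemma ratscDr r p q : ratsc r (p + q) = ratsc r p + ratsc r q.
Proof. exact: scalerDr. Qed.
Lemma ratscNl r p : ratsc (- r) p = - ratsc r p.
Proof. by rewrite /ratsc ratkN scaleNr. Qed.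
Lemma ratscNr r p : ratsc r (- p) = - ratsc r p.
Proof. exact: scalerN. Qed.
Lemma ratsc1 p : ratsc 1 p = p.
Proof. by rewrite /ratsc scale1r scale1r. Qed.
Lemma ratsc0l p : ratsc 0 p = 0.
Proof. by rewrite /ratsc scale0r scale0r. Qed.
Lemma ratsc0r r : ratsc r 0 = 0.
Proof. exact: scaler0. Qed.
Lemma ratsc_sum r I (s : seq I) (P : pred I) (F : I -> A) :
  ratsc r (\sum_(i <- s | P i) F i) = \sum_(i <- s | P i) ratsc r (F i).
Proof. exact: scaler_sumr. Qed.
Lemma lie_ratscl r p q : lie (ratsc r p) q = ratsc r (lie p q).
Proof. exact: lieZl. Qed.
Lemma lie_ratscr r p q : lie p (ratsc r q) = ratsc r (lie p q).
Proof. exact: lieZr. Qed.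
Lemma iter_lie_ratsc n r (x : A) p : iter n (lie x) (ratsc r p) = ratsc r (iter n (lie x) p).
Proof. exact: iter_lieZ. Qed.

Section Homogenize.
Variables (x1 x2 tau : A).
Hypothesis x12 : lie x1 x2 = 0.

(* The homogeneous polynomial of degree [n] in ad x1 and ad x2 obtained from [q]
   by homogenization, applied to [tau]. *)
Definition homog n (q : {poly rat}) : A :=
  \sum_(i < n.+1) ratsc q`_i (iter i (lie x1) (iter (n - i) (lie x2) tau)).

Lemma homogD n (p q : {poly rat}) : homog n (p + q) = homog n p + homog n q.
Proof. by rewrite -big_split; apply: eq_bigr => i _; rewrite coefD ratscDl. Qed.
Lemma homogZ n r (q : {poly rat}) : homog n (r *: q) = ratsc r (homog n q).
Proof. by rewrite ratsc_sum; apply: eq_bigr => i _; rewrite coefZ ratscM. Qed.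
Lemma homogN n (q : {poly rat}) : homog n (- q) = - homog n q.
Proof. by rewrite -sumrN; apply: eq_bigr => i _; rewrite coefN ratscNl. Qed.
Lemma homog0 n : homog n 0 = 0.
Proof. by rewrite -[0](scale0r 0) homogZ ratsc0l. Qed.
Lemma homog_sum n I (s : seq I) (P : pred I) (F : I -> {poly rat}) :
  homog n (\sum_(i <- s | P i) F i) = \sum_(i <- s | P i) homog n (F i).
Proof.
by elim/big_rec2: _ => [|i y1 y2 _ <-]; rewrite ?homog0 ?homogD.
Qed.

Lemma lie_sum (x : A) n (F : 'I_n -> A) : lie x (\sum_i F i) = \sum_i lie x (F i).
Proof. by rewrite /lie mulr_sumr mulr_suml sumrB. Qed.

Lemma homogX n (q : {poly rat}) : homog n.+1 ('X * q) = lie x1 (homog n q).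
Proof.
rewrite /homog big_ord_recl coefXM /= ratsc0l add0r lie_sum.
by apply: eq_bigr => i _; rewrite coefXM /bump /= add1n subSS lie_ratscr.
Qed.

(** ad x2 is the variable set to 1, so applying it only raises the degree; the size bound ensures
    that no new coefficient of q enters. *)
Lemma homogS n (q : {poly rat}) : (size q <= n.+1)%N -> homog n.+1 q = lie x2 (homog n q).
Proof.
move=> sq; rewrite /homog big_ord_recr /= [q`_n.+1]nth_default // ratsc0l addr0 lie_sum.
apply: eq_bigr => i _; rewrite lie_ratscr iter_lie_swap; last by rewrite lieC x12 oppr0.
by rewrite subSn // -ltnS.
Qed.

Lemma size_X1n (a c : nat) : (size ('X^a * ('X + 1) ^+ c : {poly rat})%R <= (a + c).+1)%N.
Proof.
rewrite size_monicM ?monicXn //; last first.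
  by rewrite expf_neq0 // -[1]/(1%:P) -size_poly_eq0 size_XaddC.
have e : ('X + 1 : {poly rat}) = 'X - (- 1)%:P by rewrite polyCN opprK.
by rewrite size_polyXn e size_exp_XsubC addSn addnS.
Qed.

Lemma homog_mon a b c : homog (a + b + c) ('X^a * ('X + 1) ^+ c) =
  iter a (lie x1) (iter b (lie x2) (iter c (lie (x1 + x2)) tau)).
Proof.
elim: a => [|a IH]; last by rewrite exprS -mulrA !addSn homogX IH.
rewrite expr0 mul1r add0n /=; elim: b => [|b IH]; last first.
  rewrite addSn homogS ?IH //; have := size_X1n 0 c; rewrite mul1r add0n => /leq_trans->//.
  by rewrite ltnS leq_addl.
rewrite add0n /=; elim: c => [|c IH].
  by rewrite /homog big_ord1 expr0 coef1 ratsc1.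
rewrite exprS mulrDl mul1r homogD homogX homogS ?IH /= ?lieDl //.
by have := size_X1n 0 c; rewrite mul1r add0n.
Qed.

End Homogenize.

Section Commutator.
Variables x1 x2 x3 y1 y2 y3 : A.
Let t12 := lie x1 y2.
Let t13 := lie x1 y3.
Let t23 := lie x2 y3.
Hypotheses (xs : x1 + x2 + x3 = 0) (ys : y1 + y2 + y3 = 0).
Hypotheses (x12 : lie x1 x2 = 0) (y12 : lie y1 y2 = 0).
Hypotheses (s12 : lie x2 y1 = t12) (s13 : lie x3 y1 = t13) (s23 : lie x3 y2 = t23).
Hypotheses (fx12 : lie x3 t12 = 0) (fx13 : lie x2 t13 = 0) (fx23 : lie x1 t23 = 0).
Hypotheses (fy12 : lie y3 t12 = 0) (fy13 : lie y2 t13 = 0) (fy23 : lie y1 t23 = 0).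

Let w := x1 + x2.
Let tau := lie t12 t13.
Let X1 n p := iter n (lie x1) p.
Let X2 n p := iter n (lie x2) p.
Let W n p := iter n (lie w) p.

Let x21 : lie x2 x1 = 0. Proof. by rewrite lieC x12 oppr0. Qed.
Let wE : w = - x3. Proof. by apply/eqP; rewrite -subr_eq0 opprK xs. Qed.
Let wt12 : lie w t12 = 0. Proof. by rewrite wE lieNl fx12 oppr0. Qed.
Let x1w : lie x1 w = 0. Proof. by rewrite lieDr x12 lie_self addr0. Qed.
Let x2w : lie x2 w = 0. Proof. by rewrite lieDr x21 lie_self addr0. Qed.

(** t13 + t23 = [w, y3], and both w = -x3 and y3 commute with t12. *)
Lemma lie_t12_t23 : lie t12 t23 = - tau.
Proof.
apply/eqP; rewrite -addr_eq0 addrC -lieDr -lieDl -/w lie_jacobi.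
rewrite [lie t12 w]lieC wt12 oppr0 lie0l add0r.
by rewrite [lie t12 y3]lieC fy12 oppr0 lie0r eqxx.
Qed.

Lemma lie_t13_t23 : lie t13 t23 = tau.
Proof.
rewrite /tau [RHS]lieC; apply/eqP; rewrite -addr_eq0 addrC -lieDr -s23 -lieDl.
have -> : x1 + x3 = - x2 by apply/eqP; rewrite -subr_eq0 opprK addrAC xs.
rewrite lieNl lieNr lie_jacobi [lie t13 x2]lieC fx13 oppr0 lie0l add0r.
by rewrite [lie t13 y2]lieC fy13 oppr0 lie0r oppr0 eqxx.
Qed.

Lemma iter_lieNx n (x : A) p : iter n (lie (- x)) p = ratsc ((-1) ^+ n) (iter n (lie x) p).
Proof.
elim: n => [|n IH]; first by rewrite ratsc1.
by rewrite /= IH lieNl lie_ratscr exprS ratscM ratscNl ratsc1.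
Qed.

(** x1 + x2 commutes with t12, so ad x2 acts on it as -ad x1. *)
Lemma X2_t12 n : X2 n t12 = ratsc ((-1) ^+ n) (X1 n t12).
Proof.
rewrite -iter_lieNx /X2 -[x2](addKr x1) -/w iter_lie_shift //.
by rewrite lieNr lieC x1w !oppr0.
Qed.
Lemma X1_t12 n : X1 n t12 = iter n (lie (- x2)) t12.
Proof.
rewrite /X1 -[x1](addrK x2) -/w addrC iter_lie_shift //.
by rewrite lieNr lieC x2w !oppr0.
Qed.
Lemma X2_t23 n : X2 n t23 = W n t23.
Proof. by rewrite /W /w addrC iter_lie_shift. Qed.
Lemma X1_t13 n : X1 n t13 = W n t13.
Proof. by rewrite /W /w iter_lie_shift. Qed.

(** As x1 commutes with t23, ad x2 may be replaced by ad w on t23. Then x1 commutes with the right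
    factor and w with t12, so both operators come out of the bracket. The next two brackets are
    computed in the same way. *)
Lemma brk_12_23 a b : lie (X1 a t12) (X2 b t23) = - X1 a (W b tau).
Proof.
rewrite X2_t23 lie_iterl; last by apply: iter_lie_kill.
by rewrite lie_iterr // lie_t12_t23 !iter_lieN.
Qed.
Lemma brk_13_12 a b : lie (X1 a t13) (X2 b t12) = - X2 b (W a tau).
Proof.
rewrite X1_t13 lie_iterr; last by apply: iter_lie_kill.
by rewrite lie_iterl // [lie t13 _]lieC !iter_lieN.
Qed.
Lemma brk_13_23 a b : lie (X1 a t13) (X2 b t23) = X1 a (X2 b tau).
Proof.
rewrite lie_iterl; last by apply: iter_lie_kill.
by rewrite lie_iterr // lie_t13_t23.
Qed.

Lemma brk_y3 n : lie y3 (X1 n t12) =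
  \sum_(i < n) X1 i (iter (n - i.+1) (lie (- x2)) tau).
Proof.
rewrite (@lie_iter_deriv _ _ _ _ t13) // 1?lieC // -sumrN; apply: eq_bigr => i _.
rewrite -/(X1 _ t12) X1_t12 lie_iterr; last by rewrite lieNl fx13 oppr0.
by rewrite [lie t13 _]lieC !iter_lieN opprK.
Qed.
Lemma brk_y1 n : lie y1 (X2 n t23) = \sum_(i < n) X2 i (W (n - i.+1) tau).
Proof.
rewrite (@lie_iter_deriv _ _ _ _ t12) // ?[lie y1 x2]lieC ?s12 // -sumrN.
apply: eq_bigr => i _.
by rewrite -/(X2 _ t23) X2_t23 lie_iterr // lie_t12_t23 !iter_lieN opprK.
Qed.
Lemma brk_y2 n : lie y2 (X1 n t13) = - \sum_(i < n) X1 i (W (n - i.+1) tau).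
Proof.
rewrite (@lie_iter_deriv _ _ _ _ t12) // 1?lieC //; congr (- _).
by apply: eq_bigr => i _; rewrite -/(X1 _ t13) X1_t13 lie_iterr.
Qed.

Let ta i := ratsc (todd i) (X1 i (y2 + y3)).
Let tb j := ratsc (todd j) (X2 j (y1 + y3)).
(** The part of [z_1, z_2 + t_12] with d operators ad x in total, t_12 = [x_1, y_2] counting for
    one. *)
Definition comm_part d :=
  \sum_(i < d.+1) lie (ta i) (tb (d - i)) + (if d is e.+1 then lie (ta e) t12 else 0).

Lemma todd0 : todd 0 = 1.
Proof. by have := toddP 0; rewrite big_ord1 divr1. Qed.

Let ta0 : ta 0 = - y1.
Proof.
by rewrite /ta todd0 ratsc1; apply/eqP; rewrite -subr_eq0 opprK addrC addrA ys.
Qed.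
Let tb0 : tb 0 = - y2.
Proof.
by rewrite /tb todd0 ratsc1; apply/eqP; rewrite -subr_eq0 opprK addrAC ys.
Qed.
Let taS i : ta i.+1 = ratsc (hcoef i) (X1 i t12 + X1 i t13).
Proof. by rewrite /ta /X1 iterSr lieDr -/t12 -/t13 iter_lieD. Qed.
Let tbS i : tb i.+1 = ratsc (hcoef i) (X2 i t12 + X2 i t23).
Proof. by rewrite /tb /X2 iterSr lieDr s12 -/t23 iter_lieD. Qed.

Let y12t12 : lie y1 t12 = - lie y2 t12.
Proof.
apply/eqP; rewrite -addr_eq0 -lieDl.
have -> : y1 + y2 = - y3 by apply/eqP; rewrite -subr_eq0 opprK ys.
by rewrite lieNl fy12 oppr0.
Qed.

Lemma comm_part0 : comm_part 0 = 0.
Proof. by rewrite /comm_part big_ord1 ta0 tb0 lieNl lieNr y12 !oppr0 addr0. Qed.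

Lemma comm_part1 : comm_part 1 = 0.
Proof.
rewrite /comm_part !big_ord_recl big_ord0 addr0 -[lift _ _ : nat]/1%N.
rewrite -[(1 - ord0)%N]/1%N -[(1 - 1)%N]/0%N -[nat_of_ord ord0]/0%N ta0 tb0.
rewrite (taS 0) (tbS 0) -[X1 0 _]/t12 -[X1 0 _]/t13 -[X2 0 _]/t12 -[X2 0 _]/t23.
rewrite lie_ratscr lie_ratscl !lieNl lieNr [lie (t12 + t13) y2]lieC opprK.
rewrite (lieDr t12 t23 y1) (lieDr t12 t13 y2) fy13 fy23 !addr0 y12t12 !opprK.
(* This is [hcoef 0] = -1/2, read off from [hcoefN]. *)
have hh : hcoef 0 + hcoef 0 + 1 = 0.
  have := hcoefN 0; rewrite expr0 mul1r /= => e.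
  by rewrite {1}e addrAC subrK addNr.
by rewrite -[X in _ + X]ratsc1 -!ratscDl hh ratsc0l.
Qed.


Lemma lie_sum_antisym n (f : nat -> A) (c : nat -> rat) :
  \sum_(i < n.+1) ratsc (c i * c (n - i)%N) (lie (f i) (f (n - i)%N)) = 0.
Proof.
set Z := \sum_(i < _) _.
have ZN : Z = - Z.
  rewrite {1}/Z (reindex_inj rev_ord_inj) -sumrN; apply: eq_bigr => i _ /=.
  have iN : (i <= n)%N by rewrite -ltnS.
  by rewrite subSS subKn // mulrC lieC ratscNr.
have <- : ratsc (2^-1) (Z + Z) = Z.
  by rewrite ratscDr -ratscDl (_ : 2^-1 + 2^-1 = 1 :> rat) ?ratsc1.
by rewrite {2}ZN subrr ratsc0r.
Qed.

Let mid i j : lie (ta i.+1) (tb j.+1) = ratsc (hcoef i * hcoef j)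
  (lie (X1 i t12) (X2 j t12) +
    (- X1 i (W j tau) - X2 j (W i tau) + X1 i (X2 j tau))).
Proof.
rewrite taS tbS lie_ratscl lie_ratscr -ratscM lieDl !lieDr.
by rewrite brk_12_23 brk_13_12 brk_13_23 !addrA.
Qed.

(** In the two extreme terms one factor is -y1 or -y2, and the brackets with the y's are evaluated
    by [brk_y3], [brk_y1], [brk_y2]. The middle terms are brackets of iterated t's, evaluated by
    [mid]. All results are commuting operators on [tau]. *)
Lemma comm_partSS n : comm_part n.+2 = homog x1 x2 tau n (todd_poly n).
Proof.
have hN m : ratsc (hcoef m.+1) (X2 m.+1 t12) = - ratsc (hcoef m.+1) (X1 m.+1 t12).
  by rewrite X2_t12 -ratscM mulrC hcoefN subr0 ratscNl.
have E1 : lie (ta 0) (tb n.+2) + lie (ta n.+2) (tb 0) =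
    - ratsc (hcoef n.+1) (lie y3 (X1 n.+1 t12))
    - ratsc (hcoef n.+1) (lie y1 (X2 n.+1 t23))
    + ratsc (hcoef n.+1) (lie y2 (X1 n.+1 t13)).
  rewrite ta0 tb0 taS tbS (ratscDr _ (X1 n.+1 t12)) (ratscDr _ (X2 n.+1 t12)) hN.
  rewrite lie_oppD_add !lie_ratscr -ratscNr; congr (ratsc _ _ - _ + _).
  rewrite -lieNl; congr (lie _ _).
  by apply/eqP; rewrite -subr_eq0 opprK ys.
(* On t12 the operator ad x2 is -ad x1, so antisymmetry cancels everything but the degree 0
   correction of [hcoefN]. What remains cancels the t12 part of the bracket of [ta n.+1] with
   t12. *)
have S1 : \sum_(i < n.+1) ratsc (hcoef i * hcoef (n - i)) (lie (X1 i t12) (X2 (n - i) t12))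
    = - ratsc (hcoef n) (lie (X1 n t12) t12).
  transitivity (\sum_(i < n.+1) (- ratsc (hcoef i * hcoef (n - i))
      (lie (X1 i t12) (X1 (n - i) t12))
      - ratsc (hcoef i * (n - i == 0)%N%:R) (lie (X1 i t12) (X1 (n - i) t12)))).
    apply: eq_bigr => i _; rewrite X2_t12 lie_ratscr -ratscM -ratscNl -ratscNl -ratscDl.
    by congr (ratsc _ _); rewrite -mulrA [_ * (-1) ^+ _]mulrC hcoefN; ring.
  rewrite sumrB sumrN (lie_sum_antisym n (fun i => X1 i t12)) oppr0 add0r; congr (- _).
  rewrite big_ord_recr /= subnn eqxx mulr1 big1 ?add0r // => i _.
  by rewrite subn_eq0 leqNgt ltn_ord mulr0 ratsc0l.
have E2 : \sum_(i < n.+1) lie (ta i.+1) (tb (n - i).+1) + lie (ta n.+1) t12 =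
    \sum_(i < n.+1) ratsc (hcoef i * hcoef (n - i))
       (- X1 i (W (n - i) tau) - X2 (n - i) (W i tau) + X1 i (X2 (n - i) tau))
    - ratsc (hcoef n) (W n tau).
  under eq_bigr => i _ do rewrite mid (ratscDr _ (lie (X1 i t12) (X2 (n - i) t12))).
  rewrite big_split /= S1 taS lie_ratscl lieDl (ratscDr _ (lie (X1 n t12) t12)).
  have -> : lie (X1 n t13) t12 = - W n tau by exact: (brk_13_12 n 0).
  by rewrite addrACA addNr add0r ratscNr.
rewrite /comm_part big_ord_recl big_ord_recr.
transitivity ((lie (ta 0) (tb n.+2) + lie (ta n.+2) (tb 0)) +
    (\sum_(i < n.+1) lie (ta i.+1) (tb (n - i).+1) + lie (ta n.+1) t12)).
  rewrite -[X in _ = X]addrA -[X in X = _]addrA; congr (_ + _).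
  rewrite [RHS]addrCA [RHS]addrA; congr (_ + _ + _).
    apply: eq_bigr => i _; have iN : (i <= n)%N by rewrite -ltnS.
    by rewrite -(subSn iN).
  by rewrite /= subnn.
rewrite E1 E2 brk_y3 brk_y1 brk_y2 /todd_poly.
rewrite !(homogD, homogN, homogZ, homog_sum).
(* The dictionary from monomials to operators on [tau]: X is ad x1, 1 is ad x2, X + 1 is ad w. *)
have m1 i c : (i + c)%N = n -> homog x1 x2 tau n ('X^i * ('X + 1) ^+ c) = X1 i (W c tau).
  by move=> <-; have := @homog_mon x1 x2 tau x12 i 0 c; rewrite addn0.
have m2 b c : (b + c)%N = n -> homog x1 x2 tau n (('X + 1) ^+ c) = X2 b (W c tau).
  by move=> <-; have := @homog_mon x1 x2 tau x12 0 b c; rewrite expr0 mul1r.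
have m3 i b : (i + b)%N = n -> homog x1 x2 tau n 'X^i = X1 i (X2 b tau).
  by move=> <-; have := @homog_mon x1 x2 tau x12 i b 0; rewrite expr0 mulr1 addn0.
rewrite [LHS]addrA ratscNr (m2 0%N n) //.
have congr5 r (a a' b b' c c' d d' e : A) : a = a' -> b = b' -> c = c' -> d = d' ->
  - ratsc r a - ratsc r b - ratsc r c + d - e =
  - ratsc r a' - ratsc r b' - ratsc r c' + d' - e by move=> -> -> -> ->.
apply: congr5.
all: apply: eq_bigr => i _; have iN : (i + (n - i))%N = n by rewrite subnKC // -ltnS.
- rewrite subSS mulrC mul_polyC homogZ (m3 _ _ iN) iter_lieNx.
  by rewrite /X1 iter_lie_ratsc.
- by rewrite subSS (m2 _ _ iN).
- by rewrite subSS (m1 _ _ iN).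
rewrite homogZ !homogD !homogN mulNr homogN (m1 _ _ iN) (m3 _ _ iN).
by rewrite (m2 (n - i)%N i) // addnC.
Qed.


Lemma comm_part_eq0 d : comm_part d = 0.
Proof.
case: d => [|[|n]]; [exact: comm_part0|exact: comm_part1|].
by rewrite comm_partSS todd_poly_eq0 homog0.
Qed.

End Commutator.
End EllipticLie.

(** * Power series in ad x *)

Section AdSeries.
Variables (k : comAlgType rat) (X : finType).
Implicit Types (x y : ncseries k X) (f g : nat -> rat).

(* f(ad x)(y), for a power series f *)
Definition adser f x y := ncsum (fun n => (f n)%:A *: iter n (lie x) y).

Lemma iter_lie_scale n (l : k) x y : iter n (lie x) (l *: y) = l *: iter n (lie x) y.
Proof.
by elim: n => //= n ->; rewrite /lie -scalerAl -scalerAr -scalerBr.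
Qed.

Lemma iter_lie_sum n x I (r : seq I) (P : pred I) (F : I -> ncseries k X) :
  iter n (lie x) (\sum_(i <- r | P i) F i) = \sum_(i <- r | P i) iter n (lie x) (F i).
Proof. by elim/big_rec2: _ => [|i a b _ <-]; rewrite ?iter_lie0 ?iter_lieD. Qed.

Lemma lie_ncsum x (u : nat -> ncseries k X) : (forall n, vanish n (u n)) ->
  lie x (ncsum u) = ncsum (fun n => lie x (u n)).
Proof. by move=> hu; rewrite /lie ncsumMl // ncsumMr // ncsumB. Qed.

Lemma vanish_iter_lier m n x y : vanish m y -> vanish m (iter n (lie x) y).
Proof. by move=> hy; elim: n => //= n IH; apply: (@vanish_lie _ _ 0). Qed.

Lemma iter_lie_ncsum n x (u : nat -> ncseries k X) : (forall n, vanish n (u n)) ->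
  iter n (lie x) (ncsum u) = ncsum (fun m => iter n (lie x) (u m)).
Proof.
move=> hu; elim: n => //= n ->; rewrite lie_ncsum // => m.
exact: vanish_iter_lier.
Qed.

Lemma vanish_adser_term f x y : vanish 1 x ->
  forall n, vanish n ((f n)%:A *: iter n (lie x) y).
Proof. by move=> hx n; apply/vanishZ/vanish_iter_lie0. Qed.

Lemma adser_comp f g x y : vanish 1 x ->
  adser f x (adser g x y) = adser (fun n => \sum_(i < n.+1) f i * g (n - i)%N) x y.
Proof.
move=> hx; transitivity (ncsum (fun n => ncsum (fun m =>
  (f n)%:A *: iter n (lie x) ((g m)%:A *: iter m (lie x) y)))).
  apply: eq_ncsum => n; rewrite /adser iter_lie_ncsum ?ncsumZ //.
  exact: vanish_adser_term.
rewrite ncsum_double => [|n m]; last first.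
  by apply/vanishZ/vanish_iter_lie => //; apply: vanish_adser_term.
apply: eq_ncsum => n; rewrite scaler_suml scaler_suml; apply: eq_bigr => i _.
have iN : (i <= n)%N by rewrite -ltnS.
by rewrite iter_lie_scale scalerA -ratkM -iterD subnKC.
Qed.

Lemma exp_adE x y : exp_ad x y = adser (fun n => n`!%:R^-1) x y. Proof. by []. Qed.
Lemma dexp_adE x y : dexp_ad x y = adser (fun n => n.+1`!%:R^-1) x y. Proof. by []. Qed.
Lemma todd_adE x y : todd_ad x y = adser todd x y. Proof. by []. Qed.

Lemma eq_adser f g x y : f =1 g -> adser f x y = adser g x y.
Proof. by move=> /funext ->. Qed.

Lemma adserD f g x y : adser (fun n => f n + g n) x y = adser f x y + adser g x y.
Proof.
by rewrite /adser ncsumD; apply: eq_ncsum => n; rewrite ratkD scalerDl.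
Qed.

Lemma adserN f x y : adser f (- x) y = adser (fun n => (-1) ^+ n * f n) x y.
Proof.
apply: eq_ncsum => n; rewrite ratkM mulrC -scalerA; congr (_ *: _).
elim: n => [|n IH]; first by rewrite expr0 !scale1r.
by rewrite /= IH lieNl exprS mulN1r ratkN scaleNr /lie -scalerAl -scalerAr -scalerBr.
Qed.

Lemma adser_shift f x y : vanish 1 x ->
  adser f x (lie x y) = adser (fun n => if n is m.+1 then f m else 0) x y.
Proof.
move=> hx; rewrite [RHS]/adser ncsum_recl; last exact: vanish_adser_term.
by rewrite scale0r scale0r add0r; apply: eq_ncsum => n; rewrite iterSr.
Qed.

(** The power series identity e^x x/(e^x - 1) = x/(e^x - 1) + x, applied to ad x. *)
Lemma exp_ad_todd x y : vanish 1 x ->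
  exp_ad x (todd_ad x y) = todd_ad x y + lie x y.
Proof.
move=> hx; rewrite exp_adE todd_adE adser_comp //.
have -> : lie x y = adser (fun n => (n == 1)%:R) x y.
  rewrite /adser (@ncsum_single _ _ 1) /= ?scale1r ?scale1r // => [n /negPf ->|].
    by rewrite scale0r scale0r.
  exact: (vanish_lie hx (@vanish0 _ _ y)).
rewrite -adserD; apply: eq_adser => n.
have : gexp 1 * gtodd 1 = gtodd 1 + gser (fun n => (n == 1)%:R).
  rewrite gexpE scale1r mulrDl mul1r -mulrA [gexp1 1 * _]mulrC gtoddM mulr1.
  by [].
rewrite gserM gserD => /(congr1 (fun a : ncseries rat unit => a (nseq n tt))).
rewrite !gserE expr1n mul1r => <-.
by apply: eq_bigr => i _; rewrite !expr1n !mul1r.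
Qed.

(** The power series identity ((e^x - 1)/x) (-x/(e^{-x} - 1)) = e^x, applied to ad x. *)
Lemma dexp_ad_todd x y : vanish 1 x -> dexp_ad x (todd_ad (- x) y) = exp_ad x y.
Proof.
move=> hx; rewrite exp_adE dexp_adE todd_adE adserN adser_comp //.
apply: eq_adser => n.
have : gexp1 1 * gtodd (-1) = gexp 1.
  by rewrite gtoddN gexpE !scale1r mulrDr mulrC gtoddM mulrC.
rewrite gserM => /(congr1 (fun a : ncseries rat unit => a (nseq n tt))).
rewrite !gserE expr1n mul1r => <-.
by apply: eq_bigr => i _; rewrite !expr1n !mul1r.
Qed.

Lemma exp_ad_dexp x y : vanish 1 x -> exp_ad x y = y + dexp_ad x (lie x y).
Proof.
move=> hx; rewrite exp_adE /adser ncsum_recl; last exact: vanish_adser_term.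
rewrite invr1 scale1r scale1r /=; congr (_ + _).
by apply: eq_ncsum => n; rewrite -iterSr.
Qed.

End AdSeries.

Lemma lie_ncsum2 (k : comAlgType rat) (X : finType) (u v : nat -> ncseries k X) :
  (forall n, vanish n (u n)) -> (forall n, vanish n (v n)) ->
  lie (ncsum u) (ncsum v) = ncsum (fun n => \sum_(i < n.+1) lie (u i) (v (n - i)%N)).
Proof.
move=> hu hv; rewrite /lie !ncsumM // ncsumB; apply: eq_ncsum => n.
rewrite sumrB; congr (_ - _); rewrite (reindex_inj rev_ord_inj).
by apply: eq_bigr => i _ /=; rewrite subSS subKn // -ltnS.
Qed.

(** The bracket is regrouped by the number of ad operators, t counting for one; each group lies in
    the ideal, which is closed. *)
Lemma lie_todd_eq0 (k : comAlgType rat) (X : finType) (R : ncseries k X -> Prop)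
    (x1 x2 y1 y2 t : ncseries k X) :
  vanish 1 x1 -> vanish 1 x2 -> vanish 1 t ->
  (forall d, \sum_(i < d.+1)
      lie (ratsc (todd i) (iter i (lie (qpi R x1)) (qpi R y1)))
          (ratsc (todd (d - i)) (iter (d - i) (lie (qpi R x2)) (qpi R y2)))
    + (if d is e.+1 then lie (ratsc (todd e) (iter e (lie (qpi R x1)) (qpi R y1))) (qpi R t)
       else 0) = 0) ->
  qpi R (lie (todd_ad x1 y1) (todd_ad x2 y2 + t)) = 0.
Proof.
move=> hx1 hx2 ht h.
pose a m := (todd m)%:A *: iter m (lie x1) y1.
pose b m := (todd m)%:A *: iter m (lie x2) y2.
have ha m : vanish m (a m) by apply: todd_vanish.
have hb m : vanish m (b m) by apply: todd_vanish.
pose c m := if m is e.+1 then lie (a e) t else 0.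
have hc m : vanish m (c m).
  case: m => [|m]; first exact: vanish0.
  by have := vanish_lie (ha m) ht; rewrite addn1.
have -> : lie (todd_ad x1 y1) (todd_ad x2 y2 + t) =
    ncsum (fun m => \sum_(i < m.+1) lie (a i) (b (m - i)%N) + c m).
  rewrite lieDr -ncsumD; congr (_ + _); first exact: lie_ncsum2.
  by rewrite ncsum_recl // add0r /lie ncsumMr // ncsumMl // ncsumB.
apply/qpi_eq0/cideal_ncsum => m.
  apply: vanishD (hc m); apply: vanish_sum => q _.
  by have := vanish_lie (ha q) (hb (m - q)%N); rewrite subnKC // -ltnS.
apply/qpi_eq0; rewrite -[RHS](h m) qpiD linear_sum /=; congr (_ + _).
  by apply: eq_bigr => p _; rewrite qpi_lie !qpiZ !qpi_iter_lie.
by case: (m) => [|e]; rewrite // qpi_lie qpiZ qpi_iter_lie.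
Qed.

(** * The elements z_i of t_{1,3} and their relations *)

Section EllipticRelations.
Variables (k : comAlgType rat) (n : nat).
Local Notation pi := (@qpi k (egen n) erel).

Lemma qsum_xx e : \sum_i pi (xx e i) = 0.
Proof. by rewrite -linear_sum; apply/qpi_rel/erel_sum. Qed.
Lemma q_comm e i j : lie (pi (xx e i)) (pi (xx e j)) = 0.
Proof.
have [->|ij] := eqVneq i j; first exact: lie_self.
by rewrite -qpi_lie; apply/qpi_rel/erel_comm.
Qed.
Lemma q_te i j : pi (te i j) = lie (pi (xx true i)) (pi (xx false j)).
Proof. exact: qpi_lie. Qed.
Lemma q_te_sym i j : pi (te i j) = pi (te j i).
Proof.
have [->//|ij] := eqVneq i j.
by apply/eqP; rewrite -subr_eq0 -qpiB; apply/eqP/qpi_rel/erel_sym.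
Qed.
Lemma q_far e i j l : uniq [:: i; j; l] -> lie (pi (xx e l)) (pi (te i j)) = 0.
Proof. by move=> h; rewrite -qpi_lie; apply/qpi_rel/erel_far. Qed.

End EllipticRelations.

Lemma vanish_letter (k : comAlgType rat) (X : finType) (x : X) : vanish 1 (letter k x).
Proof. exact: vanish_nword [:: x]. Qed.

Lemma vanish_xx (k : comAlgType rat) n e (i : 'I_n) : vanish 1 (xx e i : ncseries k _).
Proof. exact: vanish_letter. Qed.

Lemma vanish_te (k : comAlgType rat) n (i j : 'I_n) : vanish 2 (te i j : ncseries k _).
Proof. exact: (vanish_lie (vanish_xx k true i) (vanish_xx k false j)). Qed.

Lemma big_ord3 (V : nmodType) (i j l : 'I_3) (F : 'I_3 -> V) : uniq [:: i; j; l] ->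
  \sum_a F a = F i + F j + F l.
Proof.
move=> u; have -> : \sum_a F a = \sum_(a <- [:: i; j; l]) F a.
  apply: perm_big; apply: uniq_perm; rewrite ?index_enum_uniq // => a.
  rewrite mem_index_enum; symmetry; apply/negPn/negP => h.
  have : uniq [:: a; i; j; l] by rewrite /= h.
  by move/card_uniqP => /= e; have := max_card (mem [:: a; i; j; l]); rewrite e card_ord.
by rewrite !big_cons big_nil addr0 addrA.
Qed.

Section T13.
Variable k : comAlgType rat.
Local Notation pi := (@qpi k (egen 3) erel).
Local Notation x i := (xx true i : ncseries k (egen 3)).
Local Notation y i := (xx false i : ncseries k (egen 3)).

(** The image of t_{0i} under the morphism from t_4. Modulo the relations the sum of the other y_j
    is -y_i. *)
Definition zz (i : 'I_3) : ncseries k (egen 3) :=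
  todd_ad (x i) (\sum_(j | j != i) y j).

Lemma big_neq3 (V : nmodType) (i j l : 'I_3) (F : 'I_3 -> V) : uniq [:: i; j; l] ->
  \sum_(a | a != i) F a = F j + F l.
Proof.
move=> u; rewrite big_mkcond (big_ord3 _ u) /= eqxx add0r.
by move: u; rewrite /= !inE !negb_or (eq_sym i j) (eq_sym i l) => /andP[/andP[-> ->]].
Qed.

Lemma zzE i j l : uniq [:: i; j; l] -> zz i = todd_ad (x i) (y j + y l).
Proof. by move=> u; rewrite /zz (big_neq3 _ u). Qed.

Lemma vanish_zz i : vanish 1 (zz i).
Proof.
apply: ncsum_vanish => n; apply/vanishZ/vanish_iter_lier/vanish_sum => j _.
exact: vanish_xx.
Qed.

Lemma lie_series_zz i : lie_series (zz i).
Proof.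
apply: lie_series_todd; first exact: lie_series_letter.
by apply: lie_series_sum => j _; apply: lie_series_letter.
Qed.

Lemma uniq3C (T : eqType) (a b c : T) : uniq [:: a; b; c] -> uniq [:: b; a; c].
Proof. by rewrite /= !inE !negb_or (eq_sym b a) => /andP[/andP[-> ->]]; case/andP => ->. Qed.
Lemma uniq3R (T : eqType) (a b c : T) : uniq [:: a; b; c] -> uniq [:: b; c; a].
Proof. by move=> u; rewrite -(rot_uniq 2). Qed.

(** The t_4 relation between t_{0i} and t_{0j} + t_{ij}; its components vanish by [comm_part_eq0],
    whose hypotheses are the relations of t_{1,3}. *)
Lemma zz_comm i j l : uniq [:: i; j; l] -> lie (pi (zz i)) (pi (zz j) + pi (te i j)) = 0.
Proof.
move=> u; rewrite -qpiD -qpi_lie (zzE u) (zzE (uniq3C u)).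
have swap p q : lie (pi (x p)) (pi (y q)) = lie (pi (x q)) (pi (y p)).
  by rewrite -!q_te q_te_sym.
have far e p q r : uniq [:: p; q; r] -> lie (pi (xx e r)) (lie (pi (x p)) (pi (y q))) = 0.
  by rewrite -q_te; apply: q_far.
have u1 := uniq3R u; have u2 := uniq3R u1; have u3 := uniq3C u2.
have h := @comm_part_eq0 _ _ _ (pi (x i)) (pi (x j)) (pi (x l))
  (pi (y i)) (pi (y j)) (pi (y l))
  (etrans (esym (big_ord3 (fun p => pi (x p)) u)) (qsum_xx _ _ true))
  (etrans (esym (big_ord3 (fun p => pi (y p)) u)) (qsum_xx _ _ false))
  (q_comm _ _ _ _) (q_comm _ _ _ _) (swap _ _) (swap _ _)
  (far true _ _ _ u) (far true _ _ _ u3) (far true _ _ _ u1)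
  (far false _ _ _ u) (far false _ _ _ u3) (far false _ _ _ u1).
apply: lie_todd_eq0; do ?exact: vanish_xx; first exact/(vanishW _ (vanish_te _ _ _)).
by move=> m; rewrite q_te !qpiD; apply: h.
Qed.

End T13.

Section QuotientExp.
Variables (k : comAlgType rat) (X : finType) (R : ncseries k X -> Prop).
Local Notation pi := (@qpi k X R).
Implicit Types (a b x y : ncseries k X).

Lemma qpiX a n : pi (a ^+ n) = pi a ^+ n.
Proof. exact: rmorphXn. Qed.

Lemma qpi_expD a b : vanish 1 a -> vanish 1 b -> pi a * pi b = pi b * pi a ->
  pi (ncexp (a + b)) = pi (ncexp a) * pi (ncexp b).
Proof.
move=> ha hb ab; rewrite -qpiM /ncexp ncsumM; do ?exact: vanish_exp_term.
apply: qpi_ncsum => [n|n|n]; first exact/vanish_exp_term/vanishD.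
  apply: vanish_sum => i _.
  have := vanishM (@vanish_exp_term _ _ _ ha i) (@vanish_exp_term _ _ _ hb (n - i)).
  by rewrite subnKC // -ltnS.
rewrite qpiZ qpiX qpiD linear_sum addrC exprDn_comm; last by rewrite /GRing.comm ab.
rewrite scaler_sumr; apply: eq_bigr => i _ /=.
rewrite qpiM !qpiZ !qpiX -qscaleAl -qscaleAr scalerA -scaler_nat scalerA.
have -> : pi b ^+ (n - i) * pi a ^+ i = pi a ^+ i * pi b ^+ (n - i).
  exact/commrX/commr_sym/commrX/esym.
by rewrite -ratk_nat -!ratkM inv_fact_bin -1?ltnS.
Qed.

Lemma vanish1_ev2 a b : vanish 1 a -> vanish 1 b ->
  forall c : bool, vanish 1 (if c then b else a).
Proof. by move=> ha hb []. Qed.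

Lemma todd_intertwine (g : quo R) x x' y y' :
  vanish 1 x -> vanish 1 x' -> vanish 1 y -> vanish 1 y' ->
  g * pi x = pi x' * g -> g * pi y = pi y' * g ->
  g * pi (todd_ad x y) = pi (todd_ad x' y') * g.
Proof.
move=> hx hx' hy hy' gx gy.
have e (u v : ncseries k X) : vanish 1 u -> vanish 1 v ->
    todd_ad u v = subst (fun c : bool => if c then v else u) (todd_ad serA serB).
  move=> hu hv; rewrite /serA /serB subst_todd ?subst_letter //; do ?by case.
rewrite (e x y) // (e x' y') //; by apply: subst_intertwine; case.
Qed.

Lemma lie_eq0P (a b : quo R) : lie a b = 0 <-> a * b = b * a.
Proof. by rewrite /lie; split=> [/eqP|->]; [rewrite subr_eq0 => /eqP|rewrite subrr]. Qed.

Lemma qpi_adser f x y y' : vanish 1 x -> pi y = pi y' -> pi (adser f x y) = pi (adser f x y').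
Proof.
move=> hx yy; apply: qpi_ncsum => [n|n|n]; do ?exact: vanish_adser_term.
by rewrite !qpiZ !qpi_iter_lie yy.
Qed.

Lemma todd_sum3_eq0 x1 x2 x3 y1 y2 y3 t :
  vanish 1 x1 -> vanish 1 x2 -> vanish 1 x3 -> vanish 1 t ->
  (forall m, ratsc (todd m) (iter m (lie (pi x1)) (pi y1) +
     iter m (lie (pi x2)) (pi y2) + iter m (lie (pi x3)) (pi y3)) +
     ratsc (m == 1)%N%:R (pi t) = 0) ->
  pi (todd_ad x1 y1) + pi (todd_ad x2 y2) + pi (todd_ad x3 y3) + pi t = 0.
Proof.
move=> h1 h2 h3 ht h; pose c m := ((m == 1)%N%:R : rat)%:A *: t.
have hc m : vanish m (c m).
  rewrite /c; case: (m =P 1%N) => [->|_]; first exact: vanishZ.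
  by rewrite scale0r scale0r; apply: vanish_zero.
have -> : t = ncsum c.
  rewrite (@ncsum_single _ _ 1) //; first by rewrite /c /= scale1r scale1r.
  by move=> m /negPf m1; rewrite /c m1 scale0r scale0r.
rewrite -!qpiD /todd_ad !ncsumD; apply/qpi_eq0/cideal_ncsum => m.
  by do 3?[apply: vanishD]; do ?exact: todd_vanish.
by apply/qpi_eq0; rewrite -[RHS](h m) !ratscDr !qpiD !qpiZ !qpi_iter_lie.
Qed.

Lemma exp_adD x a b : exp_ad x (a + b) = exp_ad x a + exp_ad x b.
Proof.
rewrite /exp_ad ncsumD; apply: eq_ncsum => n.
by rewrite iter_lieD scalerDr.
Qed.

Lemma adserNr f x y : adser f x (- y) = - adser f x y.
Proof. by rewrite /adser ncsumN; apply: eq_ncsum => n; rewrite iter_lieN scalerN. Qed.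

Lemma hcoef_pair (X1 X2 t : quo R) m :
  iter m (lie X2) t = iter m (lie (- X1)) t ->
  ratsc (hcoef m) (iter m (lie X1) t) + ratsc (hcoef m) (iter m (lie X2) t) =
    - ratsc (m == 0)%:R t.
Proof.
move=> ->; rewrite iter_lieNx -ratscM mulrC hcoefN -ratscDl addrA subrr sub0r.
by rewrite ratscNl; case: m => //= m; rewrite !ratsc0l.
Qed.

Lemma todd_sum3_coef (X1 X2 X3 Y1 Y2 Y3 t12 t13 t23 : quo R) m :
  Y1 + Y2 + Y3 = 0 ->
  lie X1 Y2 = t12 -> lie X1 Y3 = t13 -> lie X2 Y1 = t12 -> lie X2 Y3 = t23 ->
  lie X3 Y1 = t13 -> lie X3 Y2 = t23 ->
  (forall e, ratsc (hcoef e) (iter e (lie X1) t12) + ratsc (hcoef e) (iter e (lie X2) t12)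
     = - ratsc (e == 0)%:R t12) ->
  (forall e, ratsc (hcoef e) (iter e (lie X1) t13) + ratsc (hcoef e) (iter e (lie X3) t13)
     = - ratsc (e == 0)%:R t13) ->
  (forall e, ratsc (hcoef e) (iter e (lie X2) t23) + ratsc (hcoef e) (iter e (lie X3) t23)
     = - ratsc (e == 0)%:R t23) ->
  ratsc (todd m) (iter m (lie X1) (Y2 + Y3) + iter m (lie X2) (Y1 + Y3)
    + iter m (lie X3) (Y1 + Y2)) + ratsc (m == 1)%N%:R (t12 + t13 + t23) = 0.
Proof.
move=> ys e12 e13 e21 e23 e31 e32 h12 h13 h23.
case: m => [|m].
  rewrite ratsc0l addr0 /= todd0 ratsc1.
  transitivity ((Y1 + Y2 + Y3) + (Y1 + Y2 + Y3)); last by rewrite ys addr0.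
  by rewrite [LHS](AC (2*2*2) ((3*1*2)*(5*6*4))).
rewrite !iterSr (lieDr Y2) (lieDr Y1 Y3) (lieDr Y1 Y2) e12 e13 e21 e23 e31 e32.
have R6 r (a b c d e f : quo R) : ratsc r (a + b + (c + d) + (e + f)) =
    ratsc r a + ratsc r c + (ratsc r b + ratsc r e) + (ratsc r d + ratsc r f).
  by rewrite !ratscDr [LHS](AC (2*2*2) ((1*3)*(2*5)*(4*6))).
rewrite !iter_lieD -[todd m.+1]/(hcoef m) R6 h12 h13 h23.
by rewrite eqSS -!opprD -!ratscDr addNr.
Qed.

End QuotientExp.

Section T13Relations.
Variable k : comAlgType rat.
Local Notation pi := (@qpi k (egen 3) erel).
Local Notation x i := (xx true i : ncseries k (egen 3)).
Local Notation y i := (xx false i : ncseries k (egen 3)).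

Let hx e i : vanish 1 (xx e i : ncseries k (egen 3)). Proof. exact: vanish_xx. Qed.

Lemma q_xx3 e i j l : uniq [:: i; j; l] ->
  pi (xx e i) + pi (xx e j) + pi (xx e l) = 0.
Proof. by move=> u; rewrite -(big_ord3 (fun p => pi (xx e p)) u) qsum_xx. Qed.

Lemma q_xx3N e i j l : uniq [:: i; j; l] -> pi (xx e j + xx e l) = - pi (xx e i).
Proof.
move=> u; apply/eqP; rewrite -subr_eq0 opprK qpiD addrC addrA.
by apply/eqP/q_xx3.
Qed.

Lemma q_xx_te e i j l : uniq [:: i; j; l] ->
  lie (pi (xx e i)) (pi (te i j)) = - lie (pi (xx e j)) (pi (te i j)).
Proof.
move=> u; apply/eqP; rewrite -subr_eq0 opprK -lieDl; apply/eqP.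
have := q_xx3N e (uniq3R (uniq3R u)); rewrite qpiD => ->.
by rewrite lieNl q_far // oppr0.
Qed.

Lemma q_iter_te i j l n : uniq [:: i; j; l] ->
  iter n (lie (pi (x j))) (pi (te i j)) = iter n (lie (- pi (x i))) (pi (te i j)).
Proof.
move=> u; rewrite -[pi (x j)](addKr (pi (x i))); apply: iter_lie_shift.
  by rewrite lieNr lieDl !q_comm addr0 oppr0.
by rewrite lieDl (q_xx_te true u) addNr.
Qed.

(** z_i is a series in x_i and -y_i, and both x_i and y_i commute with t_{jl}. *)
Lemma zz_far i j l : uniq [:: i; j; l] -> lie (pi (zz k i)) (pi (te j l)) = 0.
Proof.
move=> u; have u1 := uniq3R u; rewrite lieC (zzE _ u).
have -> : pi (todd_ad (x i) (y j + y l)) = pi (todd_ad (x i) (- y i)).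
  by apply: qpi_todd => //; rewrite qpiN; apply: q_xx3N.
rewrite (_ : lie _ _ = 0) ?oppr0 //; apply/lie_eq0P.
have c e : pi (te j l) * pi (xx e i) = pi (xx e i) * pi (te j l).
  by apply/esym/lie_eq0P/q_far.
apply: todd_intertwine => //; do ?[exact: vanishN].
by rewrite qpiN mulrN mulNr c.
Qed.

Lemma zz_te_pair i j l m : uniq [:: i; j; l] ->
  ratsc (hcoef m) (iter m (lie (pi (x i))) (pi (te i j))) +
  ratsc (hcoef m) (iter m (lie (pi (x j))) (pi (te i j))) =
    - ratsc (m == 0)%:R (pi (te i j)).
Proof.
by move=> u; apply/hcoef_pair/q_iter_te/u.
Qed.

(** Each t_{ij} occurs in z_i and in z_j, where ad x_j = -ad x_i on it. By [hcoefN] the two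
    contributions cancel, except for -t_{ij} in the lowest order. *)
Lemma zz_sum i j l : uniq [:: i; j; l] ->
  pi (zz k i) + pi (zz k j) + pi (zz k l)
    + (pi (te i j) + pi (te i l) + pi (te j l)) = 0.
Proof.
move=> u; have u1 := uniq3R u; have u2 := uniq3R u1; have u3 := uniq3C u2.
have <- : pi (te i j + te i l + te j l) = pi (te i j) + pi (te i l) + pi (te j l).
  by rewrite qpiD qpiD.
rewrite (zzE _ u) (zzE _ (uniq3C u)) (zzE _ u2).
have ht p q : vanish 1 (te p q : ncseries k (egen 3)).
  exact: (@vanishW _ _ 1 2 _ isT (vanish_te _ _ _)).
apply: todd_sum3_eq0 => //; first exact: (vanishD (vanishD (ht _ _) (ht _ _)) (ht _ _)).
move=> m; rewrite (qpiD _ (_ + _)) (qpiD _ (te i j)).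
rewrite !(qpiD _ (y _) (y _)).
have L p q : lie (pi (x p)) (pi (y q)) = pi (te p q) by rewrite q_te.
have S p q : lie (pi (x p)) (pi (y q)) = pi (te q p) by rewrite L q_te_sym.
apply: todd_sum3_coef; do ?[exact: L | exact: S].
- exact: q_xx3 u.
- by move=> e; apply: zz_te_pair u.
- by move=> e; apply: zz_te_pair u3.
by move=> e; apply: zz_te_pair u1.
Qed.


End T13Relations.

Lemma lie_centralize2 (A : pzRingType) (t x1 x2 y : A) :
  lie x1 t = - lie x2 t -> lie y t = 0 -> lie t (lie x1 y + lie x2 y) = 0.
Proof.
move=> h hy; rewrite -lieDl lie_jacobi [lie t y]lieC hy oppr0 lie0r addr0.
by rewrite [lie t _]lieC lieDl h addNr oppr0 lie0l.
Qed.

Lemma lie_sum_complement (A : pzRingType) (z1 z2 z3 t12 t13 t23 : A) :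
  z1 + z2 + z3 + (t12 + t13 + t23) = 0 ->
  lie t12 (t13 + t23) = 0 -> lie z3 t12 = 0 -> lie t12 (z1 + z2) = 0.
Proof.
move=> hs ht hz; have -> : z1 + z2 = - (z3 + (t12 + (t13 + t23))).
  by apply/eqP; rewrite -subr_eq0 opprK !addrA; rewrite !addrA in hs; rewrite hs.
by rewrite lieNr !lieDr -lieDr ht lie_self [lie t12 z3]lieC hz !addr0 !oppr0.
Qed.

(** * Conjugation by e^{x_i} and the morphism from t_4 to t_{1,3} *)

Section ConjGeneric.
Variables (k : comAlgType rat) (X : finType) (R : ncseries k X -> Prop).
Local Notation pi := (@qpi k X R).
Implicit Types (a b x y : ncseries k X).

Lemma exp_todd_conj x y : vanish 1 x ->
  pi (ncexp x) * pi (todd_ad x y) = (pi (todd_ad x y) + lie (pi x) (pi y)) * pi (ncexp x).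
Proof. by move=> hx; rewrite -qpiM ncexp_mul_ad // qpiM exp_ad_todd // qpiD qpi_lie. Qed.

Lemma lie_todd_commute x1 x2 y : vanish 1 x2 -> lie (pi x1) (pi x2) = 0 ->
  pi (lie x1 (todd_ad x2 y)) = pi (todd_ad x2 (lie x1 y)).
Proof.
move=> h2 h; have hv := todd_vanish y h2.
rewrite /todd_ad lie_ncsum //; apply: qpi_ncsum => [n|n|n].
- exact: (@vanish_lie _ _ 0 n x1).
- exact: todd_vanish.
by rewrite qpi_lie !qpiZ lieZr !qpi_iter_lie iter_lie_swap // qpi_lie.
Qed.

(* [t = ad x1 (y)], and [x2] acts on [t] as [- x1]. *)
Lemma exp_todd_shift x1 x2 y t : vanish 1 x1 -> vanish 1 x2 -> vanish 1 t ->
  lie (pi x1) (pi x2) = 0 ->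
  lie (pi x1) (pi y) = - pi t ->
  (forall n, iter n (lie (pi x2)) (pi t) = iter n (lie (- pi x1)) (pi t)) ->
  pi (ncexp x1) * (pi (todd_ad x2 y) + pi t) = pi (todd_ad x2 y) * pi (ncexp x1).
Proof.
move=> h1 h2 ht x12 ey et; rewrite -qpiD -qpiM ncexp_mul_ad // qpiM; congr (_ * _).
rewrite exp_adD qpiD exp_ad_dexp // qpiD.
(* [x1, z] is minus the series [todd] in ad x2 = -ad x1 applied to t, and [dexp_ad_todd] turns this
   into the exponential. *)
have -> : pi (dexp_ad x1 (lie x1 (todd_ad x2 y))) = - pi (exp_ad x1 t).
  rewrite -dexp_ad_todd // -qpiN !dexp_adE -adserNr; apply: qpi_adser => //.
  rewrite lie_todd_commute // !todd_adE -adserNr.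
  apply: qpi_ncsum => [n|n|n]; [exact: todd_vanish|exact/todd_vanish/vanishN|].
  by rewrite !qpiZ !qpi_iter_lie qpi_lie ey !qpiN !iter_lieN et.
by rewrite subrK.
Qed.

Lemma qpi_expN a : vanish 1 a -> pi (ncexp a) * pi (ncexp (- a)) = 1.
Proof. by move=> ha; rewrite -qpiM ncexp_mulN. Qed.
Lemma qpi_Nexp a : vanish 1 a -> pi (ncexp (- a)) * pi (ncexp a) = 1.
Proof. by move=> ha; rewrite -qpiM ncexp_Nmul. Qed.

End ConjGeneric.

Section T13Conj.
Variable k : comAlgType rat.
Local Notation pi := (@qpi k (egen 3) erel).
Local Notation x i := (xx true i : ncseries k (egen 3)).
Local Notation y i := (xx false i : ncseries k (egen 3)).

Let hx e i : vanish 1 (xx e i : ncseries k (egen 3)). Proof. exact: vanish_xx. Qed.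

Lemma vanish1_te p q : vanish 1 (te p q : ncseries k (egen 3)).
Proof. exact: (@vanishW _ _ 1 2 _ isT (vanish_te _ _ _)). Qed.

Lemma conj_zz i j l : uniq [:: i; j; l] ->
  pi (ncexp (x i)) * pi (zz k i) =
    (pi (zz k i) + (pi (te i j) + pi (te i l))) * pi (ncexp (x i)).
Proof.
move=> u; rewrite (zzE _ u) exp_todd_conj //; congr ((_ + _) * _).
by rewrite (qpiD _ (y j)) lieDr !q_te.
Qed.

Lemma conj_zz_te i j l : uniq [:: i; j; l] ->
  pi (ncexp (x i)) * (pi (zz k j) + pi (te i j)) = pi (zz k j) * pi (ncexp (x i)).
Proof.
move=> u; rewrite (zzE _ (uniq3C u)); apply: exp_todd_shift => //.
- exact: vanish1_te.
- exact: q_comm.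
- rewrite q_te; have := q_xx3N k false (uniq3C u).
  by rewrite -lieNr => <-.
by move=> n; apply: q_iter_te u.
Qed.

Lemma conj_te i j l : uniq [:: i; j; l] ->
  pi (ncexp (x i)) * pi (te j l) = pi (te j l) * pi (ncexp (x i)).
Proof.
move=> u; apply/esym/exp_intertwine => //.
by apply/esym/lie_eq0P/q_far/uniq3R.
Qed.

Lemma exp_xx_prod i j l : uniq [:: i; j; l] ->
  pi (ncexp (x i)) * (pi (ncexp (x j)) * pi (ncexp (x l))) = 1.
Proof.
move=> u; have c p q : pi (x p) * pi (x q) = pi (x q) * pi (x p).
  by apply/lie_eq0P/q_comm.
have -> : pi (ncexp (x j)) * pi (ncexp (x l)) = pi (ncexp (- x i)).
  apply: (etrans (esym (qpi_expD (hx _ _) (hx _ _) (c j l)))).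
  apply: qpi_exp; [exact: vanishD|exact: vanishN|].
  by rewrite qpiN; apply: q_xx3N.
exact: qpi_expN.
Qed.

(** [ord0] is the extra strand of t_4; the other three are the strands of t_{1,3}. The value 0 at
    ([ord0], [ord0]) is a default. *)
Definition tt4 (p q : 'I_4) : ncseries k (egen 3) :=
  match unlift ord0 p, unlift ord0 q with
  | Some a, Some b => te a b
  | Some a, None => zz k a
  | None, Some b => zz k b
  | None, None => 0
  end.

Lemma vanish_tt4 p q : vanish 1 (tt4 p q).
Proof.
rewrite /tt4; case: unlift => [a|]; case: unlift => [b|]; do ?exact: vanish_zz.
  exact: vanish1_te.
exact: vanish_zero.
Qed.

Lemma ord3_third (a b : 'I_3) : a != b -> exists c, uniq [:: a; b; c].
Proof.
move=> ab; have : (0 < #|[pred c | (c != a) && (c != b)]|)%N.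
  have := cardC (mem [:: a; b]); rewrite card_ord (card_uniqP _) /= ?inE ?ab //.
  move=> /eqP; rewrite -[3%N]/(2 + 1)%N eqn_add2l => /eqP e.
  rewrite (eq_card (B := [predC [:: a; b]])) ?e // => c.
  by rewrite !inE negb_or.
case/card_gt0P => c; rewrite inE => /andP[ca cb]; exists c.
by rewrite /= !inE negb_or ab eq_sym ca eq_sym cb.
Qed.

Lemma tt4_sym p q : pi (tt4 p q) = pi (tt4 q p).
Proof.
rewrite /tt4; case: unlift => [a|]; case: unlift => [b|]; [|by []..].
exact: q_te_sym.
Qed.

Lemma te_tri a b c : uniq [:: a; b; c] ->
  lie (pi (te a b)) (pi (te a c) + pi (te b c)) = 0.
Proof.
move=> u; rewrite (q_te k a c) (q_te k b c).
apply: lie_centralize2; [exact: q_xx_te u|exact: q_far].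
Qed.

Lemma tt4_lift a b : tt4 (lift ord0 a) (lift ord0 b) = te a b.
Proof. by rewrite /tt4 !liftK. Qed.
Lemma tt4_0l b : tt4 ord0 (lift ord0 b) = zz k b.
Proof. by rewrite /tt4 unlift_none liftK. Qed.
Lemma tt4_0r a : tt4 (lift ord0 a) ord0 = zz k a.
Proof. by rewrite /tt4 unlift_none liftK. Qed.
Let tt4E := (tt4_lift, tt4_0l, tt4_0r).

Lemma ord4P (p : 'I_4) : p = ord0 \/ exists a : 'I_3, p = lift ord0 a.
Proof. by case: (unliftP ord0 p) => [a ->|->]; [right; exists a|left]. Qed.

(** By [zz_sum], z_a + z_b is minus the sum of z_c, t_{ab} and t_{ac} + t_{bc}, each of which
    commutes with t_{ab}. *)
Lemma te_zz a b c : uniq [:: a; b; c] ->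
  lie (pi (te a b)) (pi (zz k a) + pi (zz k b)) = 0.
Proof.
move=> u; apply: (lie_sum_complement (zz_sum k u) (te_tri u)).
exact: (zz_far k (uniq3R (uniq3R u))).
Qed.

Lemma tt4_tri p q r : uniq [:: p; q; r] ->
  lie (pi (tt4 p q)) (pi (tt4 p r) + pi (tt4 q r)) = 0.
Proof.
have Linj (a b : 'I_3) : (lift ord0 a == lift ord0 b :> 'I_4) = (a == b).
  by rewrite (inj_eq lift_inj).
have neq0 (a : 'I_3) : (lift ord0 a == ord0 :> 'I_4) = false by [].
have neq0' (a : 'I_3) : (ord0 == lift ord0 a :> 'I_4) = false by [].
case: (ord4P p) => [->|[a ->]]; case: (ord4P q) => [->|[b ->]];
  case: (ord4P r) => [->|[c ->]]; rewrite !cons_uniq !in_cons !in_nil ?orbF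
  ?eqxx ?neq0 ?neq0' ?orbT ?andbF ?Linj ?tt4E //.
- rewrite /= ?orbF ?andbT => bc; have [d u] := ord3_third bc.
  exact: (zz_comm k u).
- rewrite /= ?orbF ?andbT => ac; have [d u] := ord3_third ac.
  by rewrite addrC; apply: (zz_comm k u).
- rewrite /= ?orbF ?andbT => ab; have [d u] := ord3_third ab.
  exact: te_zz u.
by move=> u; apply: te_tri; rewrite !cons_uniq !in_cons !in_nil !orbF.
Qed.

Lemma te_far4 (a b c d : 'I_3) : uniq [:: a; b; c; d] -> False.
Proof.
move=> u; have := max_card (mem [:: a; b; c; d]).
by rewrite (card_uniqP u) card_ord.
Qed.

Lemma tt4_far p q r s : uniq [:: p; q; r; s] ->
  lie (pi (tt4 p q)) (pi (tt4 r s)) = 0.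
Proof.
have Linj (a b : 'I_3) : (lift ord0 a == lift ord0 b :> 'I_4) = (a == b).
  by rewrite (inj_eq lift_inj).
have neq0 (a : 'I_3) : (lift ord0 a == ord0 :> 'I_4) = false by [].
have neq0' (a : 'I_3) : (ord0 == lift ord0 a :> 'I_4) = false by [].
have far a b c : uniq [:: a; b; c] -> lie (pi (te b c)) (pi (zz k a)) = 0.
  by move=> u; rewrite lieC (zz_far k u) oppr0.
case: (ord4P p) => [->|[a ->]]; case: (ord4P q) => [->|[b ->]];
  case: (ord4P r) => [->|[c ->]]; case: (ord4P s) => [->|[d ->]];
  rewrite !cons_uniq !in_cons !in_nil ?orbF
  ?eqxx ?neq0 ?neq0' ?orbT ?andbF ?Linj ?tt4E //= ?orbF => u.
- by apply: (zz_far k); rewrite !cons_uniq !in_cons !in_nil !orbF.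
- by apply: (zz_far k); rewrite !cons_uniq !in_cons !in_nil !orbF.
- by apply: far; apply/uniq3R/uniq3R; rewrite !cons_uniq !in_cons !in_nil !orbF.
- by apply: far; apply/uniq3R/uniq3R; rewrite !cons_uniq !in_cons !in_nil !orbF.
by case: (@te_far4 a b c d); rewrite !cons_uniq !in_cons !in_nil !orbF.
Qed.

End T13Conj.

(** * Strand insertions followed by a substitution of the t_{ij} *)

Lemma big_block (V : nmodType) p (I : seq (seq nat)) i (F : 'I_p.+1 -> V) :
  uniq (nth [::] I i) -> all (fun c => (0 < c <= p.+1)%N) (nth [::] I i) ->
  \sum_(a | block I i a) F a = \sum_(c <- nth [::] I i) F (ix p c).
Proof.
rewrite /block; move: (nth [::] I i) => s us /allP hs.
have hin c : c \in s -> (ix p c).+1 = c.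
  by move=> /hs /andP[c0 cp]; rewrite inordK -1?ltnS prednK.
rewrite -(big_map (ix p) xpredT F) -[LHS]big_filter; apply: perm_big.
apply: uniq_perm; rewrite ?filter_uniq ?index_enum_uniq //.
  rewrite map_inj_in_uniq // => c d cs ds e.
  by rewrite -(hin c) // -(hin d) // e.
move=> a; rewrite mem_filter mem_index_enum andbT.
apply/idP/mapP => [h|[c cs ->]]; last by rewrite hin.
by exists a.+1 => //; rewrite /ix inord_val.
Qed.

Lemma flatten_disjoint (I : seq (seq nat)) i j c : uniq (flatten I) -> i != j ->
  c \in nth [::] I i -> c \in nth [::] I j -> False.
Proof.
elim: I i j => [|s I IH] [|i] [|j] //=; rewrite ?nth_nil // cat_uniq.
- case/and3P => _ /hasPn h _ _ cs cj; have /h : c \in flatten I.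
    by apply/flattenP; exists (nth [::] I j) => //; apply: mem_nth; case: ltnP cj => // /(nth_default [::]) ->.
  by rewrite /= cs.
- case/and3P => _ /hasPn h _ _ cj cs; have /h : c \in flatten I.
    by apply/flattenP; exists (nth [::] I i) => //; apply: mem_nth; case: ltnP cj => // /(nth_default [::]) ->.
  by rewrite /= cs.
by case/and3P => _ _ u; rewrite eqSS; apply: IH.
Qed.

Section BraidSubst.
Variables (k : comAlgType rat) (X : finType).
Implicit Types (Phi : f2 k).

Lemma vanish_tij n (i j : 'I_n) : vanish 1 (tij i j : ncseries k _).
Proof. by rewrite /tij; case: insub => [g|]; [apply: vanish_letter|apply: vanish_zero]. Qed.

Lemma subst_tij n (F : 'I_n -> 'I_n -> ncseries k X) (i j : 'I_n) :
  (forall p q, vanish 1 (F p q)) -> i != j ->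
  subst (fun g : tgen n => F (val g).1 (val g).2) (tij i j) = F i j.
Proof.
move=> hF ij; rewrite /tij (insubT (fun p : 'I_n * 'I_n => p.1 != p.2) (x := (i, j)) ij).
by rewrite subst_letter.
Qed.

Definition blocksum p (T : 'I_p.+1 -> 'I_p.+1 -> ncseries k X) (s s' : seq nat) :=
  \sum_(c <- s) \sum_(d <- s') T (ix p c) (ix p d).

Lemma vanish_blocksum p (T : 'I_p.+1 -> 'I_p.+1 -> ncseries k X) s s' :
  (forall i j, vanish 1 (T i j)) -> vanish 1 (blocksum T s s').
Proof. by move=> hT; do 2![apply: vanish_sum => ? _]. Qed.

Lemma subst_ev2 (Y : finType) (s : Y -> ncseries k X) Phi a b :
  (forall y, vanish 1 (s y)) -> vanish 1 a -> vanish 1 b ->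
  subst s (ev2 Phi a b) = ev2 Phi (subst s a) (subst s b).
Proof.
by move=> hs ha hb; rewrite /ev2 subst_comp //; [apply: eq_subst|]; case.
Qed.

Variables (p : nat) (T : 'I_p.+1 -> 'I_p.+1 -> ncseries k X).
Hypothesis hT : forall i j, vanish 1 (T i j).
Let sT (g : tgen p.+1) := T (val g).1 (val g).2.

Lemma subst_tins n (I : seq (seq nat)) (u : ncseries k (tgen n)) :
  uniq (flatten I) -> (forall i, all (fun c => (0 < c <= p.+1)%N) (nth [::] I i)) ->
  subst sT (tins p.+1 I u) =
  subst (fun g : tgen n => blocksum T (nth [::] I (val g).1) (nth [::] I (val g).2)) u.
Proof.
move=> uI hI; have hs g : vanish 1 (sT g) by apply: hT.
rewrite /tins subst_comp // => [|g]; last first.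
  by do 2![apply: vanish_sum => ? _]; apply: vanish_tij.
apply: eq_subst => g; have uI' i : uniq (nth [::] I i).
  have [iI|iI] := ltnP i (size I); last by rewrite nth_default.
  elim: (I) i iI uI => //= s J IH [|i] /=; rewrite cat_uniq => iJ /and3P[us _ uJ] //.
  exact: IH.
rewrite linear_sum /blocksum -(big_block (fun a => \sum_(d <- _) T a (ix p d))) //=.
apply: eq_bigr => a ha; rewrite linear_sum -(big_block (fun b => T a b)) //=.
apply: eq_bigr => b hb; apply: subst_tij => //.
apply/negP => /eqP ab; apply: (flatten_disjoint uI (valP g) ha).
by move: hb; rewrite -ab.
Qed.

Lemma subst_Phi_t3_block (I : seq (seq nat)) Phi :
  uniq (flatten I) -> (forall i, all (fun c => (0 < c <= p.+1)%N) (nth [::] I i)) ->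
  subst sT (tins p.+1 I (Phi_t3 Phi)) =
  ev2 Phi (blocksum T (nth [::] I 0) (nth [::] I 1)) (blocksum T (nth [::] I 1) (nth [::] I 2)).
Proof.
move=> uI hI; rewrite subst_tins // /Phi_t3 subst_ev2; do ?exact: vanish_tij; last first.
  by move=> g; apply: vanish_blocksum.
have v1 : ix 2 1 = 0 :> nat by rewrite inordK.
have v2 : ix 2 2 = 1%N :> nat by rewrite inordK.
have v3 : ix 2 3 = 2%N :> nat by rewrite inordK.
congr (ev2 _ _ _).
  rewrite (subst_tij (F := fun i j : 'I_3 => blocksum T (nth [::] I i) (nth [::] I j))).
  - by rewrite v1 v2.
  - by move=> *; apply: vanish_blocksum.
  by rewrite -val_eqE /= v1 v2.
rewrite (subst_tij (F := fun i j : 'I_3 => blocksum T (nth [::] I i) (nth [::] I j))).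
- by rewrite v3 v2.
- by move=> *; apply: vanish_blocksum.
by rewrite -val_eqE /= v3 v2.
Qed.

End BraidSubst.

Lemma ix21 : ix 2 1 = @Ordinal 3 0 isT. Proof. by apply: val_inj; rewrite /= inordK. Qed.
Lemma ix22 : ix 2 2 = @Ordinal 3 1 isT. Proof. by apply: val_inj; rewrite /= inordK. Qed.
Lemma ix23 : ix 2 3 = @Ordinal 3 2 isT. Proof. by apply: val_inj; rewrite /= inordK. Qed.

Lemma subst_Phi_t3 (k : comAlgType rat) (X : finType) (T : 'I_3 -> 'I_3 -> ncseries k X) Phi :
  (forall i j, vanish 1 (T i j)) ->
  subst (fun g : tgen 3 => T (val g).1 (val g).2) (Phi_t3 Phi) =
  ev2 Phi (T (ix 2 1) (ix 2 2)) (T (ix 2 2) (ix 2 3)).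
Proof.
move=> hT; rewrite /Phi_t3 subst_ev2 //; do ?exact: vanish_tij.
by rewrite !subst_tij // ?ix21 ?ix22 ?ix23.
Qed.

Lemma ev2_nil (k : comAlgType rat) (X : finType) (Phi : f2 k) (a b : ncseries k X) :
  ev2 Phi a b [::] = Phi [::].
Proof. exact: subst_nil. Qed.

(** The universal property of t_n, with values in a quotient ring. *)
Lemma trel_subst (k : comAlgType rat) (X : finType) (R : ncseries k X -> Prop) n
    (T : 'I_n -> 'I_n -> ncseries k X) :
  (forall i j, vanish 1 (T i j)) ->
  (forall i j, qpi R (T i j) = qpi R (T j i)) ->
  (forall i j l, uniq [:: i; j; l] ->
     lie (qpi R (T i j)) (qpi R (T i l) + qpi R (T j l)) = 0) ->
  (forall i j l m, uniq [:: i; j; l; m] -> lie (qpi R (T i j)) (qpi R (T l m)) = 0) ->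
  forall r, trel r -> qpi R (subst (fun g : tgen n => T (val g).1 (val g).2) r) = 0.
Proof.
move=> hT hsym htri hfar r; have hs (g : tgen n) : vanish 1 (T (val g).1 (val g).2) by [].
case=> [i j ij|i j l u|i j l m u].
- by rewrite linearB /= !subst_tij // 1?eq_sym // qpiB (hsym i) subrr.
- have := u; rewrite !cons_uniq !in_cons !in_nil !negb_or !andbT.
  move=> /andP[/andP[ij il] jl].
  by rewrite subst_lie // qpi_lie [subst _ (_ + _)]linearD /= !subst_tij // qpiD htri.
have := u; rewrite !cons_uniq !in_cons !in_nil !negb_or !andbT.
move=> /andP[/and3P[ij _ _] /andP[_ lm]].
by rewrite subst_lie // !subst_tij // qpi_lie hfar.
Qed.

(** * The associator relations evaluated in a quotient ring *)

Section AssociatorLaws.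
Variables (k : comAlgType rat) (mu : k) (Phi : f2 k).
Hypothesis hM : is_M (MPt mu Phi).

Lemma is_lie_exp_Phi : is_lie_exp Phi. Proof. by case: hM. Qed.
Lemma Phi_nil : Phi [::] = 1. Proof. exact/is_lie_exp_nil/is_lie_exp_Phi. Qed.

Section InQuotient.
Variables (X : finType) (R : ncseries k X -> Prop).
Local Notation pi := (@qpi k X R).
Implicit Types a b c : ncseries k X.

(** With 0-based strands, i + j = 1, 3, 2 picks out the pairs 12, 23, 13. *)
Definition tri_family a b c (i j : 'I_3) : ncseries k X :=
  if (i + j)%N == 1%N then a else if (i + j)%N == 3%N then b else c.

Lemma vanish_tri_family a b c i j : vanish 1 a -> vanish 1 b -> vanish 1 c ->
  vanish 1 (tri_family a b c i j).
Proof. by rewrite /tri_family; do 2?case: ifP. Qed.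

Lemma trel_tri_family a b c : vanish 1 a -> vanish 1 b -> vanish 1 c ->
  lie (pi a) (pi b + pi c) = 0 -> lie (pi b) (pi a + pi c) = 0 ->
  lie (pi c) (pi a + pi b) = 0 ->
  forall r, trel r -> pi (subst (fun g : tgen 3 => tri_family a b c (val g).1 (val g).2) r) = 0.
Proof.
move=> va vb vc ha hb hc; apply: trel_subst.
- by move=> i j; apply: vanish_tri_family.
- by move=> i j; rewrite /tri_family addnC.
- case=> [[|[|[|i]]] hi] // [[|[|[|j]]] hj] // [[|[|[|l]]] hl] //= _;
    rewrite /tri_family /= //; by rewrite addrC.
move=> i j l m u; have := max_card (mem [:: i; j; l; m]).
by rewrite (card_uniqP u) card_ord.
Qed.

Lemma all_block3 (I : seq (seq nat)) p : all (all (fun c : nat => (0 < c <= p)%N)) I ->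
  forall i, all (fun c : nat => (0 < c <= p)%N) (nth [::] I i).
Proof.
move=> /allP h i; have [iI|iI] := ltnP i (size I); last by rewrite nth_default.
exact/h/mem_nth.
Qed.

Lemma Phi_inverse a b : vanish 1 a -> vanish 1 b ->
  pi (ev2 Phi a b) * pi (ev2 Phi b a) = 1.
Proof.
(* A third element making the sum zero turns any a and b into a representation of t_3, so Phi(a, b)
   Phi(b, a) = 1 needs no hypothesis on brackets. *)
move=> va vb; pose c := - (a + b); have vc : vanish 1 c by apply/vanishN/vanishD.
have h : forall r, trel r ->
    pi (subst (fun g : tgen 3 => tri_family a b c (val g).1 (val g).2) r) = 0.
  apply: trel_tri_family => //; rewrite /c qpiN qpiD.
  - by rewrite opprD addrA addrC addKr lieNr lie_self oppr0.
  - by rewrite opprD addNKr lieNr lie_self oppr0.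
  by rewrite lieNl lie_self oppr0.
have [_ h2 _ _] := hM.
have vT i j : vanish 1 (tri_family a b c i j) by apply: vanish_tri_family.
have := cong_subst (fun g => vT _ _) h h2.
rewrite subst_Phi_t3_block //; last exact: all_block3.
rewrite /blocksum !big_seq1 (subst_inv (fun g => vT _ _)); last first.
  by rewrite -(subst_nil (fun g => tri_family a b c (val g).1 (val g).2)) subst_Phi_t3 //
    ev2_nil Phi_nil.
rewrite subst_Phi_t3 // ix21 ix22 ix23 /tri_family /= => ->.
by apply: qpi_mulrV; rewrite ev2_nil Phi_nil.
Qed.

Lemma Phi_hexagon a b c : vanish 1 a -> vanish 1 b -> vanish 1 c ->
  lie (pi a) (pi b + pi c) = 0 -> lie (pi b) (pi a + pi c) = 0 ->
  lie (pi c) (pi a + pi b) = 0 ->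
  pi (ncexp (Defs.half mu *: b)) * pi (ev2 Phi a b) * pi (ncexp (Defs.half mu *: a)) *
    pi (ev2 Phi c a) * pi (ncexp (Defs.half mu *: c)) * pi (ev2 Phi b c) =
  pi (ncexp (Defs.half mu *: (a + c + b))).
Proof.
move=> va vb vc ha hb hc; have h := trel_tri_family va vb vc ha hb hc.
have [_ _ h3 _] := hM.
have vT i j : vanish 1 (tri_family a b c i j) by apply: vanish_tri_family.
have vs (g : tgen 3) : vanish 1 (tri_family a b c (val g).1 (val g).2) by [].
have vt i j : vanish 1 (tij i j : ncseries k (tgen 3)) by apply: vanish_tij.
have := cong_subst vs h h3; rewrite !substM //.
rewrite !subst_Phi_t3_block //; do ?exact: all_block3.
rewrite !(subst_exp vs (vanishZ _ (vt _ _))).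
rewrite (subst_exp vs (vanishZ _ (vanishD (vanishD (vt _ _) (vt _ _)) (vt _ _)))).
rewrite /blocksum !big_seq1 ix21 ix22 ix23 !linearZ /= !linearD /= !subst_tij //.
by rewrite /tri_family /= !qpiM.
Qed.

Lemma Phi_pentagon (T : 'I_4 -> 'I_4 -> ncseries k X) :
  (forall i j, vanish 1 (T i j)) ->
  (forall i j, pi (T i j) = pi (T j i)) ->
  (forall i j l, uniq [:: i; j; l] -> lie (pi (T i j)) (pi (T i l) + pi (T j l)) = 0) ->
  (forall i j l m, uniq [:: i; j; l; m] -> lie (pi (T i j)) (pi (T l m)) = 0) ->
  let t i j := T (ix 3 i) (ix 3 j) in
  pi (ev2 Phi (t 2%N 3%N) (t 3%N 4%N)) *
    pi (ev2 Phi (t 1%N 2%N + t 1%N 3%N) (t 2%N 4%N + t 3%N 4%N)) * pi (ev2 Phi (t 1%N 2%N) (t 2%N 3%N)) =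
  pi (ev2 Phi (t 1%N 2%N) (t 2%N 3%N + t 2%N 4%N)) * pi (ev2 Phi (t 1%N 3%N + t 2%N 3%N) (t 3%N 4%N)).
Proof.
move=> hT hsym htri hfar t; have h := trel_subst hT hsym htri hfar.
have [_ _ _ h4] := hM.
have := cong_subst (fun g => hT _ _) h h4; rewrite !substM //.
rewrite !subst_Phi_t3_block //; do ?exact: all_block3.
by rewrite /blocksum /= !big_cons !big_nil !addr0 !qpiM.
Qed.

End InQuotient.
End AssociatorLaws.

Section FreeQuotient.
Variables (k : comAlgType rat) (X : finType).

(** Without relators, statements about the quotient become statements about series. *)
Definition no_rel (_ : ncseries k X) := False.

Lemma qpi_no_rel a b : qpi no_rel a = qpi no_rel b -> a = b.
Proof.
move=> /qpi_eq h; apply/eqP; rewrite -subr_eq0; apply/eqP.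
apply: series_eq => n; have [c hc] := h n; rewrite subr0.
suff -> : c = 0 by rewrite subr0.
by elim: hc => // ? ? ? ? [].
Qed.

End FreeQuotient.

Section PhiCentral.
Variables (k : comAlgType rat) (mu : k) (Phi : f2 k).
Hypothesis hM : is_M (MPt mu Phi).

(* The associator relations, mapped to the commutative algebra k[[t]]. *)
Lemma Phi_coef1 c : Phi [:: c] = 0.
Proof.
pose t : ncseries k unit := letter k tt.
have vt : vanish 1 t by apply: vanish_letter.
have v0 : vanish 1 (0 : ncseries k unit) by apply: vanish_zero.
have coef a b : vanish 1 a -> vanish 1 b -> ev2 Phi a b [:: tt] =
    Phi [:: true] * b [:: tt] + Phi [:: false] * a [:: tt].
  by move=> va vb; rewrite subst_coef1 ?big_bool //; case.
have t1 : t [:: tt] = 1 by [].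
have one a b : ev2 Phi a b [::] = 1 by rewrite ev2_nil (Phi_nil hM).
have AB : Phi [:: true] + Phi [:: false] = 0.
  have := Phi_inverse hM (@no_rel k unit) vt v0; rewrite -qpiM => /qpi_no_rel.
  move=> /(congr1 (fun a : ncseries k unit => a [:: tt])).
  rewrite mul_coef1 // !coef // t1 nczeroE nconeE !mulr0 !mulr1 add0r addr0.
  by rewrite addrC.
have A0 : Phi [:: false] = 0.
  (* Only t_12 is nonzero. With c the coefficient of A in Phi, the linear part of the pentagon reads
     c + c = c. *)
  pose T (i j : 'I_4) : ncseries k unit := if (i + j)%N == 1%N then t else 0.
  have vT i j : vanish 1 (T i j) by rewrite /T; case: ifP.
  have lie0 (a b : ncseries k unit) : lie (qpi (@no_rel k unit) a) (qpi (@no_rel k unit) b) = 0.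
    by rewrite -qpi_lie /lie ser1_mulC subrr.
  have := Phi_pentagon hM vT (R := @no_rel k unit).
  rewrite /= -!qpiM => h.
  have /qpi_no_rel : _ := h (fun i j => ltac:(by rewrite /T addnC))
    (fun i j l _ => ltac:(by rewrite -qpiD lie0)) (fun i j l m _ => lie0 _ _).
  have i1 : ix 3 1 = 0 :> nat by rewrite inordK.
  have i2 : ix 3 2 = 1%N :> nat by rewrite inordK.
  have i3 : ix 3 3 = 2%N :> nat by rewrite inordK.
  have i4 : ix 3 4 = 3%N :> nat by rewrite inordK.
  rewrite /T i1 i2 i3 i4 /= !addr0 => /(congr1 (fun a : ncseries k unit => a [:: tt])).
  rewrite !mul_coef1 ?mul_nil // !coef // t1 nczeroE !mulr0 !mulr1 !add0r !addr0.
  by move/eqP; rewrite -subr_eq0 addrK => /eqP.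
by case: c => //; move: AB; rewrite A0 addr0.
Qed.

(** Commuting shifts affect only linear terms, and Phi has none. *)
Lemma Phi_shift (X : finType) (R : ncseries k X -> Prop) (a b a' b' : ncseries k X)
    (d e : quo R) :
  vanish 1 a -> vanish 1 b -> vanish 1 a' -> vanish 1 b' ->
  qpi R a' = qpi R a + d -> qpi R b' = qpi R b + e ->
  lie d (qpi R a) = 0 -> lie d (qpi R b) = 0 -> lie e (qpi R a) = 0 ->
  lie e (qpi R b) = 0 -> lie d e = 0 ->
  qpi R (ev2 Phi a' b') = qpi R (ev2 Phi a b).
Proof.
move=> va vb va' vb' ea eb /lie_eq0P da /lie_eq0P db /lie_eq0P ea' /lie_eq0P eb' /lie_eq0P de.
apply: (@shift_lie_exp _ _ _ _ _ _ (fun c : bool => if c then e else d)).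
- by case.
- by case.
- by case.
- by case; case.
- by case; case.
- exact: is_lie_exp_Phi hM.
exact: Phi_coef1.
Qed.

End PhiCentral.

Lemma ev2_intertwine (k : comAlgType rat) (X : finType) (R : ncseries k X -> Prop)
    (f : f2 k) (g : quo R) (a b a' b' : ncseries k X) :
  vanish 1 a -> vanish 1 b -> vanish 1 a' -> vanish 1 b' ->
  g * qpi R a = qpi R a' * g -> g * qpi R b = qpi R b' * g ->
  g * qpi R (ev2 f a b) = qpi R (ev2 f a' b') * g.
Proof. by move=> va vb va' vb' ga gb; apply: subst_intertwine; case. Qed.

Lemma qpi_ev2 (k : comAlgType rat) (X : finType) (R : ncseries k X -> Prop)
    (f : f2 k) (a b a' b' : ncseries k X) :
  vanish 1 a -> vanish 1 b -> vanish 1 a' -> vanish 1 b' ->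
  qpi R a = qpi R a' -> qpi R b = qpi R b' ->
  qpi R (ev2 f a b) = qpi R (ev2 f a' b').
Proof. by move=> va vb va' vb' aa bb; apply: qpi_subst; case. Qed.

(** * Word identities in a ring with explicit inverses *)

Section RingWords.
Variable A : pzRingType.

(** Inverses are carried explicitly, as [quo R] has no unit ring structure. *)
Definition inverse_pair (u u' : A) := u * u' = 1 /\ u' * u = 1.

Lemma inverse_pair_sym u u' : inverse_pair u u' -> inverse_pair u' u.
Proof. by case. Qed.
Lemma inverse_pairM u u' v v' : inverse_pair u u' -> inverse_pair v v' ->
  inverse_pair (u * v) (v' * u').
Proof.
case=> u1 u2 [v1 v2]; split.
  by rewrite mulrA -(mulrA u) v1 mulr1.
by rewrite mulrA -(mulrA v') u2 mulr1.
Qed.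
Lemma cancelr u u' x : inverse_pair u u' -> x * u * u' = x.
Proof. by case=> h _; rewrite -mulrA h mulr1. Qed.
Lemma cancelrV u u' x : inverse_pair u u' -> x * u' * u = x.
Proof. by case=> _ h; rewrite -mulrA h mulr1. Qed.
Lemma cancell u u' (x : A) : inverse_pair u u' -> u * (u' * x) = x.
Proof. by case=> h _; rewrite mulrA h mul1r. Qed.
Lemma cancellV u u' (x : A) : inverse_pair u u' -> u' * (u * x) = x.
Proof. by case=> _ h; rewrite mulrA h mul1r. Qed.
(** A relation with an arbitrary tail can be rewritten inside right-associated words. *)
Lemma tailE (u v w t : A) : u * v = w * t -> forall z, u * (v * z) = w * (t * z).
Proof. by move=> h z; rewrite !mulrA h. Qed.
Lemma tail1 (u w : A) : u = w -> forall z, u * z = w * z.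
Proof. by move=> ->. Qed.
Lemma tail21 (u v w : A) : u * v = w -> forall z, u * (v * z) = w * z.
Proof. by move=> <- z; rewrite mulrA. Qed.
Lemma mulr_inverseI u u' x y : inverse_pair u u' -> u * x = u * y -> x = y.
Proof. by case=> _ h e; rewrite -[x]mul1r -[y]mul1r -h -!mulrA e. Qed.
Lemma mulIr_inverse u u' x y : inverse_pair u u' -> x * u = y * u -> x = y.
Proof. by case=> h _ e; rewrite -[x]mulr1 -[y]mulr1 -h !mulrA e. Qed.
Lemma comm_inverse u u' x : inverse_pair u u' -> u * x = x * u -> u' * x = x * u'.
Proof.
move=> h ux; apply: (mulr_inverseI h); rewrite mulrA (proj1 h) mul1r mulrA ux.
by rewrite (cancelr _ h).
Qed.

Section Twist.
Variables Ea Ea' Eb Eb' Ec Ec' Es f1 f1' f2 f2' f3 f3' : A.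
Hypotheses (ia : inverse_pair Ea Ea') (ib : inverse_pair Eb Eb') (ic : inverse_pair Ec Ec').
Hypotheses (i1 : inverse_pair f1 f1') (i2 : inverse_pair f2 f2') (i3 : inverse_pair f3 f3').
Hypothesis hex1 : Eb * f1 * Ea * f2 * Ec * f3 = Es.
Hypothesis hex2 : Ec * f2' * Ea * f1' * Eb * f3' = Es.
Hypotheses (sc : Es * Ec = Ec * Es) (s3 : Es * f3 = f3 * Es).

(** The first hexagon is solved for Eb f1 Ea and the second for f2' Ea f1'; the two pieces share f2.
    This trades the monodromy Ea^2 for the inverse of Ec^2 and the full twist Es^2. *)
Lemma twist : Eb * f1 * Ea * Ea * f1' = Es * Es * f3' * Ec' * Ec' * f3 * Eb'.
Proof.
have sc' : Ec' * Es = Es * Ec' by apply: comm_inverse ic _.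
have s3' : f3' * Es = Es * f3' by apply: comm_inverse i3 _.
have e1 : Eb * f1 * Ea = Es * f3' * Ec' * f2'.
  by rewrite -hex1 (cancelr _ i3) (cancelr _ ic) (cancelr _ i2).
have e2 : f2' * Ea * f1' = Ec' * Es * f3 * Eb'.
  rewrite -hex2 !mulrA (proj2 ic) mul1r (cancelrV _ i3) (cancelr _ ib) //.
rewrite e1 -[LHS]mulrA -[LHS]mulrA [f2' * _]mulrA e2 !mulrA.
by rewrite -(mulrA (Es * f3' * Ec')) sc' !mulrA -(mulrA (Es * f3')) sc' !mulrA
  -(mulrA Es) s3' !mulrA.
Qed.

End Twist.

(** The three product relations are pentagons. Two of them rewrite the pieces between consecutive
    X's, the X's carry the resulting letters across, and the word telescopes to X3 X2 X1; the third
    pentagon removes what is left. *)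
Lemma alpha_minus_words (g r v v' q q' p p' G1 G2 q2 q2' q3 q3' o m
    r23 r23' r31 r31' v21 v32 X1 X2 X3 : A) :
  inverse_pair v v' -> inverse_pair q q' -> inverse_pair p p' -> inverse_pair q2 q2' ->
  inverse_pair q3 q3' -> inverse_pair r23 r23' -> inverse_pair r31 r31' ->
  p * g * r = q * v -> o * G1 * r23 = q2 * v21 -> m * G2 * r31 = q3 * v32 ->
  X2 * v21 = r31 * X2 -> X3 * v32 = r * X3 -> X1 * v = r23 * X1 ->
  X3 * (X2 * X1) = 1 ->
  (g * X3 * q3' * m) * (G2 * X2 * q2' * o) * (G1 * X1 * q' * p) = 1.
Proof.
move=> iv iq ip iq2 iq3 ir23 ir31 hP M21 M32 c2 c3 c1 hX.
have e21 : q2' * o * G1 = v21 * r23'.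
  by apply: (mulIr_inverse ir23); rewrite (cancelrV _ ir23) -!mulrA (mulrA o) M21 mulrA (proj2 iq2) mul1r.
have e32 : q3' * m * G2 = v32 * r31'.
  by apply: (mulIr_inverse ir31); rewrite (cancelrV _ ir31) -!mulrA (mulrA m) M32 mulrA (proj2 iq3) mul1r.
have eX : r23' * X1 = X1 * v'.
  by apply: (mulr_inverseI ir23); rewrite mulrA (proj1 ir23) mul1r mulrA -c1 (cancelr _ iv).
have egr : g * r = p' * q * v.
  by apply: (mulr_inverseI ip); rewrite !mulrA hP (proj1 ip) mul1r.
transitivity (g * X3 * (q3' * m * G2) * X2 * (q2' * o * G1) * X1 * q' * p).
  by rewrite !mulrA.
rewrite e21 e32; transitivity (g * (X3 * v32) * r31' * (X2 * v21) * (r23' * X1) * q' * p).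
  by rewrite !mulrA.
rewrite c2 c3 eX; transitivity (g * r * (X3 * (r31' * r31) * X2 * X1) * v' * q' * p).
  by rewrite !mulrA.
rewrite (proj2 ir31) mulr1 -(mulrA X3) hX mulr1 egr.
by rewrite (cancelr _ iv) (cancelr _ iq) (proj2 ip).
Qed.

(** Two pentagons bring the squares A1^2 and A2^2 under a common conjugation, joined by a hexagon.
    The first twist turns A1^2 into an inverse of A2^2 times a full twist; the second twist, applied
    to A3^2, cancels the rest. *)
Lemma alpha_plus_words (g g' r r' v v' q q' p p' q2 q2' p2 p2' r2 r2' v2 v2' o
    q3 q3' A1 A2 A2' A3 E123 E231 E312 E12 E12' E13 Es012 Es S31 S12 S12' : A) :
  inverse_pair g g' -> inverse_pair r r' -> inverse_pair v v' -> inverse_pair q q' ->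
  inverse_pair q2 q2' -> inverse_pair p2 p2' -> inverse_pair r2 r2' ->
  inverse_pair v2 v2' -> inverse_pair A2 A2' ->
  inverse_pair E12 E12' -> inverse_pair S12 S12' ->
  p * g * r = q * v -> p2 * g * r2 = q2 * v2 ->
  o * E123 * p = E13 * p2 * E12 ->
  A1 * v = v * A1 -> A2 * v2 = v2 * A2 -> E13 * q2 = q2 * E13 -> E13 * A2 = A2 * E13 ->
  E12 * g = g * E12 ->
  E12 * r * A1 * A1 * r' = Es012 * Es012 * r2 * A2' * A2' * r2' * E12' ->
  Es012 * r2 = r2 * Es012 -> Es012 * A2 = A2 * Es012 ->
  E312 * q3 * A3 * A3 * q3' = E12' * E12' * g * S12' * S12' * g' * S31 ->
  E231 * E13 = Es -> Es * p2 = p2 * Es -> S31 * Es = E12 ->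
  Es012 = S12 * E12 -> S12 * E12 = E12 * S12 ->
  (E312 * q3 * (A3 * A3) * q3' * p2') * (E231 * q2 * (A2 * A2) * q2' * o)
    * (E123 * q * (A1 * A1) * q' * p) = 1.
Proof.
move=> ig ir iv iq iq2 ip2 ir2 iv2 iA2 iE12 iS12 P1 P2 H cA1 cA2 c13q c13A c12g tw
  cs2 csA tw3 eEs cEs eS eS012 cS12.
have e1 z : q * (A1 * (A1 * (q' * (p * z)))) =
    p * (g * (r * (A1 * (A1 * (r' * (g' * z)))))).
  have -> : q' * (p * z) = v * (r' * (g' * z)).
    apply: (mulr_inverseI iq); rewrite (cancell _ iq) (mulrA q v) -P1 -!mulrA.
    by rewrite (cancell _ ir) (cancell _ ig).
  by rewrite !(tailE cA1) (mulrA q v) -P1 -!mulrA.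
have e2 z : q2 * (A2 * (A2 * (q2' * (p2 * (g * z))))) =
    p2 * (g * (r2 * (A2 * (A2 * (r2' * z))))).
  have -> : q2' * (p2 * (g * z)) = v2 * (r2' * z).
    apply: (mulr_inverseI iq2); rewrite (cancell _ iq2) (mulrA q2 v2) -P2 -!mulrA.
    by rewrite (cancell _ ir2).
  by rewrite !(tailE cA2) (mulrA q2 v2) -P2 -!mulrA.
have c13q' : q2' * E13 = E13 * q2' by apply: comm_inverse iq2 _; rewrite c13q.
have cs2' : r2' * Es012 = Es012 * r2' by apply: comm_inverse ir2 _.
have hH z : o * (E123 * (p * z)) = E13 * (p2 * (E12 * z)).
  by have := tail1 H z; rewrite -!mulrA.
have htw z : E12 * (r * (A1 * (A1 * (r' * z)))) =
    Es012 * (Es012 * (r2 * (A2' * (A2' * (r2' * (E12' * z)))))).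
  by have := tail1 tw z; rewrite -!mulrA.
have htw3 z : E312 * (q3 * (A3 * (A3 * (q3' * z)))) =
    E12' * (E12' * (g * (S12' * (S12' * (g' * (S31 * z)))))).
  by have := tail1 tw3 z; rewrite -!mulrA.
rewrite -[LHS]mulr1; move: (1 : A) => z; rewrite -!mulrA.
rewrite htw3 e1 hH (tailE c13q') -!(tailE c13A) -(tailE c13q) (tail21 eEs) (tailE c12g) htw e2.
rewrite !(tailE cs2') -!(tailE csA) -!(tailE cs2) (cancellV _ ir2).
rewrite !(cancell _ iA2) (cancell _ ir2) (tailE cEs) (cancellV _ ip2) (tail21 eS).
rewrite (tailE c12g) (cancellV _ ig) eS012 -!mulrA -!(tailE cS12) !(cancellV _ iS12).
by rewrite (cancell _ iE12) -!(tailE c12g) !(cancellV _ iE12) (cancell _ ig).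
Qed.

Section Mirror.
Variables E12 E12' E13 E13' E23 E23' E123 E123' p p' p2 p2' o o' Es : A.
Hypotheses (i12 : inverse_pair E12 E12') (i13 : inverse_pair E13 E13')
  (i23 : inverse_pair E23 E23') (i123 : inverse_pair E123 E123')
  (ip : inverse_pair p p') (ip2 : inverse_pair p2 p2') (io : inverse_pair o o').
Hypotheses (es : E123 * E23 = Es) (es' : E23 * E123 = Es).
Hypotheses (c12 : Es * E12 = E12 * Es) (c13 : Es * E13 = E13 * Es)
  (cp : Es * p = p * Es) (cp2 : Es * p2 = p2 * Es) (co : Es * o = o * Es).
Hypothesis hex1 : E23 * p * E12 * p2' * E13 * o = Es.
Hypothesis hex2 : E12 * p' * E23 * o' * E13 * p2 = Es.

Let c23 : Es * E23 = E23 * Es.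
Proof. by rewrite -{1}es' -es mulrA. Qed.

(** The second hexagon, with E23 absorbed into the factor Es, which commutes with the letters. The
    next lemma is the version for inverse exponentials, from the first hexagon. *)
Lemma hexagon_pos : o * E123 * p = E13 * p2 * E12.
Proof.
have e2 : E13 * p2 = o * E23' * p * E12' * Es.
  rewrite -hex2 !mulrA.
  by rewrite (cancelrV _ i12) (cancelr _ ip) (cancelrV _ i23) (proj1 io) mul1r.
have e3 : E123 = E23' * Es by rewrite -es' mulrA (proj2 i23) mul1r.
rewrite e2 -(mulrA _ Es) c12 !mulrA (cancelrV _ i12) e3.
by rewrite -!mulrA cp.
Qed.

Lemma hexagon_neg : o * E123' * p = E13' * p2 * E12'.
Proof.
have iw := inverse_pairM i23 ip.
have cw : E23 * p * Es = Es * (E23 * p) by rewrite -mulrA -cp mulrA -c23 mulrA.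
have h3 : E12 * p2' * E13 * o * (E23 * p) = Es.
  apply: (mulr_inverseI iw); rewrite cw -hex1 !mulrA.
  by rewrite hex1.
have iE : inverse_pair (E23 * E123) (E123' * E23') by apply: inverse_pairM.
rewrite es' in iE; apply: (mulr_inverseI iE).
have -> : Es * (o * E123' * p) = o * E23 * p.
  by rewrite !mulrA co -es' -!mulrA; congr (_ * (_ * _)); rewrite mulrA (proj1 i123) mul1r.
have c12' : E12' * Es = Es * E12' by apply: comm_inverse i12 _; rewrite c12.
have c13' : E13' * Es = Es * E13' by apply: comm_inverse i13 _; rewrite c13.
rewrite !mulrA -c13' -(mulrA E13') cp2 -!mulrA -c12'.
rewrite -h3 !mulrA; rewrite -(mulrA E13') -!mulrA (cancellV _ i12) (cancell _ ip2) (cancellV _ i13).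
by [].
Qed.
End Mirror.

(** Both sides are brought to the word p' E123 G1 r23 A2'^2 X1 r' g'. On the left the twist turns
    the conjugated A2'^2 into B'^2, which X1 carries back to A2'^2 ([eW]); on the right a pentagon
    and the inverse hexagon move A2'^2 through the prefix ([hK]). *)
Lemma commutator_words (g g' r r' v v' q q' p p' p2 p2' q2 q2' r2 r2' v2 v2' o
    r23 v21 A1 A2 A2' B B' E12 E12' E13 E13' E123 E123' Es Es' G1 X1 U V : A) :
  inverse_pair g g' -> inverse_pair r r' -> inverse_pair v v' -> inverse_pair q q' ->
  inverse_pair p p' -> inverse_pair p2 p2' -> inverse_pair q2 q2' ->
  inverse_pair r2 r2' -> inverse_pair v2 v2' -> inverse_pair A2 A2' ->
  inverse_pair B B' -> inverse_pair E12 E12' -> inverse_pair E13 E13' ->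
  inverse_pair E123 E123' -> inverse_pair Es Es' ->
  p * g * r = q * v -> p2 * g * r2 = q2 * v2 -> o * G1 * r23 = q2 * v21 ->
  o * E123' * p = E13' * p2 * E12' ->
  A2 * v2 = v2 * A2 -> E12 * g = g * E12 ->
  E12 * r * A1 * A1 * r' = Es * Es * r2 * A2' * A2' * r2' * E12' ->
  Es = B * A1 -> B * A1 = A1 * B -> Es * r = r * Es -> Es * r2 = r2 * Es ->
  Es * E12 = E12 * Es -> Es * A2 = A2 * Es ->
  X1 * v = r23 * X1 -> X1 * B = A2 * X1 ->
  E13 * q2 = q2 * E13 -> E13 * A2 = A2 * E13 -> A2 * v21 = v21 * A2 ->
  U = p' * E123 * G1 * X1 * q' * p ->
  V = E12' * p2' * q2 * A2' * A2' * q2' * p2 * E12' ->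
  U * V = E12 * E12 * V * U.
Proof.
move=> ig ir iv iq ip ip2 iq2 ir2 iv2 iA2 iB iE12 iE13 iE123 iEs P1 P2 M21 Hn cA2 c12g tw
  eEs cBA csr cs2 cs12 csA cXv cXB c13q c13A cAv -> ->.
have cA2' : A2' * v2 = v2 * A2' by apply: comm_inverse iA2 _.
have c12g' : E12' * g = g * E12' by apply: comm_inverse iE12 _.
have csr' : Es * r' = r' * Es by rewrite (comm_inverse ir) // -csr.
have cs12' : Es * E12' = E12' * Es by rewrite (comm_inverse iE12) // -cs12.
have cAv' : A2' * v21 = v21 * A2' by apply: comm_inverse iA2 _.
have c13A' : A2' * E13 = E13 * A2' by apply: comm_inverse iA2 _; rewrite c13A.
have cXB' : A2' * X1 = X1 * B'.
  apply: (mulr_inverseI iA2); rewrite (cancell _ iA2) mulrA -cXB -mulrA.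
  by rewrite (proj1 iB) mulr1.
have cg' : g' * E12' = E12' * g' by apply: comm_inverse ig _; rewrite c12g'.
have c13q' : q2' * E13 = E13 * q2' by apply: comm_inverse iq2 _; rewrite c13q.
have eW z : r' * (E12' * (r2 * (A2' * (A2' * (r2' * (E12' * z)))))) = B' * (B' * (r' * z)).
  apply: (mulr_inverseI iEs); apply: (mulr_inverseI iEs).
  rewrite !(tailE csr') !(tailE cs12').
  transitivity (A1 * (A1 * (r' * z))).
    have := tail1 tw z; rewrite -!mulrA => <-.
    by rewrite (cancellV _ iE12) (cancellV _ ir).
  by rewrite eEs -!mulrA !(tailE cBA) (cancell _ iB) (cancell _ iB).
have q2p2 z : p2' * (q2 * z) = g * (r2 * (v2' * z)).
  apply: (mulr_inverseI ip2); rewrite (cancell _ ip2).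
  have := tail1 P2 (v2' * z); rewrite -!mulrA => ->.
  by rewrite (cancell _ iv2).
have p2q2 z : q2' * (p2 * z) = v2 * (r2' * (g' * z)).
  apply: (mulr_inverseI iq2); rewrite (cancell _ iq2).
  have := tail1 P2 (r2' * (g' * z)); rewrite -!mulrA => <-.
  by rewrite (cancell _ ir2) (cancell _ ig).
have pq z : q' * (p * z) = v * (r' * (g' * z)).
  apply: (mulr_inverseI iq); rewrite (cancell _ iq).
  have := tail1 P1 (r' * (g' * z)); rewrite -!mulrA => <-.
  by rewrite (cancell _ ir) (cancell _ ig).
have hK z : p2 * (E12' * (p' * (E123 * (G1 * (r23 * z))))) = q2 * (E13 * (v21 * z)).
  have e z0 : p2 * (E12' * (p' * (E123 * z0))) = E13 * (o * z0).
    apply: (mulr_inverseI (inverse_pair_sym iE13)); rewrite (cancellV _ iE13).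
    have := tail1 Hn (p' * (E123 * z0)); rewrite -!mulrA => <-.
    by rewrite (cancell _ ip) (cancellV _ iE123).
  have M z0 : o * (G1 * (r23 * z0)) = q2 * (v21 * z0).
    by have := tail1 M21 z0; rewrite -!mulrA.
  by rewrite e M (tailE c13q).
rewrite -[LHS]mulr1 -[RHS]mulr1; move: (1 : A) => z; rewrite -!mulrA.
transitivity (p' * (E123 * (G1 * (r23 * (A2' * (A2' * (X1 * (r' * (g' * z))))))))).
  rewrite pq q2p2 p2q2 !(tailE cA2') (cancellV _ iv2) (tailE cg') (cancellV _ ig) (tailE cg').
  by rewrite eW (tailE cXv) -!(tailE cXB').
rewrite pq (tailE cXv) hK (cancellV _ iq2) !(tailE c13A') !(tailE cAv') -hK.
by rewrite (cancellV _ ip2) !(cancell _ iE12).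
Qed.

End RingWords.

(** * Exponentials and associators as functions on a quotient ring *)

Section QuotientValues.
Variables (k : comAlgType rat) (mu : k) (Phi : f2 k).
Hypothesis hM : is_M (MPt mu Phi).
Variables (X : finType) (R : ncseries k X -> Prop).
Local Notation pi := (@qpi k X R).
Implicit Types x y : quo R.

Definition small x := exists s, vanish 1 s /\ pi s = x.

(** Exponentials and substitutions need a representative without constant term, which [qrepr] does
    not guarantee. The default 0 makes [slift_vanish] unconditional. *)
Definition slift x : ncseries k X :=
  if pselect (small x) is left h then projT1 (cid h) else 0.

Lemma slift_vanish x : vanish 1 (slift x).
Proof.
rewrite /slift; case: pselect => [h|_]; last exact: vanish_zero.
by case: (projT2 (cid h)).
Qed.

Lemma sliftK x : small x -> pi (slift x) = x.
Proof.
by rewrite /slift; case: pselect => // h _; case: (projT2 (cid h)).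
Qed.

Lemma small_pi s : vanish 1 s -> small (pi s).
Proof. by move=> h; exists s. Qed.
Lemma smallD x y : small x -> small y -> small (x + y).
Proof.
by move=> [s [hs <-]] [t [ht <-]]; exists (s + t); rewrite qpiD; split=> //; apply: vanishD.
Qed.
Lemma smallN x : small x -> small (- x).
Proof. by move=> [s [hs <-]]; exists (- s); rewrite qpiN; split=> //; apply: vanishN. Qed.

(* [EE x] is e^{mu x/2} and [FF x y] is Phi(x, y), as functions on the quotient. *)
Definition EE x := pi (ncexp (Defs.half mu *: slift x)).
Definition FF x y := pi (ev2 Phi (slift x) (slift y)).

Let vE x : vanish 1 (Defs.half mu *: slift x).
Proof. exact/vanishZ/slift_vanish. Qed.

Lemma EE_pi s : vanish 1 s -> pi (ncexp (Defs.half mu *: s)) = EE (pi s).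
Proof.
move=> hs; apply: qpi_exp => //; first exact: vanishZ.
by rewrite !qpiZ sliftK //; apply: small_pi.
Qed.

Lemma FF_pi s t : vanish 1 s -> vanish 1 t -> pi (ev2 Phi s t) = FF (pi s) (pi t).
Proof.
move=> hs ht; apply: qpi_ev2 => //; do ?exact: slift_vanish.
  by rewrite sliftK //; apply: small_pi.
by rewrite sliftK //; apply: small_pi.
Qed.

Lemma EE_intertwine g x y : small x -> small y -> g * x = y * g -> g * EE x = EE y * g.
Proof.
move=> sx sy h; apply: exp_intertwine => //.
by rewrite !qpiZ !sliftK // -qscaleAr h qscaleAl.
Qed.

Lemma FF_intertwine g x y x' y' : small x -> small y -> small x' -> small y' ->
  g * x = x' * g -> g * y = y' * g -> g * FF x y = FF x' y' * g.
Proof.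
move=> sx sy sx' sy' hx hy; apply: ev2_intertwine; do ?exact: slift_vanish.
  by rewrite !sliftK.
by rewrite !sliftK.
Qed.

Lemma EE_comm g x : small x -> lie g x = 0 -> g * EE x = EE x * g.
Proof. by move=> sx /lie_eq0P h; apply: EE_intertwine. Qed.

Lemma EE_EE x y : small x -> small y -> lie x y = 0 -> EE x * EE y = EE y * EE x.
Proof.
move=> sx sy /lie_eq0P h; apply: EE_intertwine => //.
by apply/esym/EE_intertwine.
Qed.

Lemma EE_FF x y z : small x -> small y -> small z -> lie x y = 0 -> lie x z = 0 ->
  EE x * FF y z = FF y z * EE x.
Proof.
move=> sx sy sz /lie_eq0P hy /lie_eq0P hz; apply: FF_intertwine => //.
  by apply/esym/EE_intertwine.
by apply/esym/EE_intertwine.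
Qed.

Lemma EE_add x y : small x -> small y -> lie x y = 0 -> EE (x + y) = EE x * EE y.
Proof.
move=> sx sy /lie_eq0P h.
have -> : EE (x + y) = pi (ncexp (Defs.half mu *: slift x + Defs.half mu *: slift y)).
  rewrite -scalerDr EE_pi; last by apply: vanishD; apply: slift_vanish.
  by rewrite qpiD !sliftK.
apply: qpi_expD => //.
by rewrite !qpiZ !sliftK // -!(qscaleAr, qscaleAl) h.
Qed.

Lemma EE_inverse x : small x -> inverse_pair (EE x) (EE (- x)).
Proof.
move=> sx; have -> : EE (- x) = pi (ncexp (- (Defs.half mu *: slift x))).
  rewrite -scalerN EE_pi; last exact/vanishN/slift_vanish.
  by rewrite qpiN sliftK.
by split; [apply: qpi_expN|apply: qpi_Nexp].
Qed.

Lemma FF_inverse x y : inverse_pair (FF x y) (FF y x).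
Proof. by split; apply: (Phi_inverse hM); apply: slift_vanish. Qed.

Lemma FF_hexagon x y z : small x -> small y -> small z ->
  lie x (y + z) = 0 -> lie y (x + z) = 0 -> lie z (x + y) = 0 ->
  EE y * FF x y * EE x * FF z x * EE z * FF y z = EE (x + z + y).
Proof.
move=> sx sy sz hx hy hz.
have v := slift_vanish.
apply: etrans (Phi_hexagon hM (R := R) (v x) (v y) (v z) _ _ _) _; rewrite ?sliftK //.
by rewrite EE_pi ?qpiD ?sliftK //; do 2?apply: vanishD; apply: v.
Qed.

Lemma FF_shift x y d : small x -> small y -> small d ->
  lie d x = 0 -> lie d y = 0 -> FF (x + d) y = FF x y.
Proof.
move=> sx sy sd dx dy.
apply: (Phi_shift hM (d := d) (e := 0)); do ?exact: slift_vanish; rewrite ?sliftK ?addr0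
  ?lie0l ?lie0r //; exact: smallD.
Qed.

Section Strands.
Variable t : 'I_4 -> 'I_4 -> quo R.
Hypothesis small_t : forall i j, small (t i j).
Hypothesis tC : forall i j, t i j = t j i.
Hypothesis tri : forall i j l, uniq [:: i; j; l] -> lie (t i j) (t i l + t j l) = 0.
Hypothesis far : forall i j l m, uniq [:: i; j; l; m] -> lie (t i j) (t l m) = 0.

Lemma FF_pentagon i j l m : uniq [:: i; j; l; m] ->
  FF (t j l) (t l m) * FF (t i j + t i l) (t j m + t l m) * FF (t i j) (t j l) =
  FF (t i j) (t j l + t j m) * FF (t i l + t j l) (t l m).
Proof.
(* The pentagon for strands in an arbitrary order comes from relabelling by this injection. *)
move=> u; pose f (c : 'I_4) := nth i [:: i; j; l; m] c.
have f_inj : injective f.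
  move=> c1 c2 /eqP; rewrite /f nth_uniq ?(ltn_ord c1) ?(ltn_ord c2) //.
  by move/eqP/val_inj.
pose T (c1 c2 : 'I_4) := slift (t (f c1) (f c2)).
have piT c1 c2 : pi (T c1 c2) = t (f c1) (f c2) by rewrite sliftK.
have uf s : uniq s -> uniq (map f s) by rewrite map_inj_uniq.
have := Phi_pentagon hM (T := T) (R := R) (fun _ _ => slift_vanish _).
rewrite /= => h; have {h} := h _ _ _.
have fE p : (0 < p <= 4)%N -> f (ix 3 p) = nth i [:: i; j; l; m] p.-1.
  by case/andP=> p0 p4; rewrite /f inordK // prednK.
rewrite !FF_pi; do ?[exact: slift_vanish | apply: vanishD; exact: slift_vanish].
rewrite !qpiD !piT !fE //=; apply.
- by move=> p q; rewrite !piT tC.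
- by move=> p q r u'; rewrite !piT; have := uf [:: p; q; r] u'; apply: tri.
- by move=> p q r s u'; rewrite !piT; have := uf [:: p; q; r; s] u'; apply: far.
Qed.
End Strands.

End QuotientValues.

(** * Identities on four strands *)

Lemma uniq4C (T : eqType) (a b c d : T) : uniq [:: a; b; c; d] -> uniq [:: a; c; b; d].
Proof. by rewrite (perm_uniq (_ : perm_eq [:: a; c; b; d] [:: a; b; c; d])) // perm_cons (perm_catCA [:: c] [:: b] [:: d]). Qed.
Lemma uniq4R (T : eqType) (a b c d : T) : uniq [:: a; b; c; d] -> uniq [:: a; c; d; b].
Proof. by rewrite (perm_uniq (_ : perm_eq [:: a; c; d; b] [:: a; b; c; d])) // perm_cons perm_sym -(perm_rot 1). Qed.

Lemma cancel_sums (V : zmodType) (w x y z : V) :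
  (((w - w)%R = 0) * ((- w + w)%R = 0) * ((z + w - w)%R = z) * ((z - w + w)%R = z) *
   ((w + x - w)%R = x) * ((- w + x + w)%R = x) *
   ((z + w + x - w)%R = (z + x)%R) * ((z - w + x + w)%R = (z + x)%R) *
   ((w + x + y - w)%R = (x + y)%R) * ((- w + x + y + w)%R = (x + y)%R))%type.
Proof.
have e1 z' w' x' : z' + w' + x' - w' = z' + x' :> V by rewrite (addrAC z') addrK.
have e2 z' w' x' : z' - w' + x' + w' = z' + x' :> V by rewrite (addrAC z') subrK.
have e3 w' x' : w' + x' - w' = x' :> V by rewrite addrC addKr.
have e4 w' x' : - w' + x' + w' = x' :> V by rewrite addrC addNKr.
do !split; rewrite ?addrK ?subrK ?subrr ?addNr ?e1 ?e2 ?e3 ?e4 //.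
  by rewrite -(addrA w) e3.
by rewrite -(addrA (- w)) e4.
Qed.

Section Braids4.
Variables (k : comAlgType rat) (mu : k) (Phi : f2 k).
Hypothesis hM : is_M (MPt mu Phi).
Variables (X : finType) (R : ncseries k X -> Prop).
Local Notation E := (@EE k mu X R).
Local Notation F := (@FF k Phi X R).
Variable t : 'I_4 -> 'I_4 -> quo R.
Hypothesis small_t : forall i j, small (t i j).
Hypothesis tC : forall i j, t i j = t j i.
Hypothesis tri : forall i j l, uniq [:: i; j; l] -> lie (t i j) (t i l + t j l) = 0.
Hypothesis far : forall i j l m, uniq [:: i; j; l; m] -> lie (t i j) (t l m) = 0.

(** The brackets inside a triangle agree up to sign. One unknown per triangle then lets rewriting
    decide whether a bracket of sums vanishes. *)
Lemma triangle_brackets i j l : uniq [:: i; j; l] -> exists w,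
  ((lie (t i j) (t i l) = w) * (lie (t i j) (t j l) = - w) * (lie (t i l) (t j l) = w) *
   (lie (t i l) (t i j) = - w) * (lie (t j l) (t i j) = w) * (lie (t j l) (t i l) = - w))%type.
Proof.
move=> u; exists (lie (t i j) (t i l)).
have e1 : lie (t i j) (t j l) = - lie (t i j) (t i l).
  by apply/eqP; rewrite -subr_eq0 opprK addrC -lieDr tri.
have e2 : lie (t i l) (t j l) = lie (t i j) (t i l).
  have := tri (uniq3C (uniq3R (uniq3R u))); rewrite lieDr (tC l j) => /eqP.
  by rewrite [lie (t i l) (t i j)]lieC addrC subr_eq0 => /eqP.
by rewrite [lie (t j l) (t i j)]lieC [lie (t j l) (t i l)]lieC [lie (t i l) (t i j)]lieC e1 e2 opprK.
Qed.

Variables p q r s : 'I_4.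
Hypothesis u : uniq [:: p; q; r; s].
(** When p is the extra strand 0, the letters a, b, c are the z_i and d, e, f are t_12, t_13,
    t_23. *)
Local Notation a := (t p q).
Local Notation b := (t p r).
Local Notation c := (t p s).
Local Notation d := (t q r).
Local Notation e := (t q s).
Local Notation f := (t r s).


Lemma far_brackets :
  ((lie a f = 0) * (lie f a = 0) * (lie b e = 0) * (lie e b = 0) * (lie c d = 0) * (lie d c = 0))%type.
Proof.
have h : lie a f = 0 /\ lie b e = 0 /\ lie c d = 0.
  move: u; rewrite /= !inE !negb_or !andbT => /and3P[/and3P[pq pr ps] /andP[qr qs] rs].
  by split; [|split]; apply: far; rewrite /= !inE !negb_or ?(eq_sym r q) ?(eq_sym s q)
    ?(eq_sym s r) ?pq ?pr ?ps ?qr ?qs ?rs.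
case: h => h1 [h2 h3].
by rewrite (lieC f) (lieC e) (lieC d) h1 h2 h3 oppr0.
Qed.

Lemma brackets4 : exists w1 w2 w3 w4,
  ((lie a b = w1) * (lie a d = - w1) * (lie b d = w1) *
   (lie b a = - w1) * (lie d a = w1) * (lie d b = - w1) *
   ((lie a c = w2) * (lie a e = - w2) * (lie c e = w2) *
   (lie c a = - w2) * (lie e a = w2) * (lie e c = - w2)) *
   ((lie b c = w3) * (lie b f = - w3) * (lie c f = w3) *
   (lie c b = - w3) * (lie f b = w3) * (lie f c = - w3)) *
   ((lie d e = w4) * (lie d f = - w4) * (lie e f = w4) *
   (lie e d = - w4) * (lie f d = w4) * (lie f e = - w4)))%type.
Proof.
move: u; rewrite /= !inE !negb_or !andbT => /and3P[/and3P[pq pr ps] /andP[qr qs] rs].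
have u1 : uniq [:: p; q; r] by rewrite /= !inE negb_or pq pr qr.
have u2 : uniq [:: p; q; s] by rewrite /= !inE negb_or pq ps qs.
have u3 : uniq [:: p; r; s] by rewrite /= !inE negb_or pr ps rs.
have u4 : uniq [:: q; r; s] by rewrite /= !inE negb_or qr qs rs.
have [w1 T1] := triangle_brackets u1; have [w2 T2] := triangle_brackets u2.
have [w3 T3] := triangle_brackets u3; have [w4 T4] := triangle_brackets u4.
by exists w1, w2, w3, w4; rewrite !T1 !T2 !T3 !T4.
Qed.

Hypothesis total : a + b + c + d + e + f = 0.

Let sa : small a := small_t _ _. Let sb : small b := small_t _ _.
Let sc : small c := small_t _ _. Let sd : small d := small_t _ _.
Let se : small e := small_t _ _. Let sf : small f := small_t _ _.
Let iE := @EE_inverse k mu X R.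
Let iF := FF_inverse hM (R := R).

Ltac smalls := repeat (first [exact: sa | exact: sb | exact: sc | exact: sd | exact: se
  | exact: sf | apply: smallD | apply: smallN]).
(** Brackets of sums are expanded in the four unknowns of [brackets4], where they cancel. *)
Ltac brackets := let T := fresh in have [? [? [? [? T]]]] := brackets4;
  rewrite ?opprD ?lieDl ?lieDr ?lieNl ?lieNr ?T ?far_brackets ?lie_self;
  rewrite ?opprD ?opprK ?oppr0 ?addr0 ?add0r ?addrA ?cancel_sums ?oppr0 //.

Lemma pentagon_pqrs : F d f * F (a + b) (e + f) * F a d = F a (d + e) * F (b + d) f.
Proof. exact: (FF_pentagon hM small_t tC tri far u). Qed.

Lemma pentagon_prqs : F d e * F (a + b) (e + f) * F b d = F b (d + f) * F (a + d) e.
Proof.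
have := FF_pentagon hM small_t tC tri far (uniq4C u).
by rewrite (tC r q) (addrC (t p r)) (addrC (t r s)).
Qed.

Lemma pentagon_prsq : F f e * F (b + c) (d + e) * F b f = F b (d + f) * F (c + f) e.
Proof.
have := FF_pentagon hM small_t tC tri far (uniq4R u).
by rewrite (tC r q) (tC s q) (addrC (t r s)).
Qed.

Lemma pentagon_psqr : F e d * F (a + c) (d + f) * F c e = F c (e + f) * F (a + e) d.
Proof.
have := FF_pentagon hM small_t tC tri far (uniq4R (uniq4R u)).
by rewrite (tC s q) (tC s r) (addrC (t p s)) (addrC (t r s)).
Qed.

Lemma twist_dab : E d * F a d * E a * E a * F d a =
  E (a + b + d) * E (a + b + d) * F b d * E (- b) * E (- b) * F d b * E (- d).
Proof.
apply: (twist (f2 := F b a) (f2' := F a b)); do ?[exact: iF | apply: iE; smalls].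
- by apply: FF_hexagon; smalls; brackets.
- rewrite -(addrA a) [b + d]addrC addrA. by apply: FF_hexagon; smalls; brackets.
- by apply: EE_EE; smalls; brackets.
- by apply: EE_FF; smalls; brackets.
Qed.

Lemma twist_ecf : E (e + f) * F c (e + f) * E c * E c * F (e + f) c =
  E (- d) * E (- d) * F (a + b) (e + f) * E (- (a + b)) * E (- (a + b)) *
    F (e + f) (a + b) * E (- (e + f)).
Proof.
(* [total] makes c, a + b, e + f a triangle whose full twist is that of -d. *)
have tot : c + (a + b) + (e + f) = - d.
  apply/eqP; rewrite -subr_eq0 opprK -[X in _ == X]total.
  by rewrite (AC (1*2*2*1) (2*3*1*6*4*5)).
rewrite -tot.
apply: (twist (f2 := F (a + b) c) (f2' := F c (a + b))); do ?[exact: iF | apply: iE; smalls].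
- by apply: FF_hexagon; smalls; brackets.
- have -> : c + (a + b) + (e + f) = c + (e + f) + (a + b) by rewrite addrAC.
  by apply: FF_hexagon; smalls; brackets.
- by apply: EE_EE; smalls; brackets.
- by apply: EE_FF; smalls; brackets.
Qed.

Let hex1 : E f * F d f * E d * F e d * E e * F f e = E (d + e + f).
Proof. by apply: FF_hexagon; smalls; brackets. Qed.
Let hex2 : E d * F f d * E f * F e f * E e * F d e = E (d + e + f).
Proof.
have -> : d + e + f = f + e + d by rewrite (ACl (3*2*1)).
by apply: FF_hexagon; smalls; brackets.
Qed.

Let es : E (d + e) * E f = E (d + e + f).
Proof. by apply/esym/EE_add; smalls; brackets. Qed.
Let es' : E f * E (d + e) = E (d + e + f).
Proof. by rewrite -es; apply: EE_EE; smalls; brackets. Qed.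
Let cEd : E (d + e + f) * E d = E d * E (d + e + f).
Proof. by apply: EE_EE; smalls; brackets. Qed.
Let cEe : E (d + e + f) * E e = E e * E (d + e + f).
Proof. by apply: EE_EE; smalls; brackets. Qed.
Let cFdf : E (d + e + f) * F d f = F d f * E (d + e + f).
Proof. by apply: EE_FF; smalls; brackets. Qed.
Let cFde : E (d + e + f) * F d e = F d e * E (d + e + f).
Proof. by apply: EE_FF; smalls; brackets. Qed.
Let cFfe : E (d + e + f) * F f e = F f e * E (d + e + f).
Proof. by apply: EE_FF; smalls; brackets. Qed.

Lemma alpha_plus_strands :
  (E (e + f) * F c (e + f) * (E c * E c) * F (e + f) c * F e d) *
  (E (d + f) * F b (d + f) * (E b * E b) * F (d + f) b * F f e) *
  (E (d + e) * F a (d + e) * (E a * E a) * F (d + e) a * F d f) = 1.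
Proof.
apply: (@alpha_plus_words _ (F (a + b) (e + f)) (F (e + f) (a + b)) (F a d) (F d a)
  (F (b + d) f) (F f (b + d)) _ _ (F d f) (F f d) _ _ (F d e) _ (F b d) (F d b)
  (F (a + d) e) (F e (a + d)) _ _ _ (E a) (E b) (E (- b)) (E c) _ _ _ (E d) (E (- d))
  (E e) (E (a + b + d)) (E (d + e + f)) (E (- (e + f))) (E (a + b)) (E (- (a + b))));
  do ?[exact: iF | apply: iE; smalls].
- exact: pentagon_pqrs.
- exact: pentagon_prqs.
- exact: (hexagon_pos (iE sd) (iE sf) (iF _ _) (iF _ _) es' cEd cFdf hex2).
- by apply: EE_FF; smalls; brackets.
- by apply: EE_FF; smalls; brackets.
- by apply: EE_FF; smalls; brackets.
- by apply: EE_EE; smalls; brackets.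
- by apply: EE_FF; smalls; brackets.
- exact: twist_dab.
- by apply: EE_FF; smalls; brackets.
- by apply: EE_EE; smalls; brackets.
- exact: twist_ecf.
- have -> : d + e + f = d + f + e by rewrite addrAC.
  by apply/esym/EE_add; smalls; brackets.
- exact: cFde.
- have ed : - (e + f) + (d + e + f) = d by rewrite -(addrA d) (addrC (- _)) addrK.
  rewrite -[RHS]/(E d) -[in RHS]ed.
  by apply/esym/EE_add; smalls; brackets.
- by apply: EE_add; smalls; brackets.
- by apply: EE_EE; smalls; brackets.
Qed.

Lemma alpha_minus_strands (X1 X2 X3 : quo R) :
  X1 * (b + d) = b * X1 -> X1 * f = f * X1 ->
  X2 * (c + f) = c * X2 -> X2 * e = e * X2 ->
  X3 * (a + e) = a * X3 -> X3 * d = d * X3 -> X3 * (X2 * X1) = 1 ->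
  (F (a + b) (e + f) * X3 * F (e + f) c * F e d) *
  (F (a + c) (d + f) * X2 * F (d + f) b * F f e) *
  (F (b + c) (d + e) * X1 * F (d + e) a * F d f) = 1.
Proof.
move=> h1 h1' h2 h2' h3 h3' hX.
apply: (@alpha_minus_words _ (F (a + b) (e + f)) (F a d) (F (b + d) f) (F f (b + d))
  (F a (d + e)) _ (F d f) (F f d) _ _ (F b (d + f)) _ (F c (e + f)) _ _ _
  (F b f) (F f b) (F c e) (F e c) (F (c + f) e) (F (a + e) d));
  do ?[exact: iF | exact: hX].
- exact: pentagon_pqrs.
- exact: pentagon_prsq.
- exact: pentagon_psqr.
- by apply: FF_intertwine; smalls.
- by apply: FF_intertwine; smalls.
- by apply: FF_intertwine; smalls.
Qed.

Lemma commutator_strands (X1 U V : quo R) :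
  X1 * (b + d) = b * X1 -> X1 * f = f * X1 ->
  U = F f d * E (d + e) * F (b + c) (d + e) * X1 * F (d + e) a * F d f ->
  V = E (- d) * F e d * F b (d + f) * E (- b) * E (- b) * F (d + f) b * F d e * E (- d) ->
  U * V = E d * E d * V * U.
Proof.
move=> h1 h1'.
apply: (@commutator_words _ (F (a + b) (e + f)) (F (e + f) (a + b)) (F a d) (F d a)
  (F (b + d) f) (F f (b + d)) (F a (d + e)) _ (F d f) _ (F d e) _ (F b (d + f)) _
  (F b d) (F d b) (F (a + d) e) (F e (a + d)) (F f e) (F b f) (F (c + f) e)
  (E a) (E b) _ (E (b + d)) (E (- (b + d))) (E d) (E (- d)) (E e) (E (- e))
  (E (d + e)) (E (- (d + e))) (E (a + b + d)) (E (- (a + b + d))));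
  do ?[exact: iF | apply: iE; smalls].
- exact: pentagon_pqrs.
- exact: pentagon_prqs.
- exact: pentagon_prsq.
- apply: (hexagon_neg (iE sd) (iE se) (iE sf) _ (iF _ _) (iF _ _) es es' cEd cEe cFdf
    cFde cFfe hex1).
  by apply: iE; smalls.
- by apply: EE_FF; smalls; brackets.
- by apply: EE_FF; smalls; brackets.
- exact: twist_dab.
- have -> : a + b + d = b + d + a by rewrite (ACl (2*3*1)).
  by apply: EE_add; smalls; brackets.
- by apply: EE_EE; smalls; brackets.
- by apply: EE_FF; smalls; brackets.
- by apply: EE_FF; smalls; brackets.
- by apply: EE_EE; smalls; brackets.
- by apply: EE_EE; smalls; brackets.
- by apply: FF_intertwine; smalls.
- by apply: EE_intertwine; smalls.
- by apply: EE_FF; smalls; brackets.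
- by apply: EE_EE; smalls; brackets.
- by apply: EE_FF; smalls; brackets.
Qed.

End Braids4.

(** * The strand identities transported to t_{1,3} *)

Section T13Words.
Variables (k : comAlgType rat) (mu : k) (Phi : f2 k).
Hypothesis hM : is_M (MPt mu Phi).
Local Notation pi := (@qpi k (egen 3) erel).
Local Notation E := (@EE k mu (egen 3) erel).
Local Notation F := (@FF k Phi (egen 3) erel).
Local Notation z i := (pi (zz k i)).
Local Notation t i j := (pi (te i j)).
Local Notation ex i := (pi (ncexp (xx true i))).

Section Three.
Variables a b c : 'I_3.
Hypothesis u : uniq [:: a; b; c].

(** Presents the morphism [tt4] only through its relations and values, which is all that the strand
    identities use. *)
Lemma strands4 : exists t4 : 'I_4 -> 'I_4 -> quo (@erel k 3),
  [/\ forall i j, small (t4 i j), forall i j, t4 i j = t4 j i,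
      forall i j l, uniq [:: i; j; l] -> lie (t4 i j) (t4 i l + t4 j l) = 0
    & forall i j l m, uniq [:: i; j; l; m] -> lie (t4 i j) (t4 l m) = 0] /\
  (forall i, t4 ord0 (lift ord0 i) = z i) /\
  (forall i j, t4 (lift ord0 i) (lift ord0 j) = t i j).
Proof.
exists (fun p q => pi (tt4 k p q)); split; last first.
  by split=> [i|i j]; rewrite ?tt4_0l ?tt4_lift.
split=> [i j|i j|i j l|i j l m].
- exact/small_pi/vanish_tt4.
- exact: tt4_sym.
- exact: tt4_tri.
- exact: tt4_far.
Qed.

Let u4 : uniq [:: ord0; lift ord0 a; lift ord0 b; lift ord0 c : 'I_4].
Proof.
rewrite cons_uniq; apply/andP; split; first by rewrite !inE !negb_or.
by rewrite -[X in uniq X]/(map (lift ord0) [:: a; b; c]) map_inj_uniq //; apply: lift_inj.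
Qed.

Let total : z a + z b + z c + t a b + t a c + t b c = 0.
Proof.
have h (V : zmodType) (x1 x2 x3 x4 x5 x6 : V) :
  x1 + x2 + x3 + (x4 + x5 + x6) = x1 + x2 + x3 + x4 + x5 + x6 by rewrite !addrA.
exact: (etrans (esym (h _ _ _ _ _ _ _)) (zz_sum k u)).
Qed.

Lemma alpha_plus_eq1 :
  (E (t a c + t b c) * F (z c) (t a c + t b c) * (E (z c) * E (z c)) *
     F (t a c + t b c) (z c) * F (t a c) (t a b)) *
  (E (t a b + t b c) * F (z b) (t a b + t b c) * (E (z b) * E (z b)) *
     F (t a b + t b c) (z b) * F (t b c) (t a c)) *
  (E (t a b + t a c) * F (z a) (t a b + t a c) * (E (z a) * E (z a)) *
     F (t a b + t a c) (z a) * F (t a b) (t b c)) = 1.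
Proof.
have [t4 [[st tC tri far] [t4z t4t]]] := strands4.
have := alpha_plus_strands hM st tC tri far u4.
rewrite !t4z !t4t; apply; apply: total.
Qed.

Lemma alpha_minus_eq1 :
  (F (z a + z b) (t a c + t b c) * ex c * F (t a c + t b c) (z c) * F (t a c) (t a b)) *
  (F (z a + z c) (t a b + t b c) * ex b * F (t a b + t b c) (z b) * F (t b c) (t a c)) *
  (F (z b + z c) (t a b + t a c) * ex a * F (t a b + t a c) (z a) * F (t a b) (t b c)) = 1.
Proof.
have [t4 [[st tC tri far] [t4z t4t]]] := strands4.
have := alpha_minus_strands hM st tC tri far u4.
rewrite !t4z !t4t; apply.
- exact: (conj_zz_te k u).
- exact: (conj_te k u).
- exact: (conj_zz_te k (uniq3R u)).
- exact: (conj_te k (uniq3C u)).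
- by have := conj_zz_te k (uniq3R (uniq3R u)); rewrite (q_te_sym k c a).
- exact: (conj_te k (uniq3R (uniq3R u))).
- exact: (exp_xx_prod k (uniq3C (uniq3R u))).
Qed.

Lemma commutator_eq1 U V :
  U = F (t b c) (t a b) * E (t a b + t a c) * F (z b + z c) (t a b + t a c) * ex a *
    F (t a b + t a c) (z a) * F (t a b) (t b c) ->
  V = E (- t a b) * F (t a c) (t a b) * F (z b) (t a b + t b c) * E (- z b) * E (- z b) *
    F (t a b + t b c) (z b) * F (t a b) (t a c) * E (- t a b) ->
  U * V = E (t a b) * E (t a b) * V * U.
Proof.
have [t4 [[st tC tri far] [t4z t4t]]] := strands4.
have := @commutator_strands _ _ _ hM _ _ _ st tC tri far _ _ _ _ u4 (ex a) U V.
rewrite !t4z !t4t; apply.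
- exact: (conj_zz_te k u).
- exact: (conj_te k u).
Qed.
End Three.
End T13Words.

(** * Values of A_+ and A_- in a quotient ring *)

Lemma todd_adN (k : comAlgType rat) (X : finType) (x y : ncseries k X) : vanish 1 x ->
  todd_ad (- x) y = todd_ad x y + lie x y.
Proof.
move=> hx; rewrite !todd_adE adserN.
have -> : lie x y = adser (fun n => (n == 1)%:R) x y.
  rewrite /adser (@ncsum_single _ _ 1) /= ?scale1r ?scale1r // => [n /negPf ->|].
    by rewrite scale0r scale0r.
  exact: (vanish_lie hx (@vanish0 _ _ y)).
rewrite -adserD; apply: eq_adser => n.
have := gtoddN 1; rewrite /gtodd scale1r gserD.
move=> /(congr1 (fun a : ncseries rat unit => a (nseq n tt))); rewrite !gserE => ->.
by rewrite expr1n mul1r.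
Qed.

Lemma halfD (k : comAlgType rat) (l : k) : Defs.half l + Defs.half l = l.
Proof. by rewrite /Defs.half -scalerDl -[RHS]scale1r. Qed.
Lemma halfN (k : comAlgType rat) (l : k) : Defs.half (- l) = - Defs.half l.
Proof. exact: scalerN. Qed.

Section SigmaValues.
Variables (k : comAlgType rat) (mu : k) (Phi : f2 k).
Hypothesis hM : is_M (MPt mu Phi).
Variables (X : finType) (R : ncseries k X -> Prop).
Local Notation pi := (@qpi k X R).
Local Notation E := (@EE k mu X R).
Local Notation F := (@FF k Phi X R).

Lemma EE_sqr s : vanish 1 s -> pi (ncexp (mu *: s)) = E (pi s) * E (pi s).
Proof.
move=> hs; rewrite -EE_pi // -{1}(halfD mu) scalerDl.
by apply: qpi_expD => //; apply: vanishZ.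
Qed.

Lemma FF_inv s t : vanish 1 s -> vanish 1 t ->
  pi (ncinv (ev2 Phi s t)) = F (pi t) (pi s).
Proof.
move=> hs ht; apply: qpi_inv; first by rewrite ev2_nil (Phi_nil hM).
by rewrite FF_pi //; apply: (proj1 (FF_inverse hM _ _)).
Qed.

Variables x1 x2 y1 y2 : ncseries k X.
Hypotheses (vx1 : vanish 1 x1) (vx2 : vanish 1 x2) (vy1 : vanish 1 y1) (vy2 : vanish 1 y2).
Hypotheses (ex : pi x2 = - pi x1) (ey : pi y1 = - pi y2).
Let z := todd_ad x1 y2.
Let t := lie x1 y2.

Let vz : vanish 1 z.
Proof. by apply: ncsum_vanish => n; apply/vanishZ/vanish_iter_lier. Qed.
Let vt : vanish 1 t.
Proof. by apply: (@vanish_lie _ _ 0 1); last exact: vy2. Qed.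

(** Since x2 = -x1 and y1 = -y2, this is the series [todd] in -ad x1 applied to -y2, computed by
    [todd_adN]. *)
Lemma todd_ad_opp : pi (todd_ad x2 y1) = - (pi z + pi t).
Proof.
rewrite -qpiD /t /z -todd_adN //.
rewrite (@qpi_todd _ _ R x2 (- x1) y1 (- y2)) ?qpiN //; last exact: vanishN.
by rewrite !todd_adE adserNr qpiN.
Qed.

Lemma lie_opp : pi (lie x2 y1) = pi t.
Proof. by rewrite !qpi_lie ex ey lieNl lieNr opprK. Qed.

Lemma sigma_Ap_value :
  pi (ev2 Phi z t * ncexp (mu *: z) * ncinv (ev2 Phi z t)) =
  F (pi z) (pi t) * (E (pi z) * E (pi z)) * F (pi t) (pi z).
Proof. by rewrite !qpiM FF_inv // EE_sqr // FF_pi. Qed.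

Lemma sigma_Am_value :
  pi (ncexp (Defs.half mu *: t) * ev2 Phi (todd_ad x2 y1) (lie x2 y1) * ncexp x1 *
       ncinv (ev2 Phi z t)) =
  E (pi t) * F (- (pi z + pi t)) (pi t) * pi (ncexp x1) * F (pi t) (pi z).
Proof.
have vt' : vanish 1 (lie x2 y1) by apply: (@vanish_lie _ _ 0 1).
have vz' : vanish 1 (todd_ad x2 y1).
  by apply: ncsum_vanish => n; apply/vanishZ/vanish_iter_lier.
by rewrite !qpiM FF_inv // EE_pi // FF_pi // todd_ad_opp lie_opp.
Qed.

End SigmaValues.

Section SigmaSubst.
Variables (k : comAlgType rat) (mu : k) (Phi : f2 k).
Variables (X : finType) (s : egen 2 -> ncseries k X).
Hypothesis hPhi : Phi [::] = 1.
Hypothesis hs : forall g, vanish 1 (s g).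
Let x i := s (true, ix 1 i).
Let y i := s (false, ix 1 i).

Let sxx e i : subst s (xx e (ix 1 i)) = s (e, ix 1 i).
Proof. exact: subst_letter. Qed.
Let ste i j : subst s (te (ix 1 i) (ix 1 j)) = lie (x i) (y j).
Proof. by rewrite subst_lie // !sxx. Qed.
Let vte i j : vanish 1 (te (ix 1 i) (ix 1 j) : ncseries k (egen 2)).
Proof. exact: (@vanishW _ _ 1 2 _ isT (vanish_te _ _ _)). Qed.
Let vtodd i j : vanish 1 (todd_ad (xx true (ix 1 i)) (xx false (ix 1 j)) : ncseries k (egen 2)).
Proof. by apply: ncsum_vanish => n; apply/vanishZ/vanish_iter_lier/vanish_xx. Qed.
Let stodd i j : subst s (todd_ad (xx true (ix 1 i)) (xx false (ix 1 j))) = todd_ad (x i) (y j).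
Proof. by rewrite subst_todd ?sxx //; apply: vanish_xx. Qed.

Let Ap_shape z t : vanish 1 z -> vanish 1 t ->
  subst s (ev2 Phi z t * ncexp (mu *: z) * ncinv (ev2 Phi z t)) =
  ev2 Phi (subst s z) (subst s t) * ncexp (mu *: subst s z) *
    ncinv (ev2 Phi (subst s z) (subst s t)).
Proof.
move=> vz vt; rewrite !(substM hs) (subst_inv hs); last by rewrite ev2_nil.
rewrite (subst_ev2 _ hs vz vt) (subst_exp hs); last exact: vanishZ.
by rewrite linearZ.
Qed.

Let Am_shape z t z' t' x1 : vanish 1 z -> vanish 1 t -> vanish 1 z' -> vanish 1 t' ->
  vanish 1 x1 ->
  subst s (ncexp (Defs.half mu *: t) * ev2 Phi z' t' * ncexp x1 * ncinv (ev2 Phi z t)) =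
  ncexp (Defs.half mu *: subst s t) * ev2 Phi (subst s z') (subst s t') *
    ncexp (subst s x1) * ncinv (ev2 Phi (subst s z) (subst s t)).
Proof.
move=> vz vt vz' vt' vx; rewrite !(substM hs) (subst_inv hs); last by rewrite ev2_nil.
rewrite (subst_ev2 _ hs vz vt) (subst_ev2 _ hs vz' vt') (subst_exp hs vx) (subst_exp hs (vanishZ _ vt)).
by rewrite linearZ.
Qed.

Lemma subst_sigma_Ap : subst s (sigma_Ap (MPt mu Phi)) =
  ev2 Phi (todd_ad (x 1) (y 2)) (lie (x 1) (y 2)) * ncexp (mu *: todd_ad (x 1) (y 2)) *
    ncinv (ev2 Phi (todd_ad (x 1) (y 2)) (lie (x 1) (y 2))).
Proof. by rewrite -stodd -ste; apply: Ap_shape. Qed.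

Lemma subst_sigma_Am : subst s (sigma_Am (MPt mu Phi)) =
  ncexp (Defs.half mu *: lie (x 1) (y 2)) * ev2 Phi (todd_ad (x 2) (y 1)) (lie (x 2) (y 1)) *
    ncexp (x 1) * ncinv (ev2 Phi (todd_ad (x 1) (y 2)) (lie (x 1) (y 2))).
Proof. by rewrite -!stodd -!ste -[x 1]sxx; apply: Am_shape => //; apply: vanish_xx. Qed.

End SigmaSubst.

(** * Cabling and permutation of strands *)

Section Insertions.
Variable k : comAlgType rat.
Local Notation ser := (ncseries k (egen 3)).

(** The insertion x^{a,bc}, with strands of ['I_3] instead of lists of integers; [relabel] is the
    insertion x^{a,b,c}. *)
Definition cable (a b c : 'I_3) (g : egen 2) : ser :=
  if g.2 == ord0 then xx g.1 a else xx g.1 b + xx g.1 c.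

Definition relabel (a b c : 'I_3) (g : egen 3) : ser := xx g.1 (nth a [:: a; b; c] g.2).

Lemma vanish_cable a b c g : vanish 1 (cable a b c g).
Proof. by rewrite /cable; case: eqP => _; [|apply: vanishD]; apply: vanish_xx. Qed.
Lemma vanish_relabel a b c g : vanish 1 (relabel a b c g).
Proof. exact: vanish_xx. Qed.

Lemma eins_cable (p q r : nat) (u : ncseries k (egen 2)) :
  uniq [:: q; r] -> all (fun c => (0 < c <= 3)%N) [:: p; q; r] ->
  eins 3 [:: [:: p]; [:: q; r]] u = subst (cable (ix 2 p) (ix 2 q) (ix 2 r)) u.
Proof.
move=> uqr h; apply: eq_subst => -[e [[|[|i]] hi]] //; rewrite /cable /=.
  by rewrite big_block ?big_seq1 //= andbT; case/andP: h.
rewrite big_block //= ?big_cons ?big_nil ?addr0 //.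
by case/andP: h.
Qed.

Lemma eins_relabel (p q r : nat) (u : ncseries k (egen 3)) :
  all (fun c => (0 < c <= 3)%N) [:: p; q; r] ->
  eins 3 [:: [:: p]; [:: q]; [:: r]] u = subst (relabel (ix 2 p) (ix 2 q) (ix 2 r)) u.
Proof.
move=> /= /and4P[hp hq hr _]; apply: eq_subst => -[e [[|[|[|i]]] hi]] //; rewrite /relabel /=.
all: by rewrite big_block ?big_seq1 //= ?hp ?hq ?hr.
Qed.

Section Values.
Variables a b c : 'I_3.
Let vr := vanish_relabel a b c.
Let f (i : 'I_3) := nth a [:: a; b; c] i.

Lemma relabel_cable (u : ncseries k (egen 2)) :
  subst (relabel a b c) (subst (cable (ix 2 1) (ix 2 2) (ix 2 3)) u) = subst (cable a b c) u.
Proof.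
rewrite subst_comp //; last exact: vanish_cable.
apply: eq_subst => -[e i]; rewrite /cable /=.
case: ifP => _; rewrite ?linearD /= !subst_letter // /relabel ?ix21 ?ix22 ?ix23 //=.
Qed.

Let vte (i j : 'I_3) : vanish 1 (te i j : ser). Proof. exact: vanish1_te. Qed.

Lemma relabel_brace (u : ncseries k (tgen 3)) :
  subst (relabel a b c) (brace u) =
  subst (fun g : tgen 3 => te (f (val g).1) (f (val g).2)) u.
Proof.
rewrite /brace subst_comp //; apply: eq_subst => g.
by rewrite subst_lie // !subst_letter.
Qed.

Lemma relabel_Phi Phi :
  subst (relabel a b c) (brace (tins 3 [:: [:: 1]; [:: 2]; [:: 3]]%N (Phi_t3 Phi))) =
  ev2 Phi (te a b) (te b c).
Proof.
rewrite relabel_brace (subst_Phi_t3_block (T := fun i j => te (f i) (f j))) //; last exact: all_block3.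
by rewrite /blocksum /= !big_seq1 /f ix21 ix22 ix23.
Qed.

Lemma relabel_exp l : subst (relabel a b c)
    (brace (ncexp (l *: (tij (ix 2 1) (ix 2 2) + tij (ix 2 1) (ix 2 3))))) =
  ncexp (l *: (te a b + te a c)).
Proof.
have vt (i j : 'I_3) : vanish 1 (tij i j : ncseries k _) by apply: vanish_tij.
have v2 : vanish 1 (l *: (tij (ix 2 1) (ix 2 2) + tij (ix 2 1) (ix 2 3)) : ncseries k (tgen 3)).
  exact/vanishZ/vanishD.
rewrite relabel_brace subst_exp //; congr ncexp; rewrite linearZ linearD /=.
rewrite !(subst_tij (F := fun i j => te (f i) (f j))) ?ix21 ?ix22 ?ix23 //.
Qed.

End Values.
End Insertions.

Lemma opp_of_sum6 (V : zmodType) (x1 x2 x3 x4 x5 x6 : V) :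
  x1 + x2 + x3 + (x4 + x5 + x6) = 0 -> - (x1 + (x4 + x5)) = x2 + x3 + x6.
Proof.
move=> h; apply/eqP; rewrite eq_sym -subr_eq0 opprK -[X in _ == X]h; apply/eqP.
by rewrite (AC (2*1*(1*2)) (4*1*2*(5*6*3))).
Qed.

(** * The relations for alpha_+ and alpha_- *)

Section SigmaIsEll.
Variables (k : comAlgType rat) (mu : k) (Phi : f2 k).
Hypothesis hM : is_M (MPt mu Phi).
Local Notation pi := (@qpi k (egen 3) erel).
Local Notation E := (@EE k mu (egen 3) erel).
Local Notation F := (@FF k Phi (egen 3) erel).
Local Notation z i := (pi (zz k i)).
Local Notation t i j := (pi (te i j)).
Local Notation ex i := (pi (ncexp (xx true i))).
Local Notation Ap := (sigma_Ap (MPt mu Phi)).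
Local Notation Am := (sigma_Am (MPt mu Phi)).

Let vxx e (i : 'I_3) : vanish 1 (xx e i : ncseries k (egen 3)). Proof. exact: vanish_xx. Qed.

Lemma cable_values a b c e : cable k a b c (e, ix 1 1) = xx e a /\
  cable k a b c (e, ix 1 2) = xx e b + xx e c.
Proof. by split; rewrite /cable /ix -val_eqE /= inordK. Qed.

Lemma cable_Ap a b c : uniq [:: a; b; c] ->
  pi (subst (cable k a b c) Ap) =
  F (z a) (t a b + t a c) * (E (z a) * E (z a)) * F (t a b + t a c) (z a).
Proof.
move=> u; have vcable := @vanish_cable k a b c.
rewrite (subst_sigma_Ap mu (Phi_nil hM) vcable).
rewrite (cable_values a b c true).1 (cable_values a b c false).2.
rewrite (sigma_Ap_value hM) //; last exact: vanishD.
by rewrite -(zzE k u) qpi_lie qpiD lieDr -!q_te.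
Qed.

(** By [zz_sum] the left argument is z_b + z_c + t_{bc}, and t_{bc} commutes with z_b + z_c and with
    t_{ab} + t_{ac}, so [FF_shift] drops it. *)
Lemma FF_zz_shift a b c : uniq [:: a; b; c] ->
  F (- (z a + (t a b + t a c))) (t a b + t a c) = F (z b + z c) (t a b + t a c).
Proof.
move=> u; rewrite (opp_of_sum6 (zz_sum k u)).
have sz i : small (z i) by apply/small_pi/vanish_zz.
have st i j : small (t i j) by apply/small_pi/vanish1_te.
apply: (FF_shift hM); [exact: smallD|exact: smallD|exact: st| |].
  exact: (te_zz k (uniq3R u)).
exact: etrans (congr1 (lie (t b c)) (congr2 +%R (q_te_sym k a b) (q_te_sym k a c)))
  (te_tri k (uniq3R u)).
Qed.

Lemma cable_Am a b c : uniq [:: a; b; c] ->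
  pi (subst (cable k a b c) Am) =
  E (t a b + t a c) * F (z b + z c) (t a b + t a c) * ex a * F (t a b + t a c) (z a).
Proof.
move=> u; have vcable := @vanish_cable k a b c.
rewrite (subst_sigma_Am mu (Phi_nil hM) vcable).
rewrite (cable_values a b c true).1 (cable_values a b c false).2.
rewrite (cable_values a b c true).2 (cable_values a b c false).1.
have hx : pi (xx true b + xx true c) = - pi (xx true a) by apply: q_xx3N u.
have hy : pi (xx false a) = - pi (xx false b + xx false c).
  by rewrite (q_xx3N k false u) opprK.
rewrite (sigma_Am_value hM _ _ _ _ hx hy) //; do ?exact: vanishD.
rewrite -(zzE k u) qpi_lie qpiD lieDr -!q_te.
by rewrite -(FF_zz_shift u).
Qed.

Let half_inv a b c : pi (ncexp (Defs.half (- mu) *: (te a b + te a c))) * E (t a b + t a c) = 1.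
Proof.
have vt : vanish 1 (te a b + te a c : ncseries k (egen 3)) by apply: vanishD; apply: vanish1_te.
by rewrite -qpiD -EE_pi // halfN scaleNr qpi_Nexp //; apply: vanishZ.
Qed.

Local Notation tg i j := (tij (ix 2 i) (ix 2 j) : ncseries k (tgen 3)).
Local Notation P p q r := (tins 3 [:: [:: p]; [:: q]; [:: r]]%N (Phi_t3 Phi)).

Definition alpha e : ncseries k (egen 3) :=
  brace (ncexp (Defs.half (if e then mu else - mu) *: (tg 1 2 + tg 1 3)))
      * eins 3 [:: [:: 1]; [:: 2; 3]]%N (if e then Ap else Am) * brace (P 1 2 3)%N.

(** The equations for T, s1, s2 absorb the symmetry of t_{ij} and the order of summands, so that the
    result matches [alpha_plus_eq1] literally. *)
Lemma relabel_alpha_plus (a b c : 'I_3) T s1 s2 : uniq [:: a; b; c] ->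
  T = t a b + t a c -> s1 = t a b -> s2 = t b c ->
  pi (subst (relabel k a b c) (alpha true)) =
  E T * F (z a) T * (E (z a) * E (z a)) * F T (z a) * F s1 s2.
Proof.
move=> u -> -> ->; have vr := @vanish_relabel k a b c.
rewrite /alpha !(substM vr) eins_cable // relabel_cable relabel_Phi relabel_exp.
rewrite !qpiM (cable_Ap u) EE_pi ?FF_pi ?qpiD; do ?[exact: vanish1_te|apply: vanishD; exact: vanish1_te].
by rewrite !mulrA.
Qed.

Lemma relabel_alpha_minus (a b c : 'I_3) T s1 s2 w : uniq [:: a; b; c] ->
  T = t a b + t a c -> s1 = t a b -> s2 = t b c -> w = z b + z c ->
  pi (subst (relabel k a b c) (alpha false)) =
  F w T * ex a * F T (z a) * F s1 s2.
Proof.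
move=> u -> -> -> ->; have vr := @vanish_relabel k a b c.
rewrite /alpha !(substM vr) eins_cable // relabel_cable relabel_Phi relabel_exp.
rewrite !qpiM (cable_Am u) FF_pi; do ?exact: vanish1_te.
(* The prefactor of alpha_- cancels the one in A_-. *)
by rewrite !mulrA half_inv mul1r.
Qed.

Local Notation i1 := (ix 2 1).
Local Notation i2 := (ix 2 2).
Local Notation i3 := (ix 2 3).

Let u123 : uniq [:: i1; i2; i3].
Proof. by rewrite ix21 ix22 ix23. Qed.
Let u231 := uniq3R u123.
Let u312 := uniq3R u231.

Lemma sigma_alpha e :
  cong erel (eins 3 [:: [:: 3]; [:: 1]; [:: 2]]%N (alpha e) *
    eins 3 [:: [:: 2]; [:: 3]; [:: 1]]%N (alpha e) *
    eins 3 [:: [:: 1]; [:: 2]; [:: 3]]%N (alpha e)) 1.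
Proof.
apply/qpiP; rewrite !eins_relabel // !qpiM qpi1.
have s13 : t i3 i1 = t i1 i3 by apply: q_te_sym.
have s23 : t i3 i2 = t i2 i3 by apply: q_te_sym.
have s12 : t i2 i1 = t i1 i2 by apply: q_te_sym.
have e312 : t i1 i3 + t i2 i3 = t i3 i1 + t i3 i2 by rewrite s13 s23.
have e231 : t i1 i2 + t i2 i3 = t i2 i3 + t i2 i1 by rewrite s12; apply: addrC.
case: e.
  rewrite (relabel_alpha_plus u312 e312 (esym s13) (erefl _)).
  rewrite (relabel_alpha_plus u231 e231 (erefl _) (esym s13)).
  rewrite (relabel_alpha_plus u123 (erefl _) (erefl _) (erefl _)).
  exact: (alpha_plus_eq1 hM u123).
rewrite (relabel_alpha_minus u312 e312 (esym s13) (erefl _) (erefl _)).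
rewrite (relabel_alpha_minus u231 e231 (erefl _) (esym s13) (addrC (z i1) (z i3))).
rewrite (relabel_alpha_minus u123 (erefl _) (erefl _) (erefl _) (erefl _)).
exact: (alpha_minus_eq1 hM u123).
Qed.

Lemma brace_Phi p q r : uniq [:: p; q; r] -> all (fun c => (0 < c <= 3)%N) [:: p; q; r] ->
  brace (P p q r) = ev2 Phi (te (ix 2 p) (ix 2 q)) (te (ix 2 q) (ix 2 r)).
Proof.
move=> u h; rewrite /brace (subst_Phi_t3_block (T := fun i j => te i j)) //.
- by rewrite /blocksum /= !big_seq1.
- exact: vanish1_te.
by apply: all_block3; move: h; rewrite /= !andbT.
Qed.

Lemma brace_exp l : brace (ncexp (l *: tg 1 2)) = ncexp (l *: te i1 i2).
Proof.
have vt : vanish 1 (l *: tg 1 2) by apply/vanishZ/vanish_tij.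
rewrite /brace subst_exp => [|g|//]; last exact: vanish1_te.
rewrite linearZ /=; congr (ncexp (_ *: _)).
by rewrite (subst_tij (F := fun i j => te i j) (fun i j => vanish1_te k i j)) // ix21 ix22.
Qed.

End SigmaIsEll.

(** * The commutator relation of elliptic associators *)

Lemma qpi_gcomm (k : comAlgType rat) (X : finType) (R : ncseries k X -> Prop)
    (u v : ncseries k X) (w : quo R) : u [::] = 1 -> v [::] = 1 ->
  qpi R u * qpi R v = w * qpi R v * qpi R u -> qpi R (gcomm u v) = w.
Proof.
move=> hu hv h; rewrite /gcomm !qpiM h -!mulrA (mulrA (qpi R u)) qpi_mulrV // mul1r.
by rewrite qpi_mulrV // mulr1.
Qed.

Lemma conj_sqr_inverse (A : pzRingType) (x x' e e' : A) :
  inverse_pair x x' -> inverse_pair e e' -> x * (e * e) * x' * (x * (e' * e') * x') = 1.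
Proof.
move=> ix ie; rewrite !mulrA (cancelrV _ ix) -(mulrA _ e e') (proj1 ie) mulr1.
by rewrite -(mulrA _ e e') (proj1 ie) mulr1 (proj1 ix).
Qed.

Section Brace.
Variables (k : comAlgType rat).
Let vte (g : tgen 3) : vanish 1 (te (val g).1 (val g).2 : ncseries k (egen 3)).
Proof. exact: vanish1_te. Qed.
Lemma braceM (u v : ncseries k (tgen 3)) : brace (u * v) = brace u * brace v.
Proof. exact: substM. Qed.
Lemma braceV (u : ncseries k (tgen 3)) : u [::] = 1 -> brace (ncinv u) = ncinv (brace u).
Proof. exact: subst_inv. Qed.
End Brace.

Section SigmaCommutator.
Variables (k : comAlgType rat) (mu : k) (Phi : f2 k).
Hypothesis hM : is_M (MPt mu Phi).
Local Notation pi := (@qpi k (egen 3) erel).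
Local Notation E := (@EE k mu (egen 3) erel).
Local Notation F := (@FF k Phi (egen 3) erel).
Local Notation z i := (pi (zz k i)).
Local Notation t i j := (pi (te i j)).
Local Notation ex i := (pi (ncexp (xx true i))).
Local Notation Ap := (sigma_Ap (MPt mu Phi)).
Local Notation Am := (sigma_Am (MPt mu Phi)).

Local Notation tg i j := (tij (ix 2 i) (ix 2 j) : ncseries k (tgen 3)).
Local Notation P p q r := (tins 3 [:: [:: p]; [:: q]; [:: r]]%N (Phi_t3 Phi)).
Local Notation i1 := (ix 2 1).
Local Notation i2 := (ix 2 2).
Local Notation i3 := (ix 2 3).

Lemma ev2_Phi_nil (X : finType) (a b : ncseries k X) : ev2 Phi a b [::] = 1.
Proof. by rewrite ev2_nil (Phi_nil hM). Qed.

Lemma sigma_Ap_nil : Ap [::] = 1.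
Proof.
rewrite /sigma_Ap !mul_nil ?ncinv_nil ?ev2_Phi_nil ?ncexp_nil //.
by apply/vanishZ/ncsum_vanish => n; apply/vanishZ/vanish_iter_lier/vanish_xx.
Qed.

Lemma sigma_Am_nil : Am [::] = 1.
Proof.
rewrite /sigma_Am !mul_nil ?ncinv_nil ?ev2_Phi_nil ?ncexp_nil //; last exact: vanish_xx.
by apply/vanishZ/(@vanishW _ _ 1 2 _ isT (vanish_te _ _ _)).
Qed.

Lemma sigma_commutator :
  let En := ncexp (- Defs.half mu *: tg 1 2) in
  cong erel (brace (ncexp (mu *: tg 1 2)))
    (gcomm
      (ncinv (brace (P 1 2 3)%N) * eins 3 [:: [:: 1]; [:: 2; 3]]%N Am * brace (P 1 2 3)%N)
      (brace (En * ncinv (P 2 1 3)%N) * ncinv (eins 3 [:: [:: 2]; [:: 1; 3]]%N Ap)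
        * brace ((P 2 1 3)%N * En))).
Proof.
move=> En; apply/qpiP.
have u123 : uniq [:: i1; i2; i3] by rewrite ix21 ix22 ix23.
have vt : vanish 1 (tg 1 2) by apply: vanish_tij.
have nP p q r : (P p q r : ncseries k (tgen 3)) [::] = 1.
  rewrite subst_nil /Phi_t3 ev2_Phi_nil //.
rewrite !braceM braceV // !brace_Phi // !brace_exp //.
rewrite (eins_cable (p := 1) (q := 2) (r := 3)) // (eins_cable (p := 2) (q := 1) (r := 3)) //.
have vte i j : vanish 1 (te i j : ncseries k (egen 3)) by apply: vanish1_te.
have st i j : small (t i j) by apply: small_pi.
have sz i : small (z i) by apply/small_pi/vanish_zz.
have s12 : t i2 i1 = t i1 i2 by apply: q_te_sym.
have nE : ncexp (- Defs.half mu *: te i1 i2 : ncseries k (egen 3)) [::] = 1.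
  by rewrite ncexp_nil //; apply: vanishZ.
have nAp : subst (cable k i2 i1 i3) Ap [::] = 1 by rewrite subst_nil sigma_Ap_nil.
rewrite (EE_sqr mu erel (vte i1 i2)); apply/esym/qpi_gcomm.
- do 2?apply: mul_nil; [exact/ncinv_nil/ev2_Phi_nil| |exact: ev2_Phi_nil].
  by rewrite subst_nil sigma_Am_nil.
- by rewrite !mul_nil ?ncinv_nil ?ev2_Phi_nil.
have Einv : pi (ncexp (- Defs.half mu *: te i1 i2)) = E (- t i1 i2).
  by rewrite scaleNr -scalerN EE_pi ?qpiN //; apply: vanishN.
(* A_+ is a conjugate of a square of exponentials, so inverting it only changes the sign of the
   exponent. *)
have Ap_inv : pi (ncinv (subst (cable k i2 i1 i3) Ap)) =
    F (z i2) (t i1 i2 + t i2 i3) * (E (- z i2) * E (- z i2)) * F (t i1 i2 + t i2 i3) (z i2).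
  apply: (qpi_inv nAp); rewrite (cable_Ap hM (uniq3C u123)) s12.
  by apply: conj_sqr_inverse; [apply: (FF_inverse hM)|apply: EE_inverse].
apply: (commutator_eq1 hM u123).
  by rewrite !qpiM (FF_inv hM) // FF_pi // (cable_Am hM u123) !mulrA.
have eP : pi (ev2 Phi (te i2 i1) (te i1 i3)) = F (t i1 i2) (t i1 i3).
  rewrite (FF_pi _ _ (vte _ _) (vte _ _)); exact: (congr1 (F^~ _) s12).
have eP' : pi (ncinv (ev2 Phi (te i2 i1) (te i1 i3))) = F (t i1 i3) (t i1 i2).
  rewrite (FF_inv hM _ (vte _ _) (vte _ _)); exact: (congr1 (F _) s12).
rewrite 4!qpiM.
apply: etrans (congr2 *%R (congr2 *%R (congr2 *%R Einv eP') Ap_inv) (congr2 *%R eP Einv)) _.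
have assoc8 (A : pzRingType) (x1 x2 x3 x4 x5 x6 x7 x8 : A) :
  x1 * x2 * (x3 * (x4 * x5) * x6) * (x7 * x8) = x1 * x2 * x3 * x4 * x5 * x6 * x7 * x8.
  by rewrite !mulrA.
exact: assoc8.
Qed.

End SigmaCommutator.

(** * Logarithms, powers and evaluation of elements of F_2(k) *)

Lemma log_subst1 (k : comAlgType rat) (X : finType) (u : ncseries k X) : u [::] = 1 ->
  nclog u = subst (fun=> u - 1) (nclog (1 + letter k tt)).
Proof.
move=> /vanish_sub1P hu; have hs (_ : unit) : vanish 1 (u - 1) := hu.
rewrite (subst_log hs); last first.
  apply/vanish_sub1P; rewrite [1 + _]addrC addrK; exact: vanish_letter.
by rewrite linearD /= (subst1 hs) (subst_letter hs) addrC subrK.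
Qed.

Lemma subst_letters (k : comAlgType rat) (X : finType) (a : ncseries k X) :
  subst (fun x => letter k x) a = a.
Proof.
have hl (x : X) : vanish 1 (letter k x) by apply: vanish_letter.
move: a; apply: series_ind => [|l w a IH|a h]; first exact: linear0.
  by rewrite linearP /= IH subst_nword // nword_prod.
apply/eqP; rewrite -subr_eq0; apply/eqP/series_eq => N; rewrite subr0.
have [b hb ab] := h N; have -> : subst (fun x => letter k x) a - a =
    subst (fun x => letter k x) (a - b) - (a - b).
  by rewrite linearB /= hb opprB addrA subrK.
exact: vanishB (subst_vanish _ ab) ab.
Qed.

Section GroupIntertwine.
Variables (k : comAlgType rat) (X : finType) (R : ncseries k X -> Prop).
Local Notation pi := (@qpi k X R).
Implicit Types (u v : ncseries k X) (h : quo R).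

Lemma log_intertwine h u u' : u [::] = 1 -> u' [::] = 1 ->
  h * pi u = pi u' * h -> h * pi (nclog u) = pi (nclog u') * h.
Proof.
move=> hu hu' e; rewrite (log_subst1 hu) (log_subst1 hu'); apply: subst_intertwine => _; do ?exact/vanish_sub1P.
by rewrite !qpiB qpi1 mulrBr mulrBl e mulr1 mul1r.
Qed.

Lemma pow_intertwine h u u' l : u [::] = 1 -> u' [::] = 1 ->
  h * pi u = pi u' * h -> h * pi (ncpow u l) = pi (ncpow u' l) * h.
Proof.
move=> hu hu' e; apply: exp_intertwine; do ?exact/vanishZ/vanish_log.
by rewrite !qpiZ -(qscaleAr _ h) (log_intertwine hu hu' e) qscaleAl.
Qed.

Lemma gev2_intertwine h f u v u' v' : u [::] = 1 -> v [::] = 1 -> u' [::] = 1 -> v' [::] = 1 ->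
  h * pi u = pi u' * h -> h * pi v = pi v' * h ->
  h * pi (gev2 f u v) = pi (gev2 f u' v') * h.
Proof.
move=> hu hv hu' hv' eu ev; apply: ev2_intertwine; do ?exact: vanish_log.
  exact: log_intertwine.
exact: log_intertwine.
Qed.

Lemma qpi_pow u u' l : u [::] = 1 -> u' [::] = 1 -> pi u = pi u' ->
  pi (ncpow u l) = pi (ncpow u' l).
Proof.
move=> hu hu' e; rewrite -[LHS]mul1r -[RHS]mulr1; apply: pow_intertwine => //.
by rewrite mulr1 mul1r.
Qed.

End GroupIntertwine.

Section GroupSubst.
Variables (k : comAlgType rat) (X : finType).
Implicit Types (u v : ncseries k X) (f g : f2 k).

Lemma gev2_nil f u v : gev2 f u v [::] = f [::].
Proof. exact: ev2_nil. Qed.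

Lemma subst_gev2 (Y : finType) (s : X -> ncseries k Y) f u v :
  (forall x, vanish 1 (s x)) -> u [::] = 1 -> v [::] = 1 ->
  subst s (gev2 f u v) = gev2 f (subst s u) (subst s v).
Proof.
move=> hs hu hv; rewrite /gev2 (subst_ev2 _ hs (vanish_log hu) (vanish_log hv)).
by rewrite !subst_log.
Qed.

End GroupSubst.

Section Evaluation.
Variables (k : comAlgType rat) (X : finType).
Implicit Types (f g : f2 k).
Variables (u v : ncseries k X).
Hypotheses (hu : u [::] = 1) (hv : v [::] = 1).
Let s (c : bool) := if c then nclog v else nclog u.
Let hs c : vanish 1 (s c). Proof. by rewrite /s; case: c; apply: vanish_log. Qed.
Let grX1 : grX [::] = 1 :> k. Proof. exact/ncexp_nil/vanish_letter. Qed.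
Let grY1 : grY [::] = 1 :> k. Proof. exact/ncexp_nil/vanish_letter. Qed.

Lemma gev2_X : gev2 grX u v = u.
Proof. by rewrite /gev2 /ev2 subst_exp ?subst_letter ?ncexp_log //; apply: vanish_letter. Qed.
Lemma gev2_Y : gev2 grY u v = v.
Proof. by rewrite /gev2 /ev2 subst_exp ?subst_letter ?ncexp_log //; apply: vanish_letter. Qed.
Lemma gev2M f g : gev2 (f * g) u v = gev2 f u v * gev2 g u v.
Proof. exact: substM. Qed.
Lemma gev2V f : f [::] = 1 -> gev2 (ncinv f) u v = ncinv (gev2 f u v).
Proof. exact: subst_inv. Qed.
Lemma gev2_pow f l : f [::] = 1 -> gev2 (ncpow f l) u v = ncpow (gev2 f u v) l.
Proof. exact: subst_pow. Qed.
Lemma gev2_comp f g1 g2 : g1 [::] = 1 -> g2 [::] = 1 ->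
  gev2 (gev2 f g1 g2) u v = gev2 f (gev2 g1 u v) (gev2 g2 u v).
Proof. exact: subst_gev2. Qed.

End Evaluation.

(** * Effect of the GT action on A_+ and A_- *)

Section ConjugationWords.
Variable A : pzRingType.

Lemma conj_inverse_words (h ex ex' p p' e' em am am' ap' : A) :
  inverse_pair ex ex' -> inverse_pair p p' -> inverse_pair am am' ->
  am = h * ex * p' -> ap' = p * em * p' -> ex * em = e' * ex ->
  h * e' = am * ap' * am' * h.
Proof.
move=> ie ip iam eam eap eex.
have ir := inverse_pairM ie (inverse_pair_sym ip).
apply: (mulIr_inverse ir); rewrite -!mulrA (mulrA h ex) -eam (proj2 iam) mulr1 eam eap.
by rewrite -!mulrA (cancellV _ ip) (mulrA ex) eex !mulrA.
Qed.

Lemma conj_comm_words (e p p' w : A) : p * p' = 1 -> e * w = w * e ->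
  e * p * (p' * w * p) = w * (e * p).
Proof. by move=> hp ew; rewrite !mulrA -(mulrA e) hp mulr1 ew. Qed.

Lemma gauge_words (s e p g k ex p' gi am : A) :
  am = e * p * ex * p' -> (e * p) * g = k * (e * p) ->
  s * e * (p * g) * ex * (p' * gi) = s * k * am * gi.
Proof.
move=> -> h; rewrite !mulrA -(mulrA s) -(mulrA s (e * p)) h !mulrA.
by [].
Qed.

End ConjugationWords.

Section GTCompatibility.
Variables (k : comAlgType rat) (X : finType) (R : ncseries k X -> Prop).
Local Notation pi := (@qpi k X R).
Variables (lam mu : k) (f Phi : f2 k).
Hypotheses (f0 : f [::] = 1) (Phi0 : Phi [::] = 1).
Variables a a' t t' x : ncseries k X.
Hypotheses (va : vanish 1 a) (va' : vanish 1 a') (vt : vanish 1 t) (vt' : vanish 1 t')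
  (vx : vanish 1 x).

(** The shape of A_+, and of A_- below, with a, a', t, t', x for z_12, z_21, t_12, t_21, x_1. The
    parameter and the associator vary, so the same formula serves before and after the action. *)
Definition conj_Ap (l : k) (P : f2 k) :=
  ev2 P a t * ncexp (l *: a) * ncinv (ev2 P a t).
Definition conj_Am (l : k) (P : f2 k) :=
  ncexp (Defs.half l *: t) * ev2 P a' t' * ncexp x * ncinv (ev2 P a t).
Local Notation Ap := (conj_Ap mu Phi).
Local Notation Am := (conj_Am mu Phi).
Local Notation Phi' := (Phi * gev2 f (ncexp (mu *: serA)) (ncinv Phi * ncexp (mu *: serB) * Phi)).

Hypothesis ett : pi t' = pi t.
Hypothesis exa : pi (ncexp x) * pi a = - pi a' * pi (ncexp x).
Hypothesis hC : pi (gcomm Am Ap) = pi (ncexp (mu *: t)).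

Let nev (h : f2 k) u v : h [::] = 1 -> (ev2 h u v : ncseries k X) [::] = 1.
Proof. by move=> h0; rewrite ev2_nil. Qed.
Let ne (l : k) u : vanish 1 u -> (ncexp (l *: u) : ncseries k X) [::] = 1.
Proof. by move=> hu; apply/ncexp_nil/vanishZ. Qed.

Lemma ev2_GT_act (u v : ncseries k X) : vanish 1 u -> vanish 1 v ->
  ev2 Phi' u v = ev2 Phi u v *
    gev2 f (ncexp (mu *: u)) (ncinv (ev2 Phi u v) * ncexp (mu *: v) * ev2 Phi u v).
Proof.
move=> hu hv; pose s (c : bool) := if c then v else u.
have hs c : vanish 1 (s c) by case: c.
have vl (c : bool) : vanish 1 (letter k c) by apply: vanish_letter.
have vml (c : bool) : vanish 1 (mu *: letter k c) by apply: vanishZ.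
have e c : subst s (ncexp (mu *: letter k c)) = ncexp (mu *: s c).
  by rewrite (subst_exp hs (vml c)) linearZ /= (subst_letter hs).
rewrite /ev2 -/s (substM hs) (subst_gev2 _ hs); last 2 first.
- exact: ncexp_nil (vml false).
- by do 2?apply: mul_nil => //; [apply: ncinv_nil|apply: ncexp_nil (vml true)].
by rewrite 2!(substM hs) (subst_inv hs Phi0) (e false) (e true).
Qed.

Let Ap0 : Ap [::] = 1.
Proof. by apply: mul_nil; [apply: mul_nil; [exact: nev|exact: ne]|apply/ncinv_nil/nev]. Qed.
Let Am0 : Am [::] = 1.
Proof.
apply: mul_nil; last exact/ncinv_nil/nev.
by do 2?apply: mul_nil; [exact: ne|exact: nev|exact: ncexp_nil].
Qed.
Let C := gcomm Am Ap.
Let C0 : C [::] = 1.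
Proof. exact: mul_nil (mul_nil (mul_nil Am0 Ap0) (ncinv_nil Am0)) (ncinv_nil Ap0). Qed.

Let p1 := ev2 Phi a t.
Let p2 := ev2 Phi a' t'.
Let G := gev2 f Ap C.
Let K := gev2 f (Am * ncinv Ap * ncinv Am) C.
Let G0 : G [::] = 1. Proof. by rewrite gev2_nil. Qed.

Let p1V : pi (ncinv p1) * pi p1 = 1. Proof. exact/qpi_mulV/nev. Qed.
Let Vp1 : pi p1 * pi (ncinv p1) = 1. Proof. exact/qpi_mulrV/nev. Qed.
Let Vp2 : pi p2 * pi (ncinv p2) = 1. Proof. exact/qpi_mulrV/nev. Qed.

Let Vp1r y : y * pi (ncinv p1) * pi p1 = y. Proof. by rewrite -mulrA p1V mulr1. Qed.
Let Ap_conj : pi p1 * pi (ncexp (mu *: a)) = pi Ap * pi p1.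
Proof. by rewrite /conj_Ap -/p1 2!qpiM Vp1r. Qed.

(** Conjugation by Phi(a, t) takes e^{mu a} to A_+ by definition, and Phi^{-1} e^{mu t} Phi to e^{mu
    t} = C; hence it takes the value of f on the first pair to f(A_+, C). *)
Let key1 : pi (ev2 Phi' a t) = pi G * pi p1.
Proof.
rewrite (ev2_GT_act va vt) qpiM; apply: gev2_intertwine Ap_conj _.
- exact: ne.
- exact: mul_nil (mul_nil (ncinv_nil (nev _ _ Phi0)) (ne _ vt)) (nev _ _ Phi0).
- exact: Ap0.
- exact: C0.
by rewrite 2!qpiM !mulrA Vp1 mul1r hC.
Qed.

Let key1V : pi (ncinv (ev2 Phi' a t)) = pi (ncinv p1) * pi (ncinv G).
Proof.
apply: qpi_inv; first by apply/nev/mul_nil => //; rewrite gev2_nil.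
by rewrite key1 mulrA -(mulrA (pi G)) Vp1 mulr1 qpi_mulrV.
Qed.

Lemma GT_compat_plus :
  pi (conj_Ap (lam * mu) Phi') =
  pi (gev2 f Ap C * ncpow Ap lam * ncinv (gev2 f Ap C)).
Proof.
rewrite /conj_Ap 2!qpiM key1 key1V 2!qpiM -/G !mulrA; congr (_ * _).
have := pow_intertwine lam (ne _ va) Ap0 Ap_conj.
rewrite ncpow_exp ?scalerA; last exact: vanishZ.
by rewrite -(mulrA (pi G)) => ->; rewrite mulrA -(mulrA _ (pi p1)) Vp1 mulr1.
Qed.

Let exp_scaleD l m : ncexp (l *: t) * ncexp (m *: t) = ncexp ((l + m) *: t).
Proof.
rewrite scalerDl ncexpD //; do ?exact: vanishZ.
by rewrite -!scalerAl -!scalerAr !scalerA mulrC.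
Qed.

Local Notation E := (pi (ncexp (Defs.half mu *: t))).
Local Notation ex := (pi (ncexp x)).
Let h := E * pi p2.

Let piAm : pi Am = h * ex * pi (ncinv p1).
Proof. by rewrite /conj_Am 3!qpiM. Qed.

Let a_neg : vanish 1 (- (mu *: a)). Proof. exact/vanishN/vanishZ. Qed.

Let piApV : pi (ncinv Ap) = pi p1 * pi (ncexp (- (mu *: a))) * pi (ncinv p1).
Proof.
apply: (qpi_inv Ap0); rewrite -(mulrA (pi p1)) mulrA -Ap_conj mulrA -(mulrA (pi p1)).
by rewrite qpi_expN ?mulr1 ?Vp1 //; apply: vanishZ.
Qed.

Let ex_exp : ex * pi (ncexp (- (mu *: a))) = pi (ncexp (mu *: a')) * ex.
Proof.
apply: exp_intertwine; [exact: a_neg|exact: vanishZ|].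
by rewrite qpiN mulrN !qpiZ -qscaleAr exa mulNr scalerN opprK qscaleAl.
Qed.

(** A_- = h e^x Phi(a, t)^{-1}, so A_- A_+^{-1} A_-^{-1} is e^{-mu a} conjugated by h e^x; and e^x
    conjugates -a to a'. *)
Let h_a' : h * pi (ncexp (mu *: a')) = pi (Am * ncinv Ap * ncinv Am) * h.
Proof.
rewrite 2!qpiM; apply: conj_inverse_words piAm piApV ex_exp.
- by split; [apply: qpi_expN|apply: qpi_Nexp].
- by split; [exact: Vp1|exact: p1V].
- by split; [exact: qpi_mulrV|exact: qpi_mulV].
Qed.

Let key2 : h * pi (gev2 f (ncexp (mu *: a')) (ncinv p2 * ncexp (mu *: t') * p2)) = pi K * h.
Proof.
apply: gev2_intertwine h_a' _.
- exact: ne.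
- exact: mul_nil (mul_nil (ncinv_nil (nev _ _ Phi0)) (ne _ vt')) (nev _ _ Phi0).
- exact: mul_nil (mul_nil Am0 (ncinv_nil Ap0)) (ncinv_nil Am0).
- exact: C0.
have et : pi (ncexp (mu *: t')) = pi (ncexp (mu *: t)).
  by apply: qpi_exp; [exact: vanishZ|exact: vanishZ|rewrite !qpiZ ett].
rewrite hC 2!qpiM et; apply: conj_comm_words Vp2 _.
by rewrite -!qpiM !exp_scaleD [_ + mu]addrC.
Qed.

Lemma GT_compat_minus :
  pi (conj_Am (lam * mu) Phi') =
  pi (ncpow C (Defs.half (lam - 1)) * gev2 f (Am * ncinv Ap * ncinv Am) C * Am *
       ncinv (gev2 f Ap C)).
Proof.
(* This splitting of the exponent is the origin of the factor (Y, X)^{(lambda - 1)/2} in s. *)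
have eh : Defs.half (lam * mu) = Defs.half (lam - 1) * mu + Defs.half mu.
  by rewrite /Defs.half -scalerAl -scalerDr mulrBl mul1r subrK.
have eC : pi (ncpow C (Defs.half (lam - 1))) = pi (ncexp ((Defs.half (lam - 1) * mu) *: t)).
  rewrite (qpi_pow _ C0 (ne mu vt) hC) ncpow_exp ?scalerA //; exact: vanishZ.
rewrite [X in pi X = _]/conj_Am eh -exp_scaleD (ev2_GT_act va' vt') 5!qpiM key1V 3!qpiM eC.
exact: gauge_words piAm key2.
Qed.
End GTCompatibility.

(** * The commutator of A_- and A_+ in t_{1,2} *)

Lemma gcomm_words (A : pzRingType) (e e' ez r r' g g' w x : A) :
  inverse_pair e e' -> inverse_pair r r' -> inverse_pair g g' ->
  e * r * ez * ez * r' = g * w * w * g' * e' -> x * ez = w * x ->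
  e * g * x * r' * (r * (ez * ez) * r') =
    e * e * (r * (ez * ez) * r') * (e * g * x * r').
Proof.
move=> ie ir ig tw hx; rewrite !mulrA (cancelrV _ ir).
have -> : e * e * r * ez * ez * r' * e = e * (e * r * ez * ez * r' * e) by rewrite !mulrA.
rewrite tw (cancelrV _ ie) !mulrA (cancelrV _ ig) -(mulrA _ x) hx !mulrA.
by rewrite -(mulrA _ x ez) hx !mulrA.
Qed.

Section SigmaCommutes.
Variables (k : comAlgType rat) (mu : k) (Phi : f2 k).
Hypothesis hM : is_M (MPt mu Phi).
Variables (X : finType) (R : ncseries k X -> Prop).
Local Notation pi := (@qpi k X R).
Local Notation E := (@EE k mu X R).
Local Notation F := (@FF k Phi X R).

Lemma EE0 : E 0 = 1.
Proof.
have v0 : vanish 1 (0 : ncseries k X) by apply: vanish_zero.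
by rewrite -(qpi0 R) -EE_pi // scaler0 ncexp0 qpi1.
Qed.

(** With z' = -(z + t), the elements z, z', t add up to zero and form a t_3 triangle with trivial
    full twist. The twist identity then trades e^{mu z} for e^{-mu z'}, and x conjugates z to
    -z'. *)
Lemma FF_EE_commute (z t : quo R) (x : quo R) : small z -> small t ->
  x * z = (z + t) * x ->
  E t * F (- (z + t)) t * x * F t z * (F z t * (E z * E z) * F t z) =
  E t * E t * (F z t * (E z * E z) * F t z) * (E t * F (- (z + t)) t * x * F t z).
Proof.
move=> sz st hx; have [z' dz'] : exists z', z' = - (z + t) by exists (- (z + t)).
rewrite -dz'.
have sz' : small z' by rewrite dz'; apply/smallN/smallD.
have tot : z + z' + t = 0 by rewrite dz' opprD addrA subrr sub0r addNr.
have tot' : z + t + z' = 0 by rewrite dz' subrr.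
have l1 : lie z (t + z') = 0 by rewrite dz' opprD addrC addrNK lieNr lie_self oppr0.
have l2 : lie t (z + z') = 0 by rewrite dz' opprD addrA subrr sub0r lieNr lie_self oppr0.
have l3 : lie z' (z + t) = 0 by rewrite dz' lieNl lie_self oppr0.
apply: (gcomm_words (e' := E (- t)) (g' := F t z') (w := E (- z')));
  do ?[exact: (EE_inverse mu) | exact: (FF_inverse hM)].
- have tw : E t * F z t * E z * E z * F t z =
      1 * 1 * F z' t * E (- z') * E (- z') * F t z' * E (- t).
    apply: (twist (f2 := F z' z) (f2' := F z z'));
      do ?[exact: (EE_inverse mu) | exact: (FF_inverse hM)].
    + by rewrite -EE0 -tot; apply: (FF_hexagon hM).
    + by rewrite -EE0 -tot'; apply: (FF_hexagon hM) => //; rewrite addrC.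
    + by rewrite mul1r mulr1.
    by rewrite mul1r mulr1.
  have e1 (A : pzRingType) (u1 u2 u3 u4 u5 : A) :
    1 * 1 * u1 * u2 * u3 * u4 * u5 = u1 * u2 * u3 * u4 * u5 by rewrite !mul1r.
  rewrite tw.
  exact: e1.
apply: EE_intertwine => //; first exact: smallN.
by rewrite dz' opprK.
Qed.

Variables x1 x2 y1 y2 : ncseries k X.
Hypotheses (vx1 : vanish 1 x1) (vx2 : vanish 1 x2) (vy1 : vanish 1 y1) (vy2 : vanish 1 y2).
Hypotheses (ex : pi x2 = - pi x1) (ey : pi y1 = - pi y2).
Local Notation Ap := (conj_Ap (todd_ad x1 y2) (lie x1 y2) mu Phi).
Local Notation Am := (conj_Am (todd_ad x1 y2) (todd_ad x2 y1) (lie x1 y2) (lie x2 y1) x1 mu Phi).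

(** This evaluates (Y, X) at (A_+, A_-), which is how the elliptic formulas of s see the exponential
    e^{mu t_12} occurring in the action on Phi. *)
Lemma sigma_gcomm : pi (gcomm Am Ap) = pi (ncexp (mu *: lie x1 y2)).
Proof.
have vt u v : vanish 1 u -> vanish 1 v -> vanish 1 (lie u v : ncseries k X).
  by move=> hu hv; apply: (@vanish_lie _ _ 0 1).
have vz u v : vanish 1 u -> vanish 1 v -> vanish 1 (todd_ad u v : ncseries k X).
  by move=> hu hv; apply: ncsum_vanish => n; apply/vanishZ/vanish_iter_lier.
have Phi0 (u v : ncseries k X) : ev2 Phi u v [::] = 1 by apply: (ev2_Phi_nil hM).
have Ap0 : Ap [::] = 1.
  exact: mul_nil (mul_nil (Phi0 _ _) (ncexp_nil (vanishZ _ (vz _ _ vx1 vy2)))) (ncinv_nil (Phi0 _ _)).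
have Am0 : Am [::] = 1.
  exact: mul_nil (mul_nil (mul_nil (ncexp_nil (vanishZ _ (vt _ _ vx1 vy2))) (Phi0 _ _))
    (ncexp_nil vx1)) (ncinv_nil (Phi0 _ _)).
apply: (qpi_gcomm Am0 Ap0).
rewrite [pi Ap](sigma_Ap_value hM R x1 vy2) [pi Am](sigma_Am_value hM vx1 vx2 vy1 vy2 ex ey).
rewrite (EE_sqr mu R (vt _ _ vx1 vy2)).
apply: FF_EE_commute; [exact/small_pi/vz|exact/small_pi/vt|].
by rewrite (exp_todd_conj R y2 vx1) (qpi_lie R).
Qed.

End SigmaCommutes.

(** * Naturality in the base ring *)

Section BaseChange.
Variables (k k' : comAlgType rat) (phi : {rmorphism k -> k'}).

(** Additive maps between Q-vector spaces are Q-linear, so a ring morphism preserves all rational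
    coefficients in the formulas. *)
Lemma rmorph_rat (q : rat) : phi q%:A = q%:A.
Proof. by rewrite (rat_linear (rmorphB phi)) rmorph1. Qed.

Lemma rmorph_half (l : k) : phi (Defs.half l) = Defs.half (phi l).
Proof. exact: (rat_linear (rmorphB phi)). Qed.

Section OneAlphabet.
Variable X : finType.
Local Notation N := (@ncmap k k' X phi).
Implicit Types a b : ncseries k X.

Lemma ncmapD a b : N (a + b) = N a + N b.
Proof. by apply: ncseriesP => w /=; rewrite rmorphD. Qed.
Lemma ncmapN a : N (- a) = - N a.
Proof. by apply: ncseriesP => w /=; rewrite rmorphN. Qed.
Lemma ncmap1 : N 1 = 1.
Proof. by apply: ncseriesP => w /=; rewrite rmorph_nat. Qed.
Lemma ncmap0 : N 0 = 0.
Proof. by apply: ncseriesP => w /=; rewrite rmorph0. Qed.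
Lemma ncmapM a b : N (a * b) = N a * N b.
Proof.
apply: ncseriesP => w /=; rewrite rmorph_sum; apply: eq_bigr => i _ /=.
by rewrite rmorphM.
Qed.
Lemma ncmapZ l a : N (l *: a) = phi l *: N a.
Proof. by apply: ncseriesP => w /=; rewrite rmorphM. Qed.
Lemma ncmapX a n : N (a ^+ n) = N a ^+ n.
Proof. by elim: n => [|n IH]; rewrite ?expr0 ?ncmap1 // !exprS ncmapM IH. Qed.
Lemma ncmap_letter x : N (letter k x) = letter k' x.
Proof. by apply: ncseriesP => w /=; rewrite rmorph_nat. Qed.
Lemma ncmap_ncsum u : N (ncsum u) = ncsum (fun n => N (u n)).
Proof. by apply: ncseriesP => w /=; rewrite rmorph_sum. Qed.
Lemma ncmap_exp a : N (ncexp a) = ncexp (N a).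
Proof.
rewrite ncmap_ncsum; apply: eq_ncsum => n.
by rewrite ncmapZ ncmapX rmorph_rat.
Qed.
Lemma ncmap_inv a : N (ncinv a) = ncinv (N a).
Proof.
rewrite ncmap_ncsum; apply: eq_ncsum => n.
by rewrite ncmapX ncmapD ncmapN ncmap1.
Qed.
Lemma ncmap_lie a b : N (lie a b) = lie (N a) (N b).
Proof. by rewrite /lie ncmapD ncmapN !ncmapM. Qed.
Lemma ncmap_todd a b : N (todd_ad a b) = todd_ad (N a) (N b).
Proof.
rewrite ncmap_ncsum; apply: eq_ncsum => n; rewrite ncmapZ rmorph_rat; congr (_ *: _).
by elim: n => //= n IH; rewrite ncmap_lie IH.
Qed.

End OneAlphabet.

Lemma ncmap_subst (X Y : finType) (s : X -> ncseries k Y) a :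
  ncmap phi (subst s a) = subst (fun x => ncmap phi (s x)) (ncmap phi a).
Proof.
rewrite ncmap_ncsum; apply: eq_ncsum => n.
rewrite (big_morph _ (@ncmapD Y) (ncmap0 Y)); apply: eq_bigr => t _.
by rewrite ncmapZ (big_morph _ (@ncmapM Y) (ncmap1 Y)).
Qed.

Lemma ncmap_ev2 (X : finType) (Phi : f2 k) (a b : ncseries k X) :
  ncmap phi (ev2 Phi a b) = ev2 (ncmap phi Phi) (ncmap phi a) (ncmap phi b).
Proof. by rewrite /ev2 ncmap_subst; apply: eq_subst; case. Qed.

Lemma ncmap_xx n e (i : 'I_n) : ncmap phi (xx e i) = xx e i.
Proof. exact: ncmap_letter. Qed.
Lemma ncmap_te n (i j : 'I_n) : ncmap phi (te i j) = te i j.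
Proof. by rewrite /te ncmap_lie !ncmap_xx. Qed.

Lemma ncmap_sigma_Ap (m : pt M k) :
  sigma_Ap (base_change M phi m) = ncmap phi (sigma_Ap m).
Proof.
by rewrite /sigma_Ap /= !ncmapM ncmap_inv ncmap_ev2 ncmap_exp ncmapZ ncmap_todd !ncmap_xx ncmap_te.
Qed.

Lemma ncmap_sigma_Am (m : pt M k) :
  sigma_Am (base_change M phi m) = ncmap phi (sigma_Am m).
Proof.
rewrite /sigma_Am 3!ncmapM ncmap_inv; congr (_ * _ * _ * ncinv _).
- by rewrite ncmap_exp ncmapZ rmorph_half ncmap_te.
- by rewrite ncmap_ev2 ncmap_todd !ncmap_xx ncmap_te.
- by rewrite ncmap_exp ncmap_xx.
by rewrite ncmap_ev2 ncmap_todd !ncmap_xx ncmap_te.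
Qed.

End BaseChange.

(** * The formula lands in Ell and intertwines the actions *)

Lemma is_lie_exp_ev2 (k : comAlgType rat) (X : finType) (f : f2 k) (a b : ncseries k X) :
  is_lie_exp f -> lie_series a -> lie_series b -> is_lie_exp (ev2 f a b).
Proof. by move=> hf ha hb; apply: is_lie_exp_subst hf; case. Qed.

Section SigmaPoint.
Variables (k : comAlgType rat) (mu : k) (Phi : f2 k).
Hypothesis hM : is_M (MPt mu Phi).
Local Notation Ap := (sigma_Ap (MPt mu Phi)).
Local Notation Am := (sigma_Am (MPt mu Phi)).

Let lx e (i : 'I_2) : lie_series (xx e i : ncseries k (egen 2)).
Proof. exact: lie_series_letter. Qed.
Let lt (i j : 'I_2) : lie_series (te i j : ncseries k (egen 2)).
Proof. exact: lie_series_lie. Qed.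
Let lz (i j : 'I_2) : lie_series (todd_ad (xx true i) (xx false j) : ncseries k (egen 2)).
Proof. exact: lie_series_todd. Qed.
Let lPhi (a b : ncseries k (egen 2)) : lie_series a -> lie_series b -> is_lie_exp (ev2 Phi a b).
Proof. exact: is_lie_exp_ev2 (is_lie_exp_Phi hM). Qed.

Lemma is_lie_exp_sigma_Ap : is_lie_exp Ap.
Proof.
apply: is_lie_expM; last exact/is_lie_expV/lPhi.
by apply: is_lie_expM; [apply: lPhi|apply/is_lie_exp_ncexp/lie_seriesZ/lz].
Qed.

Lemma is_lie_exp_sigma_Am : is_lie_exp Am.
Proof.
apply: is_lie_expM; last exact/is_lie_expV/lPhi.
apply: is_lie_expM; last exact: is_lie_exp_ncexp.
by apply: is_lie_expM; [apply/is_lie_exp_ncexp/lie_seriesZ/lt|apply: lPhi].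
Qed.

Lemma sigma_is_Ell : is_Ell (sigma_formula (MPt mu Phi)).
Proof.
split.
- exact: hM.
- by split; [apply: is_lie_exp_sigma_Ap|apply: is_lie_exp_sigma_Am].
- by move=> e; apply: (sigma_alpha hM).
- exact: (sigma_commutator hM).
Qed.

End SigmaPoint.

Section GTellValues.
Variables (k : comAlgType rat) (lam : k) (f : f2 k) (X : finType) (u v : ncseries k X).
Hypotheses (f0 : f [::] = 1) (u0 : u [::] = 1) (v0 : v [::] = 1).
Let YX : f2 k := gcomm grY grX.
Let gX0 : (grX : f2 k) [::] = 1. Proof. exact/ncexp_nil/vanish_letter. Qed.
Let gY0 : (grY : f2 k) [::] = 1. Proof. exact/ncexp_nil/vanish_letter. Qed.
Let YX0 : YX [::] = 1.
Proof. exact: mul_nil (mul_nil (mul_nil gY0 gX0) (ncinv_nil gY0)) (ncinv_nil gX0). Qed.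
Let vYX : gev2 YX u v = gcomm v u.
Proof.
have hs (c : bool) : vanish 1 (if c then nclog v else nclog u).
  by case: c; apply: vanish_log.
exact: etrans (subst_gcomm hs gY0 gX0) (congr2 (@gcomm k X) (gev2_Y u0 v0) (gev2_X u0 v0)).
Qed.
Let fYX0 (g : f2 k) : g [::] = 1 -> gev2 f g YX [::] = 1. Proof. by move=> g0; rewrite gev2_nil. Qed.

Lemma GTell_gp_value : gev2 (GTell_gp (GT_to_GTell (GTPt lam f))) u v =
  gev2 f u (gcomm v u) * ncpow u lam * ncinv (gev2 f u (gcomm v u)).
Proof.
rewrite /= 2!(gev2M u0 v0) (gev2V u0 v0 (fYX0 gX0)) (gev2_pow u0 v0 _ gX0).
by rewrite (gev2_comp u0 v0 _ gX0 YX0) vYX (gev2_X u0 v0).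
Qed.

Lemma GTell_gm_value : gev2 (GTell_gm (GT_to_GTell (GTPt lam f))) u v =
  ncpow (gcomm v u) (Defs.half (lam - 1)) *
    gev2 f (v * ncinv u * ncinv v) (gcomm v u) * v * ncinv (gev2 f u (gcomm v u)).
Proof.
have gYXY0 : (grY * ncinv grX * ncinv grY : f2 k) [::] = 1.
  exact: mul_nil (mul_nil gY0 (ncinv_nil gX0)) (ncinv_nil gY0).
rewrite /=.
have eYXY : gev2 (grY * ncinv grX * ncinv grY) u v = v * ncinv u * ncinv v.
  have eX : gev2 (ncinv grX) u v = ncinv u.
    exact: etrans (gev2V u0 v0 gX0) (congr1 (@ncinv k X) (gev2_X u0 v0)).
  have eY : gev2 (ncinv grY) u v = ncinv v.
    exact: etrans (gev2V u0 v0 gY0) (congr1 (@ncinv k X) (gev2_Y u0 v0)).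
  exact: etrans (gev2M u0 v0 _ _) (congr2 *%R
    (etrans (gev2M u0 v0 _ _) (congr2 *%R (gev2_Y u0 v0) eX)) eY).
have e1 : gev2 (ncpow YX (Defs.half (lam - 1))) u v =
    ncpow (gcomm v u) (Defs.half (lam - 1)).
  exact: etrans (gev2_pow u0 v0 _ YX0) (congr1 (@ncpow k X ^~ _) vYX).
have e2 := etrans (gev2_comp u0 v0 f gYXY0 YX0) (congr2 (gev2 f) eYXY vYX).
have e4 := etrans (gev2V u0 v0 (fYX0 gX0)) (congr1 (@ncinv k X)
  (etrans (gev2_comp u0 v0 f gX0 YX0) (congr2 (gev2 f) (gev2_X u0 v0) vYX))).
apply: etrans (gev2M u0 v0 _ _) (congr2 *%R _ e4).
apply: etrans (gev2M u0 v0 _ _) (congr2 *%R _ (gev2_Y u0 v0)).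
exact: etrans (gev2M u0 v0 _ _) (congr2 *%R e1 e2).
Qed.

End GTellValues.

Section GTPoint.
Variables (k : comAlgType rat) (lam mu : k) (f Phi : f2 k).
Hypothesis hM : is_M (MPt mu Phi).
Hypothesis hf : is_lie_exp f.
Local Notation pi := (@qpi k (egen 2) erel).
Local Notation Ap := (sigma_Ap (MPt mu Phi)).
Local Notation Am := (sigma_Am (MPt mu Phi)).
Local Notation x i := (xx true (ix 1 i) : ncseries k (egen 2)).
Local Notation y i := (xx false (ix 1 i) : ncseries k (egen 2)).

Lemma qpi_xx2 e : pi (xx e (ix 1 1)) + pi (xx e (ix 1 2)) = 0.
Proof.
rewrite -(qsum_xx k 2 e) big_ord_recl big_ord1; congr (pi (xx e _) + pi (xx e _)).
  by apply: val_inj; rewrite /= inordK.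
by apply: val_inj; rewrite /= inordK.
Qed.

Let f0 : f [::] = 1. Proof. exact: is_lie_exp_nil hf. Qed.
Let Phi0 : Phi [::] = 1. Proof. exact: Phi_nil hM. Qed.
Let vx e i : vanish 1 (xx e i : ncseries k (egen 2)). Proof. exact: vanish_xx. Qed.
Let vt i j : vanish 1 (te i j : ncseries k (egen 2)).
Proof. exact: (@vanishW _ _ 1 2 _ isT (vanish_te _ _ _)). Qed.
Let vz i j : vanish 1 (todd_ad (xx true i) (xx false j) : ncseries k (egen 2)).
Proof. by apply: ncsum_vanish => n; apply/vanishZ/vanish_iter_lier. Qed.
Let ex : pi (x 2) = - pi (x 1).
Proof. by apply/eqP; rewrite -addr_eq0 addrC qpi_xx2. Qed.
Let ey : pi (y 1) = - pi (y 2).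
Proof. by apply/eqP; rewrite -addr_eq0 qpi_xx2. Qed.
Let et : pi (te (ix 1 2) (ix 1 1)) = pi (te (ix 1 1) (ix 1 2)). Proof. exact: q_te_sym. Qed.
Let hC := sigma_gcomm hM (vx true (ix 1 1)) (vx true (ix 1 2)) (vx false (ix 1 1))
  (vx false (ix 1 2)) ex ey.
Let exa : pi (ncexp (x 1)) * pi (todd_ad (x 1) (y 2)) =
  - pi (todd_ad (x 2) (y 1)) * pi (ncexp (x 1)).
Proof.
by rewrite (todd_ad_opp (vx _ _) (vx _ _) ex ey) opprK (exp_todd_conj _ _ (vx _ _)) (qpi_lie erel).
Qed.

Lemma sigma_GT_act :
  Ell_eqv (sigma_formula (GT_act (GTPt lam f) (MPt mu Phi)))
    (GTell_act (GT_to_GTell (GTPt lam f)) (sigma_formula (MPt mu Phi))).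
Proof.
have Ap0 := sigma_Ap_nil hM; have Am0 := sigma_Am_nil hM.
split=> //; apply/qpiP.
  rewrite [RHS](congr1 pi (GTell_gp_value lam f0 Ap0 Am0)).
  (* The formulas of s evaluated at (A_+, A_-) are literally the right-hand sides of the
     compatibility lemmas. *)
  exact: (GT_compat_plus lam f0 Phi0 (vz _ _) (vt _ _) (vx _ _) hC).
rewrite [RHS](congr1 pi (GTell_gm_value lam f0 Ap0 Am0)).
exact: (GT_compat_minus lam f0 Phi0 (vz _ _) (vz _ _) (vt _ _) (vt _ _) (vx _ _) et exa hC).
Qed.

End GTPoint.

Lemma Ell_eqv_refl (k : comAlgType rat) (x : pt Ell k) : Ell_eqv x x.
Proof. by split=> //; apply/qpiP. Qed.

Lemma sigma_base_change (k k' : comAlgType rat) (phi : {rmorphism k -> k'}) (m : pt M k) :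
  sigma_formula (base_change M phi m) = base_change Ell phi (sigma_formula m).
Proof. by rewrite /sigma_formula ncmap_sigma_Ap ncmap_sigma_Am. Qed.

Theorem proposition3p8 :
  exists sigma : (forall k : comAlgType rat, pt M k -> pt Ell k),
    [/\ is_morphism sigma,
        (forall (k : comAlgType rat) (m : pt M k), is_point M m ->
           eqv Ell (sigma k m) (sigma_formula m)),
        (forall tau : (forall k : comAlgType rat, pt M k -> pt Ell k),
           is_morphism tau ->
           (forall (k : comAlgType rat) (m : pt M k), is_point M m ->
              eqv Ell (tau k m) (sigma_formula m)) ->
           forall (k : comAlgType rat) (m : pt M k), is_point M m ->
             eqv Ell (tau k m) (sigma k m))
      & (forall (k : comAlgType rat) (g : pt GT k) (m : pt M k),
           is_point GT g -> is_point M m ->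
           eqv Ell (sigma k (GT_act g m))
                   (GTell_act (GT_to_GTell g) (sigma k m)))].
Proof.
exists (fun k m => sigma_formula m); split.
- split; first by move=> k [mu Phi] hM; apply: sigma_is_Ell.
  split=> [k x y _ _ ->|k k' phi m _]; first exact: Ell_eqv_refl.
  by rewrite sigma_base_change; apply: Ell_eqv_refl.
- by move=> k m _; apply: Ell_eqv_refl.
- by move=> tau _ h k m hm; apply: h.
move=> k [lam f] [mu Phi] hg hM; have [hf _ _ _] := hg.
exact: sigma_GT_act hM hf.
Qed.
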